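(* Let $G$ be a compact metrizable group with normalized Haar measure $\mu$, let $X_1, X_2, \dots$ be i.i.d. $G$-valued random variables with distribution $\nu$ (a Borel probability measure on $G$), and set $S_k = X_1 X_2 \cdots X_k$. Suppose that $\nu$ is adapted, and that $(\nu^{*k})_{\mathrm{abs}} \neq 0$ for some $k \ge 1$. Let $f: G \to \mathbb{R}$ be Borel measurable such that $\int_G f \, \mathrm{d}\mu = 0$. (i) If $\sup_{c \in G} \mathbb{E} |f(cX_1)|^p < \infty$ for some $1 \le p \le 2$, then for any integer $m \ge 1$ and any $\varepsilon > 0$ \[ \lim_{N \to \infty} \frac{\sum_{k=1}^N f(S_k)}{\varphi_{m,\varepsilon}(N)^{1/p}} = 0 \quad \text{almost surely}. \] (ii) If $\sup_{c \in G} \mathbb{E} |f(cX_1)|^p < \infty$ for some $p > 2$, then \[ \limsup_{N \to \infty} \frac{\left| \sum_{k=1}^N f(S_k) \right|}{\sqrt{N \log\log N}} < \infty \quad \text{almost surely}. \]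
   Context: For $m \ge 1$ and $\varepsilon > 0$, $\varphi_{m,\varepsilon}(N) = N \left( \prod_{i=1}^{m-1} \log_i N \right) (\log_m N)^{1+\varepsilon}$ (for all sufficiently large $N$), where $\log_1 N = \log N$ and $\log_i N = \log\log_{i-1} N$ is the $i$-fold iterated logarithm. A Borel probability measure $\nu$ on $G$ is called adapted if its support (the smallest closed set of full $\nu$-measure) is not contained in any proper closed subgroup of $G$. $\nu^{*k}$ denotes the $k$-fold convolution of $\nu$ (the distribution of $S_k$). Its Lebesgue decomposition with respect to $\mu$ is $\nu^{*k} = (\nu^{*k})_{\mathrm{abs}} + (\nu^{*k})_{\mathrm{sing}}$, where $(\nu^{*k})_{\mathrm{abs}}$ is absolutely continuous and $(\nu^{*k})_{\mathrm{sing}}$ is singular with respect to $\mu$. $\mu$ is normalized so that $\mu(G)=1$. *)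

(* Defs.v *)
From HB Require Import structures.
From mathcomp Require Import all_boot all_order all_algebra finmap.
From mathcomp Require Import all_classical all_reals all_analysis.

Set Implicit Arguments.
Unset Strict Implicit.
Unset Printing Implicit Defensive.

Import Order.TTheory GRing.Theory Num.Theory.
Import numFieldNormedType.Exports.

Local Open Scope classical_set_scope.
Local Open Scope ring_scope.

HB.mixin Record isTopologicalGroup G & Group G & Topological G := {
  mulg_continuous : continuous (fun x : G * G => (x.1 * x.2)%g) ;
  invg_continuous : continuous (fun x : G => x^-1%g)
}.

#[short(type="topologicalGroupType")]
HB.structure Definition TopologicalGroup :=
  {G of Group G & Topological G & isTopologicalGroup G}.

HB.mixin Record isBorelGroup d G & TopologicalGroup G & Measurable d G := {
  measurable_borel : @measurable d G = <<s (@open G) >>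
}.

#[short(type="borelGroupType")]
HB.structure Definition BorelGroup d :=
  {G of TopologicalGroup G & Measurable d G & isBorelGroup d G}.

Definition metrizable (R : realType) (T : topologicalType) : Prop :=
  exists dist : T -> T -> R,
    [/\ forall x y, dist x y = 0 <-> x = y,
        forall x y, dist x y = dist y x,
        forall x y z, dist x z <= dist x y + dist y z &
        forall (x : T) (A : set T), nbhs x A <->
          exists2 e : R, 0 < e & [set y | dist x y < e] `<=` A].

Definition subgroup (G : groupType) (H : set G) : Prop :=
  [/\ H 1%g,
      forall x y, H x -> H y -> H (x * y)%g &
      forall x, H x -> H (x^-1)%g].

Section measures_on_groups.
Context {R : realType} {d : measure_display} {G : borelGroupType d}.
Local Open Scope ereal_scope.

(* On a compact group the left and right Haar probability measures coincide, and
   on a metrizable one every Borel probability measure is regular. *)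
Definition normalized_haar (mu : probability G R) : Prop :=
  forall (g : G) (A : set G), measurable A ->
    mu [set (g * x)%g | x in A] = mu A.

(* G is second countable when it is compact and metrizable, so this intersection
   has full measure: it is the smallest closed set of full measure. *)
Definition support (nu : probability G R) : set G :=
  \bigcap_(C in [set C : set G | closed C /\ nu C = 1]) C.

Definition adapted (nu : probability G R) : Prop :=
  forall H : set G, closed H -> subgroup H -> support nu `<=` H -> H = setT.

(* (m1 * m2)(A) = \int m2 (x^-1 A) dm1(x): the law of xy when x and y are
   independent with laws m1 and m2. *)
Definition convolution (m1 m2 : set G -> \bar R) (A : set G) : \bar R :=
  \int[m1]_x m2 [set y | A (x * y)%g].

Definition convolution_power (nu : set G -> \bar R) (k : nat) :
    set G -> \bar R :=
  iter k (convolution nu) (dirac (1%g : G)).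

Definition lebesgue_decomposition (m mu : set G -> \bar R)
    (m_abs m_sing : {measure set G -> \bar R}) : Prop :=
  [/\ forall A, measurable A -> m A = m_abs A + m_sing A,
      m_abs `<< mu &
      exists A, [/\ measurable A, mu A = 0 & m_sing (~` A) = 0]].

(* For a sigma-finite mu and a finite m the decomposition exists and is unique,
   so "some" decomposition is "the" decomposition. *)
Definition abs_part_neq0 (m mu : set G -> \bar R) : Prop :=
  exists m_abs m_sing : {measure set G -> \bar R},
    lebesgue_decomposition m mu m_abs m_sing /\
    exists A, measurable A /\ m_abs A != 0.

End measures_on_groups.

Section random_walk.
Context {R : realType} {dO d : measure_display} {Omega : measurableType dO}
  {G : borelGroupType d} {P : probability Omega R}.

Definition mutually_independent (X : nat -> {RV P >-> G}) : Prop :=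
  forall (J : {fset nat}) (B : nat -> set G), (forall i, measurable (B i)) ->
    P (\bigcap_(i in [set` J]) (X i @^-1` B i)) =
    (\prod_(i <- J) P (X i @^-1` B i))%E.

Definition iid_with_law (nu : probability G R) (X : nat -> {RV P >-> G}) :
    Prop :=
  mutually_independent X /\
  forall i (A : set G), measurable A -> distribution P (X i) A = nu A.

(* The steps are indexed from 0: X 0 is the first one, and S_k is the product
   of the first k of them. *)
Definition walk (X : nat -> {RV P >-> G}) (k : nat) (w : Omega) : G :=
  (\prod_(i < k) X i w)%g.

Definition walk_sum (X : nat -> {RV P >-> G}) (f : G -> R) (N : nat)
    (w : Omega) : R :=
  \sum_(1 <= k < N.+1) f (walk X k w).

End random_walk.

Definition iterated_log (R : realType) (i : nat) (x : R) : R := iter i (@ln R) x.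

(* Where an iterated logarithm is not defined, ln takes the value 0; only large
   N matter. *)
Definition varphi (R : realType) (m : nat) (eps : R) (N : nat) : R :=
  N%:R * (\prod_(1 <= i < m) iterated_log i N%:R)
       * (iterated_log m N%:R) `^ (1 + eps).

(* Main.v *)
(* Steinhaus applied to the absolutely continuous part bounds some power of [nu]
   below by a multiple of [mu] on an open set; adaptedness and compactness spread
   this, so that a sum of powers dominates a multiple of [mu].  Averages of the
   transition operator then contract mean-zero functions, and the Poisson equation
   [h - K h = K f] has a bounded solution, where [K F s] is the mean of [F (s x)]
   for [x] distributed by [nu].  With
   [D (s, x) = f (s x) - K f s + h (s x) - K h s = f (s x) + h (s x) - h s] the walk
   sum is a martingale plus a bounded coboundary, and the increments [D (S_k, X_k)]
   have conditional [p]-th moments bounded uniformly.  Part (i) follows by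
   truncation, Kolmogorov's maximal inequality and Kronecker's lemma, since
   [1 / varphi] is summable; part (ii) by truncation and an exponential
   supermartingale bound over dyadic blocks. *)

Require Import Defs.
From HB Require Import structures.
From mathcomp Require Import all_boot all_order all_algebra finmap.
From mathcomp Require Import all_classical all_reals all_analysis.
From mathcomp Require Import measurable_realfun ring lra.

Set Implicit Arguments.
Unset Strict Implicit.
Unset Printing Implicit Defensive.

Import Order.TTheory GRing.Theory Num.Theory.
Import numFieldNormedType.Exports.

Local Open Scope classical_set_scope.
Local Open Scope ring_scope.

(** A sum of powers is needed because one power may never dominate a multiple of [mu]: the point
    mass at the generator of a two-element group is adapted, yet its powers alternate between the
    two points. The contraction is therefore proved for an average of [N] consecutive powers, and
    the passage from this average back to [K] is algebraic. The function [f] may be unbounded, but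
    the supremum over translates in the moment hypothesis makes [K f] bounded. This is why the
    Poisson equation is posed for [K f]: all unboundedness is confined to the increments
    [D (S_k, X_k)]. These increments are neither independent nor identically distributed; what is
    known is a [p]-th moment bound uniform in the current position. Truncation levels are thus
    chosen so that the tail bound [C t_k ^ (- p)] itself is summable, which is how summability of
    [1 / varphi] enters. Conditional expectations are avoided. The past and the next step have a
    product joint law, so each martingale or supermartingale property becomes an inequality for an
    inner integral against [nu] with the past frozen. *)

(** * Second countability and measurability of the group operations *)

Lemma compact_finite_subcover (T : topologicalType) (J : choiceType)
    (f : J -> set T) :
  compact [set: T] -> (forall i, open (f i)) -> (forall x, exists i, f i x) ->
  exists s : seq J, forall x, exists2 i, i \in s & f i x.
Proof.
move=> cT fo fcov; have [[x0 _]|noT] := pselect (exists x : T, True); last first.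
  by exists [::] => x; case: noT; exists x.
pose T' := HB.pack_for ptopologicalType T (isPointed.Build T x0).
have : @compact T' setT := cT.
rewrite compact_cover => /(_ _ setT f).
case=> [i _|x _|D _ cov]; first exact: fo.
  by have [i fix_] := fcov x; exists i.
by exists (enum_fset D) => x; have [i /= iD fi] := cov x I; exists i.
Qed.

(** For each [n], compactness leaves finitely many centres whose balls of radius [1 / (n + 1)]
    cover. The countable base so obtained links the Borel sets of [G] to the product sigma-algebra
    on [G * G]. *)
Lemma metrizable_compact_basis (R : realType) (T : topologicalType) :
  metrizable R T -> compact [set: T] ->
  exists B : nat -> set T, (forall n, open (B n)) /\
    forall x A, nbhs x A -> exists n, B n x /\ B n `<=` A.
Proof.
move=> [dist [d0 dC dT dN]] cT.
have ball_nbhs x e : 0 < e -> nbhs x [set y | dist x y < e].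
  by move=> e0; apply/dN; exists e.
pose f (n : nat) (z : T) : set T := ([set y | dist z y < n.+1%:R^-1])°.
have fx n z : f n z z by apply: ball_nbhs; rewrite invr_gt0 ltr0n.
have fsub n z y : f n z y -> dist z y < n.+1%:R^-1 by exact: nbhs_singleton.
have /choice[D Dcov] : forall n, exists s : seq T, forall x,
    exists2 z, z \in s & f n z x.
  move=> n; apply: compact_finite_subcover => // [z|x]; last by exists x.
  exact: open_interior.
(* [k] codes a radius index and a position in the corresponding list of centres; codes that denote
   no centre give [set0]. *)
exists (fun k => if @choice.unpickle (nat * nat)%type k is Some p then
  if seq.onth (D p.1) p.2 is Some z then f p.1 z else set0 else set0).
split=> [k|x A /dN[e e0 eA]].
  case: choice.unpickle => [[n i]|]; last exact: open0.
  by case: seq.onth => [z|] /=; [exact: open_interior|exact: open0].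
(* Half of [e], since [x] and [y] are each compared with the common centre [z]. *)
have [n ne] : exists n : nat, n.+1%:R^-1 < e / 2.
  have [//|n] := @ltr_add_invr R 0 (e / 2); first exact: divr_gt0.
  by rewrite add0r; exists n.
have [z zD fzx] := Dcov n x.
exists (choice.pickle (n, index z (D n))); rewrite choice.pickleK /=.
have -> : seq.onth (D n) (index z (D n)) = Some z.
  by rewrite seq.onthE (nth_map z) ?index_mem// nth_index.
split=> // y fzy; apply: eA => /=; apply: le_lt_trans (dT _ z _) _.
rewrite (splitr e) ltrD// (lt_trans _ ne)//; last exact: fsub.
by rewrite dC; exact: fsub.
Qed.

Lemma continuous_borel_measurable d d' (G : borelGroupType d)
    (H : borelGroupType d') (phi : G -> H) :
  continuous phi -> measurable_fun setT phi.
Proof.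
move=> cphi; apply: (measurability _ (measurable_borel (s := H))).
move=> _ [U oU <-]; rewrite setTI measurable_borel.
apply: sub_sigma_algebra; exact: open_comp.
Qed.

Section borel_group.
Context (R : realType) (d : measure_display) (G : borelGroupType d).
Hypothesis G_compact : compact [set: G].
Hypothesis G_metrizable : metrizable R G.

(** Continuity alone does not suffice, as [G * G] carries the product sigma-algebra. The preimage of
    an open set is open, hence a countable union of those basic rectangles that it contains. *)
Lemma measurable_mulg : measurable_fun setT (fun z : G * G => (z.1 * z.2)%g).
Proof.
have [B [Bo Bb]] := metrizable_compact_basis G_metrizable G_compact.
have Bm n : measurable (B n).
  by rewrite measurable_borel; apply: sub_sigma_algebra; exact: Bo.
apply: (measurability _ (measurable_borel (s := G))).
move=> _ [U oU <-]; rewrite setTI.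
pose I (n m : nat) := B n `*` B m `<=` [set z : G * G | U (z.1 * z.2)%g].
rewrite (_ : _ @^-1` _ =
    \bigcup_n \bigcup_m if `[< I n m >] then B n `*` B m else set0).
  apply: bigcupT_measurable => n; apply: bigcupT_measurable => m.
  by case: ifP => // _; exact: measurableX.
apply/seteqP; split=> [[x y] /= Uxy|z [n _ [m _]]]; last first.
  by case: ifP => // /asboolP; apply.
have : nbhs (x, y) [set z : G * G | U (z.1 * z.2)%g].
  apply: mulg_continuous; exact: open_nbhs_nbhs.
case=> -[V W]/= [/Bb[n [Bnx BnV]] /Bb[m [Bmy BmW]]] VW.
exists n => //; exists m => //; case: ifPn => [_ //|/asboolP].
by case=> z [/BnV ? /BmW ?]; exact: VW.
Qed.

Lemma measurable_invg : measurable_fun setT (fun x : G => (x^-1)%g).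
Proof. by apply: continuous_borel_measurable; exact: invg_continuous. Qed.

Lemma measurable_fun_mulg d' (T : measurableType d') (u v : T -> G) :
  measurable_fun setT u -> measurable_fun setT v ->
  measurable_fun setT (fun t => (u t * v t)%g).
Proof.
move=> mu mv; have -> : (fun t => (u t * v t)%g) =
  (fun z : G * G => (z.1 * z.2)%g) \o (fun t => (u t, v t)) by [].
by apply: measurableT_comp; [exact: measurable_mulg|exact: measurable_fun_pair].
Qed.

Lemma measurable_fun_invg d' (T : measurableType d') (u : T -> G) :
  measurable_fun setT u -> measurable_fun setT (fun t => (u t)^-1%g).
Proof.
have -> : (fun t => (u t)^-1%g) = (fun x : G => (x^-1)%g) \o u by [].
by apply: measurableT_comp; exact: measurable_invg.
Qed.

Lemma measurable_lmulg (g : G) : measurable_fun setT (fun x : G => (g * x)%g).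
Proof. by apply: measurable_fun_mulg. Qed.

Lemma measurable_rmulg (g : G) : measurable_fun setT (fun x : G => (x * g)%g).
Proof. by apply: measurable_fun_mulg. Qed.

End borel_group.

(** * Convolution powers of a probability measure *)

Section convolution.
Context (R : realType) (d : measure_display) (G : borelGroupType d).
Hypothesis G_compact : compact [set: G].
Hypothesis G_metrizable : metrizable R G.
Local Open Scope ereal_scope.

Let mulg_meas := measurable_mulg G_compact G_metrizable.

Let mulgM : {mfun (G * G)%type >-> G} :=
  HB.pack_for {mfun (G * G)%type >-> G} (fun z : G * G => (z.1 * z.2)%g)
    (isMeasurableFun.Build _ _ _ _ _ mulg_meas).

Lemma measurable_convolution_integrand (g : G -> \bar R) :
  measurable_fun setT g ->
  measurable_fun setT (fun z : G * G => g (z.1 * z.2)%g).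
Proof. by move=> mg; apply: (measurableT_comp mg). Qed.

Lemma measurable_lmulg_comp d' (T : measurableType d') (g : G -> T) x :
  measurable_fun setT g -> measurable_fun setT (fun y => g (x * y)%g).
Proof.
by move=> mg; apply: (measurableT_comp mg); exact: (measurable_lmulg G_compact G_metrizable).
Qed.

Lemma measurable_integral_mulg (m : probability G R) (g : G -> \bar R) :
  measurable_fun setT g -> (forall x, 0 <= g x) ->
  measurable_fun setT (fun x => \int[m]_y g (x * y)%g).
Proof.
move=> mg g0.
by apply: (measurable_fun_fubini_tonelli_F (fun z : G * G => g (z.1 * z.2)%g)) => //;
  exact: measurable_convolution_integrand.
Qed.

Definition is_convolution (m1 m2 m : probability G R) :=
  forall A, measurable A -> m A = convolution m1 m2 A.

Lemma convolution_pushforward (m1 m2 : probability G R) A : measurable A ->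
  convolution m1 m2 A =
  distribution (m1 \x m2) mulgM A.
Proof.
move=> mA; rewrite /convolution /distribution /pushforward /product_measure1/=.
apply: eq_integral => x _; congr (m2 _); apply/seteqP; split=> y /=.
  by move=> Axy; rewrite /xsection/= inE.
by rewrite /xsection/= inE.
Qed.

Lemma is_convolution_exists (m1 m2 : probability G R) :
  exists m, is_convolution m1 m2 m.
Proof.
by exists (distribution (m1 \x m2) mulgM) => A /convolution_pushforward.
Qed.

Lemma ge0_integral_convolution (m1 m2 m : probability G R) (g : G -> \bar R) :
  is_convolution m1 m2 m -> measurable_fun setT g -> (forall x, 0 <= g x) ->
  \int[m]_z g z = \int[m1]_x \int[m2]_y g (x * y)%g.
Proof.
move=> mE mg g0.
rewrite [LHS](eq_measure_integral (distribution (m1 \x m2) mulgM)); last first.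
  by move=> A mA _; exact: etrans (mE A mA) (convolution_pushforward m1 m2 mA).
rewrite ge0_integral_distribution// fubini_tonelli1//; last by move=> z; exact: g0.
exact: measurable_convolution_integrand.
Qed.

(** [convolution_power] yields bare set functions. Integrating against them calls for bundled
    measures, which agree with them on measurable sets. *)
Lemma convolution_powers_exist (nu : probability G R) :
  exists nus : nat -> probability G R, forall k A, measurable A ->
    nus k A = convolution_power nu k A.
Proof.
suff /choice[nus] : forall k, exists m : probability G R, forall A,
  measurable A -> m A = convolution_power nu k A by exists nus.
elim=> [|k [m mE]]; first by exists (dirac 1%g).
have [m' m'E] := is_convolution_exists nu m.
exists m' => A mA; rewrite m'E//; apply: eq_integral => x _.
by rewrite mE//; rewrite -[X in measurable X]setTI; exact: (measurable_lmulg G_compact G_metrizable).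
Qed.

Section powers.
Variables (nu : probability G R) (nus : nat -> probability G R).
Hypothesis nusE : forall k A, measurable A ->
  nus k A = convolution_power nu k A.

Lemma ge0_integral_power0 (g : G -> \bar R) : measurable_fun setT g ->
  (forall x, 0 <= g x) -> \int[nus 0%N]_y g y = g 1%g.
Proof.
move=> mg g0; rewrite [LHS](eq_measure_integral (dirac 1%g)); last first.
  by move=> A mA _; exact: (nusE 0 mA).
by rewrite integral_dirac// diracT mul1e.
Qed.

Lemma ge0_integral_powerS k (g : G -> \bar R) : measurable_fun setT g ->
  (forall x, 0 <= g x) ->
  \int[nus k.+1]_z g z = \int[nu]_x \int[nus k]_y g (x * y)%g.
Proof.
apply: ge0_integral_convolution => A mA; rewrite nusE//.
apply: eq_integral => x _; rewrite nusE//.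
by rewrite -[X in measurable X]setTI; exact: (measurable_lmulg G_compact G_metrizable).
Qed.

(** The Chapman-Kolmogorov relation: unfolding one step at a time on the left reduces it to
    associativity in [G]. *)
Lemma ge0_integral_powerD j k (g : G -> \bar R) : measurable_fun setT g ->
  (forall x, 0 <= g x) ->
  \int[nus (j + k)%N]_z g z = \int[nus j]_x \int[nus k]_y g (x * y)%g.
Proof.
elim: j g => [|j IH] g mg g0.
  rewrite add0n ge0_integral_power0; first 1 last.
  - exact: measurable_integral_mulg.
  - by move=> x; exact: integral_ge0.
  by apply: eq_integral => y _; rewrite mul1g.
rewrite addSn !ge0_integral_powerS//; last 2 first.
- exact: measurable_integral_mulg.
- by move=> x; exact: integral_ge0.
apply: eq_integral => x _; rewrite IH//; last exact: measurable_lmulg_comp.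
by apply: eq_integral => y _; apply: eq_integral => z _; rewrite mulgA.
Qed.

End powers.
End convolution.

(** * Two-sided invariance of the Haar measure *)

Section haar.
Context (R : realType) (d : measure_display) (G : borelGroupType d).
Hypothesis G_compact : compact [set: G].
Hypothesis G_metrizable : metrizable R G.
Variable mu : probability G R.
Hypothesis mu_haar : normalized_haar mu.
Local Open Scope ereal_scope.

Let mlmulg := measurable_lmulg G_compact G_metrizable.
Let mmulg d' (T : measurableType d') := @measurable_fun_mulg _ _ _ G_compact G_metrizable d' T.

Lemma haar_lmulg (g : G) A : measurable A -> mu [set x | A (g * x)%g] = mu A.
Proof.
move=> mA; rewrite -(mu_haar g^-1%g mA); congr (mu _).
apply/seteqP; split=> [x /= Agx|_ [x Ax <-]] /=; last by rewrite mulVKg.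
by exists (g * x)%g => //; rewrite mulKg.
Qed.

Lemma ge0_integral_haar_lmulg (c : G) (g : G -> \bar R) :
  measurable_fun setT g -> (forall x, 0 <= g x) ->
  \int[mu]_x g (c * x)%g = \int[mu]_x g x.
Proof.
move=> mg g0.
have := ge0_integral_pushforward (mlmulg c) mu measurableT mg (fun x _ => g0 x).
rewrite preimage_setT => <-; apply: eq_measure_integral => A mA _.
exact: haar_lmulg.
Qed.

(** Unimodularity from left invariance and finite mass: integrate [g (x^-1 * y)] over both
    variables. The inner integral in [x] is that of [g x^-1], the inner integral in [y] is that of
    [g], and Tonelli equates the two. *)
Lemma ge0_integral_haar_invg (g : G -> \bar R) :
  measurable_fun setT g -> (forall x, 0 <= g x) ->
  \int[mu]_x g x^-1%g = \int[mu]_x g x.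
Proof.
move=> mg g0.
have mginv : measurable_fun setT (fun x => g x^-1%g).
  by apply: (measurableT_comp mg); exact: measurable_invg.
have constE (c : \bar R) : 0 <= c -> \int[mu]_x (cst c) x = c.
  by move=> c0; rewrite integral_cst//= probability_setT mule1.
have I0 : 0 <= \int[mu]_x g x by exact: integral_ge0.
have J0 : 0 <= \int[mu]_x g x^-1%g by exact: integral_ge0.
rewrite -[LHS]constE// -[RHS]constE//.
transitivity (\int[mu]_y \int[mu]_x g (x^-1 * y)%g).
  apply: eq_integral => y _.
  rewrite -(ge0_integral_haar_lmulg y^-1%g (g := fun x => g x^-1%g))//.
  by apply: eq_integral => x _; rewrite invgM invgK.
rewrite -(fubini_tonelli (fun z : G * G => g (z.1^-1 * z.2)%g))//=; last first.
  apply: (measurableT_comp mg); apply: mmulg => //.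
  by apply: measurable_fun_invg; exact: measurable_fst.
by apply: eq_integral => x _; exact: ge0_integral_haar_lmulg.
Qed.

(** Inversion conjugates right translation by [c] into left translation by [c^-1]. *)
Lemma ge0_integral_haar_rmulg (c : G) (g : G -> \bar R) :
  measurable_fun setT g -> (forall x, 0 <= g x) ->
  \int[mu]_x g (x * c)%g = \int[mu]_x g x.
Proof.
move=> mg g0.
have mgc : measurable_fun setT (fun x => g (x * c)%g).
  by apply: (measurableT_comp mg); exact: (measurable_rmulg G_compact G_metrizable).
have mginv : measurable_fun setT (fun x => g x^-1%g).
  by apply: (measurableT_comp mg); exact: measurable_invg.
rewrite -[LHS]ge0_integral_haar_invg// -[RHS]ge0_integral_haar_invg//.
rewrite -[RHS](ge0_integral_haar_lmulg c^-1%g)//.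
by apply: eq_integral => x _; rewrite invgM invgK.
Qed.

(** Multiplication is continuous at each [(1, x)]; compactness makes the neighbourhood of [1]
    uniform in [x]. No invariance of the distance is assumed. *)
Lemma near1_dist_small (dist : G -> G -> R) (e : R) :
  (forall x y, dist x y = dist y x) ->
  (forall x y z, dist x z <= dist x y + dist y z)%R ->
  (forall (x : G) (A : set G), nbhs x A <->
          exists2 e : R, 0 < e & [set y | dist x y < e] `<=` A)%R ->
  (0 < e)%R -> \forall v \near (1%g : G), forall x, (dist x (v * x)%g < e)%R.
Proof.
move=> dC dT dN e0.
have cov := (compact_near_coveringP [set: G]).1 G_compact G (nbhs (1%g : G))
  (fun v x => (dist x (v * x)%g < e)%R) _.
suff : \forall v \near (1%g : G), [set: G] `<=` (fun x => (dist x (v * x)%g < e)%R).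
  by apply: filterS => v Vv x; exact: Vv.
apply: cov => x _.
have Nx : nbhs x [set y | (dist x y < e / 2)%R].
  by apply/dN; exists (e / 2)%R => //; exact: divr_gt0.
have : nbhs (1 * x)%g [set y | (dist x y < e / 2)%R] by rewrite mul1g.
move=> /(@mulg_continuous G (1%g, x))[[V W] [/= V1 Wx] VW].
exists (W `&` [set y | (dist x y < e / 2)%R], V).
  by split=> //=; exact: filterI.
move=> [x' v] [/= [Wx' dx'] Vv]; apply: (le_lt_trans (dT _ x _)).
by rewrite (splitr e) ltrD// ?(dC x' x)//; exact: (VW (v, x')).
Qed.

End haar.

(** * Continuity of translations in measure and the Steinhaus argument *)

Lemma measure_nonincreasing_lt d (T : measurableType d) (R : realType)
    (mu : probability T R) (D : nat -> set T) (e : R) :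
  (forall n, measurable (D n)) -> nonincreasing_seq D ->
  \bigcap_n D n = set0 -> 0 < e -> exists n, (mu (D n) < e%:E)%E.
Proof.
move=> mD niD D0 e0.
have : mu (D n) @[n --> \oo] --> mu (\bigcap_n D n).
  apply: nonincreasing_cvg_mu => //; last exact: bigcapT_measurable.
  by rewrite -ge0_fin_numE// fin_num_measure.
rewrite D0 measure0 => /fine_cvgP[fn /cvgrPdist_lt/(_ _ e0) fc].
have : \forall n \near \oo, (mu (D n) < e%:E)%E.
  near=> n; rewrite -[ltLHS]fineK; last by near: n.
  rewrite lte_fin; have : `|0 - fine (mu (D n))| < e by near: n.
  by rewrite sub0r normrN; exact: le_lt_trans (ler_norm _).
by move=> [n _ /(_ n (leqnn n))]; exists n.
Unshelve. all: by end_near. Qed.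

Section steinhaus.
Context (R : realType) (d : measure_display) (G : borelGroupType d).
Hypothesis G_compact : compact [set: G].
Hypothesis G_metrizable : metrizable R G.
Variable mu : probability G R.
Hypothesis mu_haar : normalized_haar mu.
Local Open Scope ereal_scope.

Let mlmulg := measurable_lmulg G_compact G_metrizable.

Let mcomp d' (T : measurableType d') (h : T -> G) A :
  measurable_fun setT h -> measurable A -> measurable [set x | A (h x)].
Proof. by move=> mh mA; rewrite -[X in measurable X]setTI; exact: mh. Qed.

(** Continuity at [1] of the translates of [A] in measure. A one-sided difference is enough, since
    both halves of the symmetric difference of a set and its translate have equal mass. *)
Definition translation_small (A : set G) := forall e : R, (0 < e)%R ->
  \forall v \near (1%g : G), mu [set x | A x /\ ~ A (v * x)%g] < e%:E.

Let mdiff (A : set G) (v : G) : measurable A -> measurable [set x | A x /\ ~ A (v * x)%g].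
Proof.
move=> mA; apply: measurableI => //.
exact: (mcomp (A := ~` A) (mlmulg v) (measurableC mA)).
Qed.

Lemma translation_smallC A : measurable A -> translation_small A ->
  translation_small (~` A).
Proof.
move=> mA sA e e0; apply: filterS (sA e e0) => v; rewrite /setC/=.
suff -> : mu [set x | ~ A x /\ ~ ~ A (v * x)%g] =
          mu [set x | A x /\ ~ A (v * x)%g] by [].
have mAv : measurable [set x | A (v * x)%g] by exact: mcomp.
rewrite (_ : [set x | _] = [set x | A (v * x)%g] `\` A); last first.
  by apply/seteqP; split=> x /= [? ?]; split=> //; exact: contrapT.
rewrite (_ : [set x | _ /\ _] = A `\` [set x | A (v * x)%g])//.
rewrite !measureD//; try by rewrite -ge0_fin_numE// fin_num_measure.
by rewrite setIC; congr (_ - _); exact: haar_lmulg.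
Qed.

(** Half of [e] covers the mass missed by a finite subunion; the other half is shared equally among
    its [N] members. *)
Lemma translation_small_bigcup (F : nat -> set G) :
  (forall n, measurable (F n)) -> (forall n, translation_small (F n)) ->
  translation_small (\bigcup_n F n).
Proof.
move=> mF sF e e0; pose U := \bigcup_n F n.
pose V N := \big[setU/set0]_(i < N) F i.
have mV N : measurable (V N) by exact: bigsetU_measurable.
have mU : measurable U by exact: bigcupT_measurable.
have [N VN] : exists N, mu (U `\` V N) < (e / 2)%:E.
  apply: measure_nonincreasing_lt.
  - by move=> n; exact: measurableD.
  - move=> m n mn; apply/subsetPset; apply: setDS; exact: subset_bigsetU.
  - apply/seteqP; split=> // x Ux; have [[n _ Fnx] _] := Ux 0%N Logic.I.
    have [_] := Ux n.+1 Logic.I; apply.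
    by rewrite /V -bigcup_mkord; exists n => //=.
  - exact: divr_gt0.
have : \forall v \near (1%g : G), forall i : 'I_N,
    mu [set x | F i x /\ ~ F i (v * x)%g] < (e / 2 / N%:R)%:E.
  have [->|N0] := posnP N; first by near=> v => -[].
  apply: filter_forall => i; apply: sF.
  by rewrite !divr_gt0 ?ltr0n.
apply: filterS => v Hv.
have sub : [set x | U x /\ ~ U (v * x)%g] `<=` (U `\` V N) `|`
    \big[setU/set0]_(i < N) [set x | F i x /\ ~ F i (v * x)%g].
  move=> x [Ux nUvx]; have [Vx|] := pselect (V N x); last by left; split.
  right; move: Vx; rewrite /V -bigcup_mkord => -[i /= iN Fx].
  rewrite -(bigcup_mkord N (fun i => [set x | F i x /\ ~ F i (v * x)%g])).
  by exists i => //=; split=> // Fi; apply: nUvx; exists i.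
have mb : measurable (\big[setU/set0]_(i < N) [set x | F i x /\ ~ F i (v * x)%g]).
  by apply: bigsetU_measurable => i _; exact: mdiff.
have mUV : measurable (U `\` V N) by exact: measurableD.
apply: (@le_lt_trans _ _ (mu ((U `\` V N) `|`
    \big[setU/set0]_(i < N) [set x | F i x /\ ~ F i (v * x)%g]))).
  by apply: le_measure; rewrite ?inE//; [exact: mdiff|exact: measurableU].
apply: (le_lt_trans (measureU2 _ mUV mb)).
rewrite (splitr e) EFinD lte_leD//; first by rewrite fin_num_measure.
apply: (le_trans (Boole_inequality mu
  (A := fun i => [set x | F i x /\ ~ F i (v * x)%g]) _)).
  by move=> i iN; exact: mdiff.
apply: (@le_trans _ _ (\sum_(i < N) (e / 2 / N%:R)%:E)).
  by apply: lee_sum => i _; exact: ltW (Hv i).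
have [->|N0] := posnP N; first by rewrite big_ord0 lee_fin divr_ge0// ltW.
rewrite sumEFin lee_fin sumr_const card_ord -[leLHS]mulr_natr divfK//.
by rewrite pnatr_eq0 -lt0n.
Unshelve. all: by end_near. Qed.

(** The sets [W n] of points whose [1 / (n + 1)]-ball lies in [U] exhaust [U], and a translation
    that moves every point by less than [1 / (n + 1)] keeps [W n] inside [U]. *)
Lemma translation_small_open (U : set G) : open U -> translation_small U.
Proof.
move=> oU e e0; have [dist [_ dC dT dN]] := G_metrizable.
pose W (n : nat) := [set x | forall y, (dist x y < n.+1%:R^-1)%R -> U y].
have W0 n : (0 < n.+1%:R^-1 :> R)%R by rewrite invr_gt0.
have mW n : measurable (W n).
  rewrite -[W n]setCK; apply: measurableC; rewrite measurable_borel.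
  apply: sub_sigma_algebra => /=; rewrite openE => x /=.
  rewrite /W /= => /existsNP[y /not_implyP[dxy Uy]].
  apply/dN; exists (n.+1%:R^-1 - dist x y)%R; first by rewrite subr_gt0.
  move=> z /=; rewrite ltrBrDl => dxz Wz; apply: Uy; apply: Wz.
  by apply: le_lt_trans dxz; rewrite addrC (dC x z); exact: dT.
have mU : measurable U by rewrite measurable_borel; exact: sub_sigma_algebra.
have [n Wn] : exists n, mu (U `\` W n) < e%:E.
  apply: measure_nonincreasing_lt => //.
  - by move=> n; exact: measurableD.
  - move=> m n mn; apply/subsetPset; apply: setDS => x Wx y dxy.
    apply: Wx; apply: lt_le_trans dxy _.
    by rewrite lef_pV2 ?posrE// ler_nat.
  - apply/seteqP; split=> // x Ux; have [Ux0 _] := Ux 0%N Logic.I.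
    have /dN[r r0 rU] : nbhs x U by exact: open_nbhs_nbhs.
    have [//|n] := @ltr_add_invr R 0%R r; rewrite add0r => nr.
    have [_] := Ux n Logic.I; apply => y dxy.
    by apply: rU => /=; exact: lt_trans nr.
apply: filterS (near1_dist_small G_compact dC dT dN (W0 n)) => v Hv.
apply: le_lt_trans Wn; apply: le_measure; rewrite ?inE.
- exact: mdiff.
- exact: measurableD.
- by move=> x /= [Ux Uvx]; split=> // Wx; apply: Uvx; exact: Wx.
Qed.

(** The measurable sets with this property form a sigma-algebra that contains the open sets. *)
Lemma translation_small_measurable (A : set G) : measurable A ->
  translation_small A.
Proof.
rewrite measurable_borel => mA.
suff : (<<s @open G >>) `<=` [set A | measurable A /\ translation_small A].
  by move=> /(_ _ mA)[].
apply: smallest_sub; last first.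
  move=> U oU; split; last exact: translation_small_open.
  by rewrite measurable_borel; exact: sub_sigma_algebra.
split => /=.
- by split=> //; apply: translation_small_open; exact: open0.
- move=> B [mB sB]; rewrite setTD; split; first exact: measurableC.
  exact: translation_smallC.
- move=> F HF; split; first by apply: bigcupT_measurable => n; have [] := HF n.
  by apply: translation_small_bigcup => n; have [] := HF n.
Qed.

Lemma rmulg_continuous (g : G) : continuous (fun x : G => (x * g)%g).
Proof.
move=> x A /(@mulg_continuous G (x, g))[[V W] [/= Vx Wg] VW].
apply: (@filterS _ (nbhs x) _ V) => // y Vy.
exact: (VW (y, g) (conj Vy (nbhs_singleton Wg))).
Qed.

(* Steinhaus: the convolution of [\1_A] with itself is not null, and continuity of
   translations in measure spreads a positive value to a neighbourhood. *)
Lemma convolution_density_lower_bound (A : set G) : measurable A -> 0 < mu A ->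
  exists (e : R) (U : set G), [/\ (0 < e)%R, open U, U !=set0 &
    forall y, U y -> e%:E <= mu [set x | A x /\ A (x^-1 * y)%g]].
Proof.
move=> mA A0; pose theta (y : G) := mu [set x | A x /\ A (x^-1 * y)%g].
have minv : measurable_fun setT (fun x : G => x^-1%g) by exact: measurable_invg.
have mxy : measurable_fun setT (fun z : G * G => (z.2^-1 * z.1)%g).
  apply: (measurable_fun_mulg G_compact G_metrizable) => //.
  by apply: measurable_fun_invg; exact: measurable_snd.
have mind : measurable_fun setT (\1_A : G -> R) by exact: measurable_indic.
have mAy y : measurable [set x | A (x^-1 * y)%g].
  by apply: mcomp => //; exact: (measurable_fun_mulg G_compact G_metrizable).
(* By Tonelli and left invariance [theta] integrates to the square of [mu A], so it cannot vanish
   everywhere. *)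
have [y0 y0P] : exists y, 0 < theta y.
  apply: contrapT => /forallNP H.
  have th0 y : theta y = 0.
    by apply/eqP; rewrite eq_le measure_ge0 andbT leNgt; apply/negP/H.
  pose F (z : G * G) : \bar R := (\1_A z.2 * \1_A (z.2^-1 * z.1)%g)%:E.
  have mF : measurable_fun setT F.
    apply/measurable_EFinP; apply: measurable_funM.
      by apply: (measurableT_comp mind); exact: measurable_snd.
    exact: (measurableT_comp mind).
  have F0 z : 0 <= F z by rewrite lee_fin mulr_ge0.
  have E1 : \int[mu]_y \int[mu]_x F (y, x) = 0.
    apply: integral0_eq => y _; rewrite -(th0 y).
    transitivity (\int[mu]_x
        (\1_([set x | A x] `&` [set x | A (x^-1 * y)%g]) x)%:E); last first.
      by rewrite integral_indic ?setIT//; exact: measurableI.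
    by apply: eq_integral => x _; rewrite /F/= indicI.
  move: E1; rewrite (fubini_tonelli F)//.
  have -> : \int[mu]_x \int[mu]_y F (y, x) = \int[mu]_x ((\1_A x)%:E * mu A).
    apply: eq_integral => x _; rewrite /F/=.
    have mAx : measurable_fun setT (fun y => (\1_A (x^-1 * y)%g)%:E : \bar R).
      by apply/measurable_EFinP/(measurableT_comp mind)/mlmulg.
    under eq_integral do rewrite EFinM.
    rewrite ge0_integralZl//.
    congr (_ * _).
    rewrite (ge0_integral_haar_lmulg G_compact G_metrizable mu_haar x^-1%g
      (g := fun y => (\1_A y)%:E))//.
    - by rewrite integral_indic// setIT.
    - by apply/measurable_EFinP; exact: mind.
  rewrite ge0_integralZr//; last by apply/measurable_EFinP.
  rewrite integral_indic// setIT => /eqP; rewrite mule_eq0 orbb => /eqP A00.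
  by rewrite A00 ltxx in A0.
have mth y : measurable [set x | A x /\ A (x^-1 * y)%g].
  exact: (measurableI _ _ mA (mAy y)).
have [t t0 thE] : exists2 t : R, (0 < t)%R & theta y0 = t%:E.
  have fin : theta y0 \is a fin_num by rewrite fin_num_measure.
  by exists (fine (theta y0)); rewrite ?fineK// -lte_fin fineK.
have t20 : (0 < t / 2)%R by exact: divr_gt0.
(* Replacing [y0] by [v * y0] lowers [theta] by at most the mass of the points of [A] that [v] moves
   out of [A]; keeping this below [t / 2] leaves at least [t / 2]. *)
have V1 := translation_small_measurable mA t20.
pose V := [set v : G | mu [set x | A x /\ ~ A (v * x)%g] < (t / 2)%:E].
have V0 : nbhs (1%g : G) V by [].
exists (t / 2)%R, [set y | V° (y * y0^-1)%g]; split=> //.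
- apply: (@open_comp _ _ (fun y => (y * y0^-1)%g)); last exact: open_interior.
  by move=> y _; exact: rmulg_continuous.
- by exists y0; rewrite /= mulgV.
- move=> y /= /nbhs_singleton; set v := (y * y0^-1)%g; rewrite /V/= => vV.
  have yE : y = (v * y0)%g by rewrite /v mulgVK.
  clearbody v.
  have mvy : measurable [set x | A (v * x)%g /\ A (x^-1 * y0)%g].
    exact: (measurableI _ _ (mcomp (mlmulg v) mA) (mAy y0)).
  have <- : mu [set x | A (v * x)%g /\ A (x^-1 * y0)%g] =
      mu [set x | A x /\ A (x^-1 * y)%g].
    rewrite -(haar_lmulg mu_haar v (mth y)); congr (mu _).
    by apply/seteqP; split=> x /=; rewrite invgM yE -mulgA mulKg.
  rewrite leNgt; apply/negP => lt_t.
  suff : t%:E < t%:E by rewrite ltxx.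
  rewrite {2}(splitr t) EFinD -thE; apply: le_lt_trans (lteD vV lt_t).
  apply: le_trans (measureU2 _ (mdiff v mA) mvy).
  apply: le_measure; rewrite ?inE; [exact: mth|exact: measurableU (mdiff v mA) mvy|].
  move=> x /= [Ax Axy]; have [Avx|Avx] := pselect (A (v * x)%g); first by right.
  by left.
Qed.

End steinhaus.

(** * Lower bound for one convolution power on an open set *)

Lemma ge0_integralZlT d (T : measurableType d) (R : realType)
    (mu : {measure set T -> \bar R}) (c : \bar R) (g : T -> \bar R) :
  measurable_fun setT g -> (forall x, 0 <= g x)%E -> (0 <= c)%E ->
  (\int[mu]_x (c * g x) = c * \int[mu]_x g x)%E.
Proof. by move=> mg g0 c0; rewrite ge0_integralZl. Qed.

Section lower_bound.
Import HBNNSimple.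

(** Domination on sets passes to simple functions below [g] on [A], then to their supremum. *)
Lemma ge0_integral_lower_bound d (T : measurableType d) (R : realType)
    (mu m : {measure set T -> \bar R}) (A : set T) (c : R) (g : T -> \bar R) :
  measurable A -> 0 <= c ->
  (forall B, measurable B -> c%:E * mu (B `&` A) <= m B)%E ->
  measurable_fun setT g -> (forall x, 0 <= g x)%E ->
  (c%:E * \int[mu]_x ((\1_A x)%:E * g x) <= \int[m]_x g x)%E.
Proof.
move=> mA c0 muAm mg g0.
have -> : (\int[mu]_x ((\1_A x)%:E * g x) = \int[mu]_(x in A) g x)%E.
  rewrite [RHS]integral_mkcond; apply: eq_integral => x _.
  by rewrite patchE indicE; case: ifP => _; rewrite ?mul1e ?mul0e.
rewrite -[c]/((NngNum c0)%:num) -ge0_integral_mscale//; last exact: measurable_funTS.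
rewrite !ge0_integralE//= patch_setT ge_ereal_sup// => _ [h/= hg] <-.
apply: le_ereal_sup_tmp; exists (sintegral m h).
  exists h => // x; apply: (le_trans (hg x)); rewrite /patch.
  by case: ifP.
rewrite !sintegralE lee_fsum// => r [t _ <-].
(* A level set of [h] for a nonzero value lies in [A], because [h] is at most [0] outside; this is
   what allows the bound on [B] intersected with [A] to be used. *)
have [h0|h0] := eqVneq (h t) 0%R; first by rewrite h0 !mul0e.
apply: lee_pmul; rewrite ?lee_fin//=.
rewrite /mscale/=; apply: le_trans (muAm _ _); last exact: measurable_sfunP.
rewrite (_ : _ `&` A = h @^-1` [set h t])//; apply: setIidl => x /= hx.
apply: contrapT => nAx; have := hg x; rewrite /patch memNset// hx lee_fin.
by rewrite leNgt lt_neqAle eq_sym h0 fun_ge0.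
Qed.

End lower_bound.

Section minorization.
Context (R : realType) (d : measure_display) (G : borelGroupType d).
Hypothesis G_compact : compact [set: G].
Hypothesis G_metrizable : metrizable R G.
Variable mu : probability G R.
Hypothesis mu_haar : normalized_haar mu.
Variables (nu : probability G R) (nus : nat -> probability G R).
Hypothesis nusE : forall k A, measurable A ->
  nus k A = convolution_power nu k A.
Local Open Scope ereal_scope.

(** The Radon-Nikodym density of the absolutely continuous part is not almost everywhere zero, so it
    is at least some [1 / (n + 1)] on a set of positive Haar measure. *)
Lemma absolutely_continuous_lower_bound k :
  abs_part_neq0 (convolution_power nu k) mu ->
  exists (A : set G) (e : R), [/\ measurable A, 0 < mu A, (0 < e)%R &
    forall B, measurable B -> e%:E * mu (B `&` A) <= nus k B].
Proof.
move=> [ma [ms [[mE ma_mu _] [A0 [mA0 A0neq0]]]]].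
have ma_le B : measurable B -> ma B <= nus k B.
  by move=> mB; rewrite nusE// mE// leeDl.
have maT : ma setT < +oo.
  by apply: (le_lt_trans (ma_le _ measurableT)); rewrite -ge0_fin_numE// fin_num_measure.
(* [ma] is finite because it is below [nus k]; restricting it to [setT] changes only its type. *)
pose ma' : {finite_measure set G -> \bar R} := mfrestr measurableT maT.
have ma'E B : ma' B = ma B by rewrite /ma'/= /mfrestr /mrestr setIT.
have ma'_mu : ma' `<< mu.
  apply/null_content_dominatesP => B mB B0; rewrite ma'E.
  by move/null_content_dominatesP : ma_mu; exact.
have [phi [phi0 phiint phiE']] := @radon_nikodym_finite _ _ _ mu ma' ma'_mu.
have phiE B : measurable B -> ma B = \int[mu]_(x in B) phi x.
  by move=> mB; rewrite -phiE'.
have mphi : measurable_fun setT phi by case/integrableP: phiint.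
pose A n := [set x | (n.+1%:R^-1)%:E <= phi x].
have mA n : measurable (A n).
  by rewrite -[X in measurable X]setTI; exact: emeasurable_fun_c_infty.
have [n An0] : exists n, 0 < mu (A n).
  apply: contrapT => /forallNP H.
  have An0 n : mu (A n) = 0.
    by apply/eqP; rewrite eq_le measure_ge0 andbT leNgt; apply/negP/H.
  have mUA : measurable (\bigcup_n A n) by exact: bigcupT_measurable.
  have muU0 : mu (\bigcup_n A n) = 0.
    apply/measure_negligible => //; apply: negligible_bigcup => n.
    by exists (A n); split; [exact: mA|exact: An0|].
  have maU0 : ma (\bigcup_n A n) = 0.
    by move/null_content_dominatesP : ma_mu; exact.
  move/negP : A0neq0; apply; rewrite -measure_le0.
  apply: (@le_trans _ _ (ma (A0 `\` \bigcup_n A n) + ma (A0 `&` \bigcup_n A n))).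
    rewrite -measureU//; [|exact: measurableD|exact: measurableI|]; last first.
      by rewrite -subset0 => x [[_ ?] []].
    by rewrite setUC setUIDK.
  have -> : ma (A0 `&` \bigcup_n A n) = 0.
    by apply: subset_measure0 maU0 => //; exact: measurableI.
  rewrite adde0 phiE; last exact: measurableD.
  rewrite integral0_eq// => x [_ nAx].
  apply/eqP; rewrite eq_le phi0 andbT leNgt; apply/negP => phix0; apply: nAx.
  have [r r0 rphi] : exists2 r : R, (0 < r)%R & r%:E <= phi x.
    move: phix0; case: (phi x) => [r|_|//]; first by rewrite lte_fin; exists r.
    by exists 1%R; rewrite ?leey.
  have [//|n] := @ltr_add_invr R 0%R r; rewrite add0r => nr.
  by exists n => //; rewrite /A/=; apply: le_trans rphi; rewrite lee_fin ltW.
exists (A n), (n.+1%:R^-1)%R; split => // B mB.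
apply: (@le_trans _ _ (ma (B `&` A n))); last first.
  apply: le_trans (ma_le _ (measurableI _ _ mB (mA n))) _.
  apply: le_measure; rewrite ?inE//; exact: measurableI.
rewrite phiE; last exact: measurableI.
rewrite -integral_cst; last exact: measurableI.
apply: ge0_le_integral => //; first exact: measurableI.
- by move=> x _; rewrite lee_fin invr_ge0.
- exact: measurable_funTS.
- by move=> x [].
Qed.

Let mind (A : set G) : measurable A -> measurable_fun setT (\1_A : G -> R).
Proof. by move=> mA; exact: measurable_indic. Qed.

Let mindg (A : set G) (g : G -> \bar R) : measurable A -> measurable_fun setT g ->
  measurable_fun setT (fun x => (\1_A x)%:E * g x).
Proof.
by move=> mA mg; apply: emeasurable_funM => //; apply/measurable_EFinP; exact: mind.
Qed.

Let ind_ge0 (A : set G) x : 0 <= (\1_A x : R)%:E.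
Proof. by rewrite lee_fin. Qed.

Let indg_ge0 (A : set G) x (y : \bar R) : 0 <= y -> 0 <= (\1_A x)%:E * y.
Proof. by move=> y0; exact: mule_ge0. Qed.

Let mdivlg y : measurable_fun setT (fun x : G => (x^-1 * y)%g).
Proof.
by apply: (measurable_fun_mulg G_compact G_metrizable) => //; exact: measurable_invg.
Qed.

Lemma measurable_divlg_measure (m : probability G R) (A : set G) :
  measurable A -> measurable_fun setT (fun y => m [set x | A (x^-1 * y)%g]).
Proof.
move=> mA.
have mAxy : measurable [set z : G * G | A (z.1^-1 * z.2)%g].
  have : measurable_fun setT (fun z : G * G => (z.1^-1 * z.2)%g).
    apply: (measurable_fun_mulg G_compact G_metrizable) => //.
    by apply: measurable_fun_invg; exact: measurable_fst.
  by move=> /(_ measurableT _ mA); rewrite setTI.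
rewrite (_ : (fun y => _) = (m \o ysection [set z : G * G | A (z.1^-1 * z.2)%g])).
  exact: measurable_fun_ysection.
apply/funext => y /=; congr (m _); apply/seteqP.
by split=> x; rewrite /ysection/= inE.
Qed.

(* Both sides integrate [g] against the convolution of [m] with the restriction of
   [mu] to [A]. *)
Lemma integral_haar_restriction_swap (m : probability G R) (A : set G)
    (g : G -> \bar R) : measurable A -> measurable_fun setT g ->
  (forall x, 0 <= g x) ->
  \int[m]_x \int[mu]_y ((\1_A y)%:E * g (x * y)%g) =
  \int[mu]_y (m [set x | A (x^-1 * y)%g] * g y).
Proof.
move=> mA mg g0.
pose F (z : G * G) := (\1_A (z.1^-1 * z.2)%g : R)%:E * g z.2.
have mF : measurable_fun setT F.
  apply: emeasurable_funM; last first.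
    by apply: (measurableT_comp mg); exact: measurable_snd.
  apply/measurable_EFinP; apply: (measurableT_comp (mind mA)).
  apply: (measurable_fun_mulg G_compact G_metrizable) => //.
  by apply: measurable_fun_invg; exact: measurable_fst.
have F0 z : 0 <= F z by exact: mule_ge0.
transitivity (\int[m]_x \int[mu]_y F (x, y)).
  apply: eq_integral => x _.
  rewrite -(ge0_integral_haar_lmulg G_compact G_metrizable mu_haar x
    (g := fun y => F (x, y))).
  - by apply: eq_integral => y _; rewrite /F/= mulKg.
  - by apply: (measurableT_comp mF); exact: pair1_measurable.
  - by [].
rewrite (fubini_tonelli F)//; apply: eq_integral => y _; rewrite /F/= muleC.
have mAy : measurable [set x | A (x^-1 * y)%g].
  by rewrite -[X in measurable X]setTI; exact: mdivlg.
have mi : measurable_fun setT (fun x => (\1_[set x | A (x^-1 * y)%g] x : R)%:E).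
  by apply/measurable_EFinP; exact: mind.
transitivity (g y * \int[m]_x (\1_[set x | A (x^-1 * y)%g] x)%:E); last first.
  by rewrite integral_indic// setIT muleC.
rewrite -ge0_integralZlT//.
by apply: eq_integral => x _; rewrite muleC.
Qed.

(** If [nus k] dominates [e] times [mu] on [A], then [nus (k + k)] dominates [e ^ 2] times the
    convolution of [mu] restricted to [A] with itself. The density of the latter is at least [t] on
    [U], whence the constant [e * e * t]. *)
Lemma power_density_lower_bound k :
  abs_part_neq0 (convolution_power nu k) mu ->
  exists (U : set G) (e : R), [/\ open U, U !=set0, (0 < e)%R &
    forall g : G -> \bar R, measurable_fun setT g -> (forall x, 0 <= g x) ->
    e%:E * \int[mu]_x ((\1_U x)%:E * g x) <= \int[nus (k + k)%N]_x g x].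
Proof.
move=> /absolutely_continuous_lower_bound[A [e [mA A0 e0 nusA]]].
have [t [U [t0 oU U0 tU]]] :=
  convolution_density_lower_bound G_compact G_metrizable mu_haar mA A0.
have mU : measurable U by rewrite measurable_borel; exact: sub_sigma_algebra.
exists U, (e * e * t)%R; split=> //; first by rewrite !mulr_gt0.
move=> g mg g0.
have mgx x : measurable_fun setT (fun y => g (x * y)%g).
  exact: (measurable_lmulg_comp G_compact G_metrizable).
have mK (m : probability G R) := measurable_integral_mulg G_compact G_metrizable m mg g0.
have mAy y : measurable [set x | A (x^-1 * y)%g].
  by rewrite -[X in measurable X]setTI; exact: mdivlg.
have e0' : 0 <= e%:E by rewrite lee_fin ltW.
have minner : measurable_fun setT (fun x => \int[mu]_y ((\1_A y)%:E * g (x * y)%g)).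
  apply: (measurable_fun_fubini_tonelli_F
    (fun z : G * G => (\1_A z.2)%:E * g (z.1 * z.2)%g)) => /=; last first.
    by move=> z; exact: indg_ge0.
  apply: emeasurable_funM; last exact: measurable_convolution_integrand.
  apply/measurable_EFinP; apply: (measurableT_comp (mind mA)); exact: measurable_snd.
rewrite (ge0_integral_powerD G_compact G_metrizable nusE)//.
apply: (@le_trans _ _ (\int[nus k]_x (e%:E * \int[mu]_y ((\1_A y)%:E * g (x * y)%g)))).
  rewrite ge0_integralZlT//; last by move=> x; apply: integral_ge0 => y _; exact: indg_ge0.
  rewrite integral_haar_restriction_swap//.
  rewrite !EFinM -!muleA; apply: lee_wpmul2l => //.
  have et0 : 0 <= e%:E * t%:E by rewrite mule_ge0// lee_fin ltW.
  rewrite muleA -(ge0_integralZlT mu (mindg mU mg) (fun x => indg_ge0 U x (g0 x)) et0).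
  apply: ge0_le_integral => //.
  - by move=> y _; rewrite mule_ge0 ?indg_ge0.
  - by apply: measurable_funeM; exact: mindg.
  - by apply: emeasurable_funM => //; exact: measurable_divlg_measure.
  - move=> y _; rewrite indicE; case: (boolP (y \in U)) => [/set_mem Uy|_]; last first.
      by rewrite mul0e mule0 mule_ge0.
    rewrite mul1e; apply: lee_wpmul2r => //.
    apply: le_trans (nusA _ (mAy y)); apply: lee_wpmul2l => //.
    by rewrite setIC; exact: tU.
apply: ge0_le_integral => //.
- by move=> x _; rewrite mule_ge0// integral_ge0// => y _; exact: indg_ge0.
- exact: measurable_funeM.
- by move=> x _; apply: ge0_integral_lower_bound => //; exact: ltW.
Qed.
End minorization.

(** * Points reached by the powers of an adapted measure *)

Section adapted_walk.
Context (R : realType) (d : measure_display) (G : borelGroupType d).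
Hypothesis G_compact : compact [set: G].
Hypothesis G_metrizable : metrizable R G.
Variable mu : probability G R.
Hypothesis mu_haar : normalized_haar mu.
Variables (nu : probability G R) (nus : nat -> probability G R).
Hypothesis nusE : forall k A, measurable A ->
  nus k A = convolution_power nu k A.
Local Open Scope ereal_scope.

Let open_meas (U : set G) : open U -> measurable U.
Proof. by move=> oU; rewrite measurable_borel; exact: sub_sigma_algebra. Qed.

(** The closure of the union of the supports of all powers, written through charged neighbourhoods.
    Power [0] is included and accounts for the identity. *)
Definition reachable : set G :=
  [set x | forall W, open W -> W x -> exists j, 0 < nus j W].

Let mind (A : set G) : measurable A -> measurable_fun setT (fun x => (\1_A x : R)%:E).
Proof. by move=> mA; apply/measurable_EFinP; exact: measurable_indic. Qed.

Let ind_ge0 (A : set G) x : 0 <= (\1_A x : R)%:E.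
Proof. by rewrite lee_fin. Qed.

Lemma reachable1 : reachable 1%g.
Proof.
move=> W /open_meas mW W1; exists 0%N.
rewrite -[W]setIT -(integral_indic _ measurableT mW).
rewrite (ge0_integral_power0 nusE (mind mW) (ind_ge0 W)) indicE mem_set//.
Qed.

Lemma reachableM x y : reachable x -> reachable y -> reachable (x * y)%g.
Proof.
move=> rx ry W oW Wxy.
have : nbhs (x * y)%g W by exact: open_nbhs_nbhs.
move=> /(@mulg_continuous G (x, y))[[V1 V2] [/= V1x V2y] VW].
have [i i0] := rx V1° (@open_interior _ _) V1x.
have [j j0] := ry V2° (@open_interior _ _) V2y.
have mV1 := open_meas (@open_interior _ V1).
have mV2 := open_meas (@open_interior _ V2).
have mW := open_meas oW.
exists (i + j)%N.
rewrite -[W]setIT -(integral_indic _ measurableT mW).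
rewrite (ge0_integral_powerD G_compact G_metrizable nusE _ _ (mind mW) (ind_ge0 W)).
apply: (@lt_le_trans _ _ (nus i V1° * nus j V2°)); first exact: mule_gt0.
have -> : nus i V1° * nus j V2° = \int[nus i]_x (nus j V2° * (\1_(V1°) x : R)%:E).
  by rewrite ge0_integralZlT//= ?integral_indic ?setIT 1?muleC//; exact: mind.
apply: ge0_le_integral => //.
- by move=> a _; exact: mule_ge0.
- by apply: measurable_funeM; exact: mind.
- exact: (measurable_integral_mulg G_compact G_metrizable _ (mind mW) (ind_ge0 W)).
- move=> a _; rewrite indicE; have [/[dup] Va1 /nbhs_singleton Va|nVa] := pselect (V1° a).
    rewrite mem_set// mule1.
  2: by rewrite memNset// mule0; exact: integral_ge0.
  rewrite -[V2°]setIT -(integral_indic _ measurableT mV2).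
  apply: ge0_le_integral => //; first exact: mind.
    by apply: (measurable_lmulg_comp G_compact G_metrizable (g := fun z => (\1_W z : R)%:E)); exact: mind.
  move=> b _; rewrite lee_fin !indicE.
  have [/[dup] Vb1 /nbhs_singleton Vb|nVb] := pselect (V2° b).
    by rewrite !mem_set//; exact: (VW (a, b)).
  by rewrite memNset.
Qed.

Lemma reachableX x n : reachable x -> reachable (x ^+ n)%g.
Proof.
move=> rx; elim: n => [|n IH]; first by rewrite expg0; exact: reachable1.
by rewrite expgS; exact: reachableM.
Qed.

Lemma reachable_closed : closed reachable.
Proof.
rewrite -[reachable]setCK; apply: open_closedC; rewrite openE => x /existsNP[W].
move=> /not_implyP[oW /not_implyP[Wx nW]].
apply: (@filterS _ (nbhs x) _ W); last exact: open_nbhs_nbhs.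
by move=> y Wy ry; apply: nW; exact: ry.
Qed.

(* In a compact group the powers of [x] recur, so inverses are limits of positive
   powers. *)
Lemma reachableV x : reachable x -> reachable (x^-1)%g.
Proof.
move=> rx W oW Wx.
have [z [_ zcl]] := G_compact (F := (fun n => x ^+ n)%g @ \oo) _ filterT.
have [V [nV VW]] : exists V, nbhs z V /\
    forall a b, V a -> V b -> W (x^-1 * (a^-1 * b))%g.
  have : nbhs (x^-1 * (z^-1 * z))%g W by rewrite mulVg mulg1; exact: open_nbhs_nbhs.
  move=> /(@mulg_continuous G (x^-1, z^-1 * z)%g)[[W1 W2] [/= W1x W2z] W12].
  have := W2z => /(@mulg_continuous G (z^-1, z)%g)[[V1 V2] [/= V1z V2z] V12].
  have := V1z => /(@invg_continuous G z) V1z'.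
  exists ((fun a => a^-1)%g @^-1` V1 `&` V2); split; first exact: filterI.
  move=> a b [V1a _] [_ V2b]; apply: (W12 (_, _)); split => /=.
    exact: nbhs_singleton.
  exact: (V12 (_, _)).
have freq N : exists2 n, (N <= n)%N & V (x ^+ n)%g.
  have FN : ((fun n => x ^+ n)%g @ \oo) [set y | exists2 n, (N <= n)%N & y = (x ^+ n)%g].
    by exists N => // n /= Nn; exists n.
  by have [_ [[n Nn ->] Vn]] := zcl _ _ FN nV; exists n.
have [n _ Vn] := freq 0%N; have [m nm Vm] := freq n.+1.
apply: (@reachableX x (m - n.+1) rx) => //.
suff -> : (x ^+ (m - n.+1) = x^-1 * ((x ^+ n)^-1 * x ^+ m))%g by exact: VW.
by rewrite -[in RHS](subnKC nm) expgnDr expgSr -!mulgA !mulKg.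
Qed.

Lemma nus1E A : measurable A -> nus 1 A = nu A.
Proof.
move=> mA; rewrite -[A]setIT -!(integral_indic _ measurableT mA).
rewrite (ge0_integral_powerS G_compact G_metrizable nusE _ (mind mA) (ind_ge0 A)).
apply: eq_integral => x _.
rewrite (ge0_integral_power0 nusE (g := fun y => (\1_A (x * y)%g : R)%:E)) ?mulg1//.
by apply: (measurable_lmulg_comp G_compact G_metrizable (g := fun y => (\1_A y : R)%:E)); exact: mind.
Qed.

(** An open set that [nu] does not charge has a closed complement of full measure, so the support
    avoids it. *)
Lemma support_reachable : Defs.support nu `<=` reachable.
Proof.
move=> x sx W oW Wx; exists 1%N; rewrite nus1E; last exact: open_meas.
rewrite lt0e measure_ge0 andbT; apply/eqP => W0.
have [] : (~` W) x; last by [].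
apply: sx; split; first exact: open_closedC.
by rewrite probability_setC ?W0 ?sube0//; exact: open_meas.
Qed.

Lemma adapted_reachable : adapted nu -> reachable = setT.
Proof.
move=> nua; apply: nua; [exact: reachable_closed| |exact: support_reachable].
by split; [exact: reachable1|exact: reachableM|exact: reachableV].
Qed.
End adapted_walk.

(** * A sum of powers dominates a multiple of the Haar measure *)

Section uniform_minorization.
Context (R : realType) (d : measure_display) (G : borelGroupType d).
Hypothesis G_compact : compact [set: G].
Hypothesis G_metrizable : metrizable R G.
Variable mu : probability G R.
Hypothesis mu_haar : normalized_haar mu.
Variables (nu : probability G R) (nus : nat -> probability G R).
Hypothesis nusE : forall k A, measurable A ->
  nus k A = convolution_power nu k A.
Hypothesis nu_adapted : adapted nu.
Local Open Scope ereal_scope.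

Let open_meas (U : set G) : open U -> measurable U.
Proof. by move=> oU; rewrite measurable_borel; exact: sub_sigma_algebra. Qed.

Let mdivlg (U : set G) y : measurable U -> measurable [set x | U (x^-1 * y)%g].
Proof.
move=> mU; rewrite -[X in measurable X]setTI.
have : measurable_fun setT (fun x : G => (x^-1 * y)%g).
  by apply: (measurable_fun_mulg G_compact G_metrizable) => //; exact: measurable_invg.
by apply.
Qed.

(** Near [y * u^-1] and [y] the relation [U (x^-1 * y)] is stable, and some power charges the
    neighbourhood of [y * u^-1]. The number of powers and the lower bound [1 / (n + 1)] are tied to
    one index [n], which turns uniformity in [y] into a near-covering statement as [n] grows. *)
Lemma uniformly_reachable (U : set G) : open U -> U !=set0 ->
  exists N (e : R), (0 < e)%R /\
    forall y, e%:E <= \sum_(j < N) nus j [set x | U (x^-1 * y)%g].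
Proof.
move=> oU [u Uu].
have cov := (compact_near_coveringP [set: G]).1 G_compact nat \oo
  (fun n y => (n.+1%:R^-1)%:E <= \sum_(j < n) nus j [set x | U (x^-1 * y)%g]) _.
suff : \forall n \near \oo, [set: G] `<=`
    (fun y => (n.+1%:R^-1)%:E <= \sum_(j < n) nus j [set x | U (x^-1 * y)%g]).
  move=> [N _ /(_ N (leqnn N)) HN]; exists N, (N.+1%:R^-1)%R.
  by split=> [|y]; [rewrite invr_gt0|exact: HN].
apply: cov => y _; pose x0 := (y * u^-1)%g.
have [V1 [V2 [V1x V2y VU]]] : exists V1 V2, [/\ nbhs x0 V1, nbhs y V2 &
    forall a b, V1 a -> V2 b -> U (a^-1 * b)%g].
  have : nbhs (x0^-1 * y)%g U.
    by rewrite /x0 invgM invgK mulgVK; exact: open_nbhs_nbhs.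
  move=> /(@mulg_continuous G (x0^-1, y)%g)[[W1 W2] [/= W1x W2y] W12].
  exists ((fun a => a^-1)%g @^-1` W1), W2; split => //.
    exact: (@invg_continuous G x0).
  by move=> a b W1a W2b; exact: (W12 (_, _)).
have oV1 : open V1° by exact: open_interior.
have [j j0] : exists j, 0 < nus j V1°.
  have : reachable nus x0.
    by rewrite (adapted_reachable G_compact G_metrizable nusE nu_adapted).
  exact.
have mV1 := open_meas oV1.
have [t t0 tj] : exists2 t : R, (0 < t)%R & nus j V1° = t%:E.
  have fin : nus j V1° \is a fin_num by rewrite fin_num_measure.
  by exists (fine (nus j V1°)); rewrite ?fineK// -lte_fin fineK.
have [//|n0 n0t] := @ltr_add_invr R 0%R t; rewrite add0r in n0t.
exists (V2, [set n | (maxn n0 j.+1 <= n)%N]).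
  by split=> //; exists (maxn n0 j.+1).
move=> [y' n] /= [V2y' n0n].
have jn : (j < n)%N by apply: leq_trans n0n; exact: leq_maxr.
rewrite (bigD1 (Ordinal jn))//=.
apply: (@le_trans _ _ (nus j [set x | U (x^-1 * y')%g])); last first.
  by rewrite leeDl// sume_ge0.
apply: (@le_trans _ _ (nus j V1°)).
  rewrite tj lee_fin; apply: le_trans (ltW n0t).
  by rewrite lef_pV2 ?posrE// ler_nat ltnS (leq_trans _ n0n)// leq_maxl.
apply: le_measure; rewrite ?inE//; first exact: mdivlg (open_meas oU).
by move=> x /nbhs_singleton V1x'; exact: VU.
Qed.

(** Preceding the [k + k] steps that yield a density on [U] by [j] free steps moves [U] around; at
    [y] the density becomes [e] times the [nus j]-mass of the [x] with [U (x^-1 * y)]. Summed over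
    [j < N] this is at least [e * e'] everywhere. *)
Lemma power_sum_minorization : (exists k : nat,
      (1 <= k)%N /\ abs_part_neq0 (convolution_power nu k) mu) ->
  exists (k N : nat) (c : R), (0 < c)%R /\
    forall g : G -> \bar R, measurable_fun setT g -> (forall x, 0 <= g x) ->
    c%:E * \int[mu]_x g x <= \sum_(j < N) \int[nus (j + k)%N]_x g x.
Proof.
move=> [k [_ kabs]].
have [U [e [oU U0 e0 eU]]] :=
  power_density_lower_bound G_compact G_metrizable mu_haar nusE kabs.
have [N [e' [e'0 e'U]]] := uniformly_reachable oU U0.
have mU := open_meas oU.
exists (k + k)%N, N, (e * e')%R; split; first exact: mulr_gt0.
move=> g mg g0.
have e0E : 0 <= e%:E by rewrite lee_fin ltW.
have e'0E : 0 <= e'%:E by rewrite lee_fin ltW.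
have mgx x : measurable_fun setT (fun y => g (x * y)%g).
  exact: (measurable_lmulg_comp G_compact G_metrizable).
have mU' : measurable_fun setT (fun x => (\1_U x : R)%:E).
  by apply/measurable_EFinP; exact: measurable_indic.
have indg_ge0 x y : 0 <= (\1_U y : R)%:E * g (x * y)%g.
  by rewrite mule_ge0// lee_fin.
have minner : measurable_fun setT (fun x => \int[mu]_y ((\1_U y)%:E * g (x * y)%g)).
  apply: (measurable_fun_fubini_tonelli_F
    (fun z : G * G => (\1_U z.2)%:E * g (z.1 * z.2)%g)) => /=; last first.
    by move=> z; exact: indg_ge0.
  apply: emeasurable_funM; last exact: measurable_convolution_integrand.
  by apply: (measurableT_comp mU'); exact: measurable_snd.
have mnus j := measurable_divlg_measure G_compact G_metrizable (nus j) mU.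
apply: (@le_trans _ _ (\sum_(j < N)
    (e%:E * \int[mu]_y (nus j [set x | U (x^-1 * y)%g] * g y)))).
  rewrite -ge0_sume_distrr; last first.
    by move=> j _; apply: integral_ge0 => y _; exact: mule_ge0.
  rewrite EFinM -muleA; apply: lee_wpmul2l => //.
  rewrite -ge0_integral_sum//; last 2 first.
  - by move=> j; exact: emeasurable_funM.
  - by move=> j y _; exact: mule_ge0.
  rewrite -ge0_integralZlT//; apply: ge0_le_integral => //.
  - by move=> y _; exact: mule_ge0.
  - exact: measurable_funeM.
  - by apply: emeasurable_sum => j; exact: emeasurable_funM.
  - move=> y _; rewrite -ge0_sume_distrl; last by move=> j _; exact: measure_ge0.
    by apply: lee_wpmul2r => //; exact: e'U.
apply: lee_sum => j _.
rewrite (ge0_integral_powerD G_compact G_metrizable nusE)//.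
rewrite -(integral_haar_restriction_swap G_compact G_metrizable mu_haar)//.
rewrite -ge0_integralZlT//; last by move=> x; apply: integral_ge0 => y _.
apply: ge0_le_integral => //.
- by move=> x _; rewrite mule_ge0// integral_ge0.
- exact: measurable_funeM.
- exact: (measurable_integral_mulg G_compact G_metrizable _ mg).
- by move=> x _; exact: eU.
Qed.

End uniform_minorization.

(** * Integrals of bounded functions *)

Section bounded_functions.
Context d (T : measurableType d) (R : realType).
Implicit Types (m : probability T R) (F : T -> R).

Definition bounded_measurable (M : R) F :=
  measurable_fun setT F /\ forall x, `|F x| <= M.

Lemma bounded_measurable_integrable m M F :
  bounded_measurable M F -> m.-integrable setT (EFin \o F).
Proof.
move=> [mF FM].
have iM : m.-integrable setT (EFin \o cst M) by exact: finite_measure_integrable_cst.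
apply: (le_integrable measurableT _ _ iM); first exact/measurable_EFinP.
move=> x _ /=; rewrite lee_fin; apply: le_trans (FM x) _.
exact: ler_norm.
Qed.

Lemma bounded_measurableD M N F H : bounded_measurable M F ->
  bounded_measurable N H -> bounded_measurable (M + N) (fun x => F x + H x).
Proof.
move=> [mF FM] [mH HN]; split; first exact: measurable_funD.
by move=> x; apply: le_trans (ler_normD _ _) _; apply: lerD.
Qed.

Lemma bounded_measurableZ M a F : bounded_measurable M F ->
  bounded_measurable (`|a| * M) (fun x => a * F x).
Proof.
move=> [mF FM]; split; first exact: measurable_funM.
by move=> x; rewrite normrM ler_wpM2l.
Qed.

Lemma bounded_measurable_cst a : bounded_measurable `|a| (fun _ : T => a).
Proof. by split. Qed.

Lemma bounded_measurable_sum (I : Type) (s : seq I) M (F : I -> T -> R) :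
  (forall i, bounded_measurable M (F i)) ->
  bounded_measurable (\sum_(i <- s) M) (fun x => \sum_(i <- s) F i x).
Proof.
move=> FM; split; first by apply: measurable_sum => i; have [] := FM i.
move=> x; apply: le_trans (ler_norm_sum _ _ _) _.
by apply: ler_sum => i _; have [] := FM i.
Qed.

Lemma bounded_measurable_le M N F : M <= N -> bounded_measurable M F ->
  bounded_measurable N F.
Proof. by move=> MN [mF FM]; split=> // x; exact: le_trans MN. Qed.

Lemma Rintegral_EFin m F : m.-integrable setT (EFin \o F) ->
  (\int[m]_x F x)%:E = (\int[m]_x (F x)%:E)%E.
Proof. by move=> iF; rewrite fineK//; exact: integrable_fin_num. Qed.

Lemma Rintegral_probability_cst m (a : R) : \int[m]_x a = a.
Proof. by rewrite Rintegral_cst//= probability_setT mulr1. Qed.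

Lemma Rintegral_sum m (I : Type) (s : seq I) M (F : I -> T -> R) :
  (forall i, bounded_measurable M (F i)) ->
  \int[m]_x (\sum_(i <- s) F i x) = \sum_(i <- s) \int[m]_x F i x.
Proof.
move=> FM; elim: s => [|i s IH].
  rewrite big_nil; under eq_Rintegral do rewrite big_nil.
  exact: Rintegral_probability_cst.
rewrite big_cons -IH; under eq_Rintegral do rewrite big_cons.
rewrite RintegralD//; first exact: bounded_measurable_integrable (FM i).
exact: bounded_measurable_integrable (bounded_measurable_sum s FM).
Qed.

Lemma norm_Rintegral_le m M F : bounded_measurable M F ->
  `|\int[m]_x F x| <= M.
Proof.
move=> bF; have iF := bounded_measurable_integrable m bF.
have iM : m.-integrable setT (EFin \o cst M) by exact: finite_measure_integrable_cst.
apply: le_trans (le_normr_Rintegral measurableT iF) _.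
rewrite -[leRHS](Rintegral_probability_cst m); apply: le_Rintegral => //.
  exact: integrable_norm.
by move=> x _; exact: bF.2.
Qed.

Lemma Rintegral_bounded_cvg m M (F : nat -> T -> R) (H : T -> R) :
  (forall n, bounded_measurable M (F n)) -> measurable_fun setT H ->
  (forall x, F n x @[n --> \oo] --> H x) ->
  \int[m]_x F n x @[n --> \oo] --> \int[m]_x H x.
Proof.
move=> FM mH FH.
have iM : m.-integrable setT (EFin \o cst M) by exact: finite_measure_integrable_cst.
have mFE n : measurable_fun setT (EFin \o F n) by exact/measurable_EFinP/(FM n).1.
have mHE : measurable_fun setT (EFin \o H) by exact/measurable_EFinP.
have [] := dominated_convergence measurableT mFE mHE _ iM _.
- by apply: aeW => x _ /=; apply: cvg_EFin; [exact: nearW|exact: FH].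
- by apply: aeW => x n _ /=; rewrite lee_fin; exact: (FM n).2.
move=> iH _; rewrite -Rintegral_EFin// => /fine_cvgP[_].
by apply: cvg_trans; apply: near_eq_cvg; near=> n.
Unshelve. all: by end_near. Qed.

End bounded_functions.

(** * The transition operator and its Poisson equation *)

Section poisson.
Context (R : realType) (d : measure_display) (G : borelGroupType d).
Hypothesis G_compact : compact [set: G].
Hypothesis G_metrizable : metrizable R G.

Definition right_average (m : probability G R) (F : G -> R) (x : G) : R :=
  \int[m]_y F (x * y)%g.

Lemma bounded_measurable_lmulg M (F : G -> R) x :
  bounded_measurable M F -> bounded_measurable M (fun y => F (x * y)%g).
Proof.
move=> [mF FM]; split=> //.
exact: (measurable_lmulg_comp G_compact G_metrizable).
Qed.

(** Adding the bound [M] makes the integrand nonnegative, so the Tonelli and convolution formulas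
    for nonnegative functions carry over to signed bounded ones. *)
Lemma right_average_shift m M (F : G -> R) x : bounded_measurable M F ->
  (right_average m F x)%:E = (\int[m]_y (M + F (x * y)%g)%:E - M%:E)%E.
Proof.
move=> bF; have bFx := bounded_measurable_lmulg x bF.
rewrite -Rintegral_EFin; last first.
  exact: (bounded_measurable_integrable m (bounded_measurableD
    (bounded_measurable_cst _ M) bFx)).
rewrite RintegralD//; last 2 first.
- exact: (bounded_measurable_integrable m (bounded_measurable_cst _ M)).
- exact: (bounded_measurable_integrable m bFx).
by rewrite Rintegral_probability_cst -EFinB addrC addKr.
Qed.

Lemma bounded_shift_ge0 M (F : G -> R) x : bounded_measurable M F ->
  (0 <= (M + F x)%:E)%E.
Proof.
by move=> [_ /(_ x)]; rewrite ler_norml lee_fin => /andP[? _]; rewrite -lerBlDl sub0r.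
Qed.

Lemma bounded_shift_measurable M (F : G -> R) : bounded_measurable M F ->
  measurable_fun setT (fun x => (M + F x)%:E).
Proof. by move=> [mF _]; apply/measurable_EFinP; exact: measurable_funD. Qed.

Lemma right_average_bounded m M (F : G -> R) :
  bounded_measurable M F -> bounded_measurable M (right_average m F).
Proof.
move=> bF; split; last first.
  by move=> x; apply: norm_Rintegral_le; exact: bounded_measurable_lmulg.
have : measurable_fun setT (fun x => \int[m]_y (M + F (x * y)%g)%:E - M%:E)%E.
  apply: emeasurable_funB => //.
  apply: (measurable_integral_mulg G_compact G_metrizable m
    (bounded_shift_measurable bF)) => x; exact: bounded_shift_ge0.
under eq_fun do rewrite -right_average_shift//.
by move=> /measurable_EFinP.
Qed.

Lemma right_averageD m M N (F H : G -> R) x : bounded_measurable M F ->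
  bounded_measurable N H -> right_average m (fun y => F y + H y) x =
  right_average m F x + right_average m H x.
Proof.
move=> bF bH; rewrite /right_average RintegralD//.
  exact: (bounded_measurable_integrable m (bounded_measurable_lmulg x bF)).
exact: (bounded_measurable_integrable m (bounded_measurable_lmulg x bH)).
Qed.

Lemma right_averageZ m M a (F : G -> R) x : bounded_measurable M F ->
  right_average m (fun y => a * F y) x = a * right_average m F x.
Proof.
move=> bF; rewrite /right_average RintegralZl//.
exact: (bounded_measurable_integrable m (bounded_measurable_lmulg x bF)).
Qed.

Lemma right_average_sum m M (I : Type) (s : seq I) (F : I -> G -> R) x :
  (forall i, bounded_measurable M (F i)) ->
  right_average m (fun y => \sum_(i <- s) F i y) x =
  \sum_(i <- s) right_average m (F i) x.
Proof.
move=> bF; apply: (@Rintegral_sum _ _ _ _ _ _ M) => i.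
exact: bounded_measurable_lmulg.
Qed.

Variable mu : probability G R.
Hypothesis mu_haar : normalized_haar mu.

(** The Haar measure is stationary for right steps of any law, by Tonelli and right invariance. *)
Lemma Rintegral_haar_right_average m M (F : G -> R) : bounded_measurable M F ->
  \int[mu]_x right_average m F x = \int[mu]_x F x.
Proof.
move=> bF; have bK := right_average_bounded m bF.
have mF := bounded_shift_measurable bF.
have F0 x := bounded_shift_ge0 x bF.
have shift H : bounded_measurable M H ->
    (\int[mu]_x H x)%:E = (\int[mu]_x (M + H x)%:E - M%:E)%E.
  move=> bH; rewrite -Rintegral_EFin; last first.
    exact: (bounded_measurable_integrable mu (bounded_measurableD
      (bounded_measurable_cst _ M) bH)).
  rewrite RintegralD//; last 2 first.
  - exact: (bounded_measurable_integrable mu (bounded_measurable_cst _ M)).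
  - exact: (bounded_measurable_integrable mu bH).
  by rewrite Rintegral_probability_cst -EFinB addrC addKr.
apply: EFin_inj; rewrite (shift _ bK) (shift _ bF); congr (_ - _)%E.
transitivity (\int[mu]_x \int[m]_y (M + F (x * y)%g)%:E)%E.
  by apply: eq_integral => x _; rewrite EFinD (right_average_shift _ _ bF) addeC subeK.
rewrite (fubini_tonelli (fun z : G * G => (M + F (z.1 * z.2)%g)%:E)) /=; last 2 first.
- exact: (measurable_convolution_integrand G_compact G_metrizable mF).
- by move=> z; exact: F0.
transitivity (\int[m]_y \int[mu]_x (M + F x)%:E)%E.
  apply: eq_integral => y _.
  exact: (ge0_integral_haar_rmulg G_compact G_metrizable mu_haar y mF F0).
by rewrite integral_cst//= probability_setT mule1.
Qed.

Variables (nu : probability G R) (nus : nat -> probability G R).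
Hypothesis nusE : forall k A, measurable A ->
  nus k A = convolution_power nu k A.

Lemma right_average_power0 M (F : G -> R) x : bounded_measurable M F ->
  right_average (nus 0%N) F x = F x.
Proof.
move=> bF; apply: EFin_inj; rewrite (right_average_shift _ _ bF).
have bFx := bounded_measurable_lmulg x bF.
rewrite (ge0_integral_power0 nusE (bounded_shift_measurable bFx)); last first.
  by move=> y; exact: (bounded_shift_ge0 y bFx).
by rewrite mulg1 -EFinB addrC addKr.
Qed.

Lemma right_average_powerS k M (F : G -> R) x : bounded_measurable M F ->
  right_average (nus k.+1) F x = right_average nu (right_average (nus k) F) x.
Proof.
move=> bF; apply: EFin_inj.
rewrite (right_average_shift _ _ bF) (right_average_shift _ _ (right_average_bounded _ bF)).
congr (_ - _)%E; have bFx := bounded_measurable_lmulg x bF.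
rewrite (ge0_integral_powerS G_compact G_metrizable nusE _ (bounded_shift_measurable bFx)); last first.
  by move=> y; exact: (bounded_shift_ge0 y bFx).
apply: eq_integral => y _.
rewrite EFinD (right_average_shift _ _ bF) addeC subeK//.
by apply: eq_integral => z _; rewrite mulgA.
Qed.

End poisson.

Section poisson_equation.
Context (R : realType) (d : measure_display) (G : borelGroupType d).
Hypothesis G_compact : compact [set: G].
Hypothesis G_metrizable : metrizable R G.
Variable mu : probability G R.
Hypothesis mu_haar : normalized_haar mu.
Variables (nu : probability G R) (nus : nat -> probability G R).
Hypothesis nusE : forall k A, measurable A ->
  nus k A = convolution_power nu k A.
Variables (k N : nat) (c : R).
Hypothesis c0 : 0 < c.
Hypothesis nus_minor : forall g : G -> \bar R, measurable_fun setT g ->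
  (forall x, 0 <= g x)%E ->
  (c%:E * \int[mu]_x g x <= \sum_(j < N) \int[nus (j + k)%N]_x g x)%E.

Let K := @right_average R d G.
Let A (F : G -> R) (x : G) : R := N%:R^-1 * \sum_(j < N) K (nus (j + k)%N) F x.

(** The minorization tested on the constant [1]; it makes [N] nonzero and the factor [r]
    nonnegative. *)
Let c_le_N : c <= N%:R.
Proof.
have := nus_minor (g := cst 1%E) (measurable_cst _) (fun=> lee01).
rewrite integral_cst//= probability_setT mule1.
rewrite (eq_bigr (fun=> 1%E)); last first.
  by move=> j _; rewrite integral_cst//= probability_setT mule1.
by rewrite mule1 sumEFin lee_fin sumr_const card_ord.
Qed.

Let N0 : 0 < N%:R :> R. Proof. exact: lt_le_trans c_le_N. Qed.

(* Doeblin: [A] dominates [c / N] times the mean, so it shrinks the sup norm of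
   mean-zero functions by the factor [r]. *)
Let r := 1 - c / N%:R.

Let r0 : 0 <= r.
Proof. by rewrite subr_ge0 ler_pdivrMr// mul1r. Qed.

Let r1 : r < 1.
Proof. by rewrite ltrBlDr ltrDl divr_gt0. Qed.

Let Kb m M F : bounded_measurable M F -> bounded_measurable M (K m F).
Proof. exact: right_average_bounded. Qed.

Let A_bounded M F : bounded_measurable M F ->
  bounded_measurable (`|N%:R^-1| * \sum_(j < N) M) (A F).
Proof.
by move=> bF; apply: bounded_measurableZ; apply: bounded_measurable_sum => j; exact: Kb.
Qed.

Let A_mean M F : bounded_measurable M F ->
  \int[mu]_x A F x = \int[mu]_x F x.
Proof.
move=> bF; rewrite RintegralZl//; last first.
  apply: (bounded_measurable_integrable mu (bounded_measurable_sum
    (index_enum 'I_N) (fun j => Kb (nus (j + k)%N) bF))).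
rewrite (@Rintegral_sum _ _ _ mu _ _ M); last by move=> j; exact: Kb.
rewrite (eq_bigr (fun=> \int[mu]_x F x)); last first.
  by move=> j _; exact: (Rintegral_haar_right_average G_compact G_metrizable mu_haar _ bF).
by rewrite sumr_const card_ord -[X in _ * X]mulr_natl mulKf// gt_eqF.
Qed.

(** The minorization applied to the nonnegative function [M - F (x * y)] of [y], whose Haar mean is
    [M], reads [c * M <= N * (M - A F x)]. *)
Let A_le M F x : bounded_measurable M F -> \int[mu]_x F x = 0 -> A F x <= r * M.
Proof.
move=> bF F0.
have bNF := bounded_measurableZ (-1) bF.
have bH := bounded_measurableD (bounded_measurable_cst _ M) bNF.
have bHx := bounded_measurable_lmulg G_compact G_metrizable x bH.
pose H y := M + -1 * F y.
have H_ge0 y : (0 <= (H y)%:E)%E.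
  by rewrite lee_fin /H mulN1r subr_ge0; apply: le_trans (ler_norm _) (bF.2 y).
have mH : measurable_fun setT (fun y => (H y)%:E).
  by apply/measurable_EFinP; exact: bH.1.
have := nus_minor (g := fun y => (H (x * y)%g)%:E)
  (iffRL (measurable_EFinP _ _) bHx.1) (fun y => H_ge0 _).
rewrite (ge0_integral_haar_lmulg G_compact G_metrizable mu_haar x mH)//.
rewrite -(Rintegral_EFin (bounded_measurable_integrable mu bH)).
rewrite (eq_bigr (fun j : 'I_N => (M - K (nus (j + k)%N) F x)%:E)); last first.
  move=> j _; rewrite -(Rintegral_EFin (bounded_measurable_integrable _ bHx)).
  congr EFin; apply: (etrans (right_averageD G_compact G_metrizable
    (nus (j + k)%N) x (bounded_measurable_cst _ M) bNF)).
  rewrite (right_averageZ G_compact G_metrizable _ _ _ bF) mulN1r.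
  by rewrite {1}/right_average Rintegral_probability_cst.
rewrite RintegralD//; last 2 first.
- exact: (bounded_measurable_integrable mu (bounded_measurable_cst _ M)).
- exact: (bounded_measurable_integrable mu bNF).
rewrite Rintegral_probability_cst RintegralZl//; last first.
  exact: (bounded_measurable_integrable mu bF).
rewrite F0 mulr0 addr0 sumEFin -EFinM lee_fin sumrB sumr_const card_ord => cM.
rewrite /A -ler_pdivlMl ?invr_gt0// invrK /r mulrA mulrBr mulr1.
rewrite mulrCA divff ?gt_eqF// mulr1 mulrBl mulr_natl.
by rewrite lerBrDr addrC -lerBrDr.
Qed.

Let A_contract M F : bounded_measurable M F -> \int[mu]_x F x = 0 ->
  bounded_measurable (r * M) (A F).
Proof.
move=> bF F0; split; first exact: (A_bounded bF).1.
move=> x; rewrite ler_norml; apply/andP; split; last exact: A_le.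
have bNF := bounded_measurableZ (-1) bF.
rewrite normrN1 mul1r in bNF.
have NF0 : \int[mu]_x (-1 * F x) = 0.
  by rewrite RintegralZl ?F0 ?mulr0//; exact: (bounded_measurable_integrable mu bF).
have := A_le x bNF NF0; rewrite lerNl; congr (_ <= _).
rewrite /A -mulrN -sumrN; congr (_ * _); apply: eq_bigr => j _.
by rewrite /K (right_averageZ G_compact G_metrizable _ _ _ bF) mulN1r.
Qed.

Lemma cvg_sumr (V : realType) (I : Type) (s : seq I) (u : I -> nat -> V) (l : I -> V) :
  (forall i, u i n @[n --> \oo] --> l i) ->
  \sum_(i <- s) u i n @[n --> \oo] --> \sum_(i <- s) l i.
Proof.
move=> ul; elim: s => [|i s IH].
  by rewrite big_nil; under eq_fun do rewrite big_nil; exact: cvg_cst.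
by rewrite big_cons; under eq_fun do rewrite big_cons; exact: cvgD.
Qed.

(** The Neumann series of [A] at [F] converges geometrically, as iterates keep mean zero and shrink
    by [r]; its sum [h] satisfies [h = F + A h]. A finite sum of powers of [K] then converts [1 - A]
    into [1 - K]. *)
Lemma poisson_equation_bounded M (F : G -> R) : bounded_measurable M F ->
  \int[mu]_x F x = 0 ->
  exists L (h : G -> R), bounded_measurable L h /\
    forall x, h x - right_average nu h x = F x.
Proof.
move=> bF F0.
have M0 : 0 <= M by apply: le_trans (bF.2 1%g).
pose u i := iter i A F.
have ub i : bounded_measurable (r ^+ i * M) (u i) /\ \int[mu]_x u i x = 0.
  elim: i => [|i [IHb IH0]]; first by rewrite expr0 mul1r.
  split; last by rewrite -IH0; exact: A_mean IHb.
  by rewrite exprS -mulrA; exact: A_contract.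
pose S n x := series (fun i => u i x) n.
pose L := M / (1 - r).
have Sb n : bounded_measurable L (S n).
  split; first by apply: measurable_sum => i; exact: (ub i).1.1.
  move=> x; apply: le_trans (ler_norm_sum _ _ _) _.
  apply: (@le_trans _ _ (series (geometric M r) n)).
    apply: ler_sum => i _; rewrite /geometric/= mulrC; exact: (ub i).1.2.
  have gc : series (geometric M r) n @[n --> \oo] --> L.
    by apply: cvg_geometric_series; rewrite ger0_norm.
  rewrite -(cvg_lim (@Rhausdorff _) gc); apply: nondecreasing_cvgn_le.
    by apply: nondecreasing_series => i _ _; rewrite mulr_ge0// exprn_ge0.
  by apply/cvg_ex; exists L.
have Sc x : cvgn (S ^~ x).
  apply: normed_cvg; apply: (@series_le_cvg _ _ (geometric M r)).
  - by move=> n; exact: normr_ge0.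
  - by move=> n; apply: mulr_ge0 => //; exact: exprn_ge0.
  - by move=> n; rewrite /geometric/= mulrC; exact: (ub n).1.2.
  - by apply: is_cvg_geometric_series; rewrite ger0_norm.
pose h x := limn (S ^~ x).
have Sh x : S n x @[n --> \oo] --> h x by exact: Sc.
have hb : bounded_measurable L h.
  split; first by apply: (measurable_fun_cvg (fun n => (Sb n).1)) => x _; exact: Sh.
  move=> x; rewrite ler_norml; apply/andP; split.
    apply: limr_ge; first exact: Sc.
    by apply: nearW => n; have := (Sb n).2 x; rewrite ler_norml => /andP[].
  apply: limr_le; first exact: Sc.
  by apply: nearW => n; have := (Sb n).2 x; rewrite ler_norml => /andP[].
have AS n x : S n.+1 x = F x + A (S n) x.
  rewrite /S /series/= big_nat_recl//; congr (_ + _).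
  rewrite /A; under [in RHS]eq_bigr => j _.
    rewrite /K (@right_average_sum _ _ _ G_compact G_metrizable _ M); last first.
      move=> i; apply: bounded_measurable_le (ub i).1.
      by rewrite ler_piMl// exprn_ile1// ltW.
    over.
  rewrite exchange_big mulr_sumr; apply: eq_bigr => i _.
  by rewrite /u iterS.
(* The partial sums are bounded by [L], so dominated convergence carries the limit through [A]. *)
have hE x : h x = F x + A h x.
  have AhL : A (S n) x @[n --> \oo] --> A h x.
    apply: cvgMr; apply: cvg_sumr => j.
    apply: (Rintegral_bounded_cvg (M := L)).
    - by move=> n; exact: (bounded_measurable_lmulg G_compact G_metrizable).
    - exact: (bounded_measurable_lmulg G_compact G_metrizable _ hb).1.
    - by move=> y; exact: Sh.
  have : S n.+1 x @[n --> \oo] --> F x + A h x.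
    by under eq_fun do rewrite AS; apply: cvgD => //; exact: cvg_cst.
  move=> /(cvg_lim (@Rhausdorff _)) <-.
  by apply/esym/cvg_lim; [exact: Rhausdorff|rewrite cvg_shiftS; exact: Sh].
(* [h] solves [(1 - A) h = F], and [1 - K^n = (1 - K) (1 + ... + K^(n-1))]. *)
pose s := flatten [seq iota 0 (j + k) | j <- iota 0 N].
pose B x := \sum_(i <- s) K (nus i) h x.
have Kh i := Kb (nus i) hb.
have bB := bounded_measurable_sum s Kh.
exists (`|N%:R^-1| * \sum_(i <- s) L), (fun x => N%:R^-1 * B x).
split; first exact: bounded_measurableZ.
move=> x; rewrite (right_averageZ G_compact G_metrizable _ _ _ bB).
rewrite (right_average_sum G_compact G_metrizable _ _ _ Kh).
rewrite -mulrBr /B -sumrB big_flatten big_map.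
have telescope n :
    \sum_(i <- iota 0 n) (K (nus i) h x - right_average nu (K (nus i) h) x) =
    h x - K (nus n) h x.
  elim: n => [|n IH].
    by rewrite big_nil /K (right_average_power0 G_compact G_metrizable nusE _ hb) subrr.
  rewrite -addn1 iotaD big_cat IH big_seq1 add0n addn1 /K.
  rewrite (right_average_powerS G_compact G_metrizable nusE _ _ hb) /=.
  by rewrite addrA subrK.
(* Averaging [h - K (nus (j + k)) h] over [j < N] gives [h - A h], which is [F]. *)
under eq_bigr do rewrite telescope.
rewrite sumrB big_const_seq count_predT size_iota iter_addr_0 mulrBr.
have -> : \sum_(j <- iota 0 N) K (nus (j + k)%N) h x =
          \sum_(j < N) K (nus (j + k)%N) h x.
  by rewrite -(big_mkord xpredT (fun j => K (nus (j + k)%N) h x)) /index_iota subn0.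
rewrite -[X in _ * X - _]mulr_natl mulKf ?gt_eqF//.
by rewrite {1}hE /A addrK.
Qed.
End poisson_equation.

(** * Martingale decomposition of the walk sum *)

Section powR_bounds.
Variable R : realType.
Implicit Types a b p : R.

Lemma le_1_powR a p : 1 <= p -> `|a| <= 1 + `|a| `^ p.
Proof.
move=> p1; have [a1|a1] := leP `|a| 1.
  by apply: le_trans a1 _; rewrite lerDl powR_ge0.
rewrite -[leLHS]powRr1//; apply: (@le_trans _ _ (`|a| `^ p)).
  exact: (ler_powR (ltW a1)).
by rewrite lerDr.
Qed.

(** Here [|a + b|] is at most twice the larger of the two absolute values; the constant is not
    optimized. *)
Lemma powR_normD_le a b p : 0 <= p ->
  `|a + b| `^ p <= 2 `^ p * (`|a| `^ p + `|b| `^ p).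
Proof.
move=> p0.
wlog ab : a b / `|a| <= `|b|.
  move=> H; have [/H//|/ltW/H] := leP `|a| `|b|.
  by rewrite addrC [X in 2 `^ p * X]addrC.
apply: (@le_trans _ _ ((2 * `|b|) `^ p)).
  apply: ge0_ler_powR => //; rewrite ?nnegrE ?mulr_ge0//.
  by apply: le_trans (ler_normD _ _) _; rewrite mulr_natl mulr2n lerD2r.
by rewrite powRM// ler_wpM2l ?powR_ge0// lerDr powR_ge0.
Qed.

End powR_bounds.

Section martingale_decomposition.
Context (R : realType) (d : measure_display) (G : borelGroupType d).
Hypothesis G_compact : compact [set: G].
Hypothesis G_metrizable : metrizable R G.
Variable mu : probability G R.
Hypothesis mu_haar : normalized_haar mu.
Variable nu : probability G R.
Hypothesis nu_adapted : adapted nu.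
Hypothesis nu_abs : exists k : nat,
  (1 <= k)%N /\ abs_part_neq0 (convolution_power nu k) mu.
Variable f : G -> R.
Hypothesis f_measurable : measurable_fun [set: G] f.
Hypothesis f_mean0 : (\int[mu]_x (f x)%:E = 0)%E.
Variables (p C : R).
Hypothesis p1 : 1 <= p.
Hypothesis f_bound : forall c : G, (\int[nu]_x (`|f (c * x)%g| `^ p)%:E <= C%:E)%E.

Let mpow d' (T : measurableType d') (u : T -> R) : measurable_fun setT u ->
  measurable_fun setT (fun x => (`|u x| `^ p)%:E).
Proof.
move=> mu_; apply/measurable_EFinP; apply: (measurableT_comp (measurable_powR p)).
exact: measurableT_comp.
Qed.

Let mfs s : measurable_fun setT (fun x => f (s * x)%g).
Proof. exact: (measurable_lmulg_comp G_compact G_metrizable). Qed.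

Let abs_bound s : (\int[nu]_x `|(f (s * x)%g)%:E| <= (1 + C)%:E)%E.
Proof.
apply: (@le_trans _ _ (\int[nu]_x (1 + (`|f (s * x)%g| `^ p)%:E))%E).
  apply: ge0_le_integral => //.
  - by apply: measurableT_comp => //; exact/measurable_EFinP.
  - by apply: emeasurable_funD => //; exact: mpow.
  - by move=> x _; rewrite -EFinD abse_EFin lee_fin le_1_powR.
rewrite ge0_integralD//; last exact: mpow.
by rewrite integral_cst//= probability_setT mule1 EFinD leeD2l.
Qed.

Let f_integrable s : nu.-integrable setT (EFin \o (fun x => f (s * x)%g)).
Proof.
apply/integrableP; split; first exact/measurable_EFinP.
by apply: le_lt_trans (abs_bound s) _; rewrite ltry.
Qed.

Let Kf := right_average nu f.

Let mf2 : measurable_fun setT (fun z : G * G => (f (z.1 * z.2)%g)%:E).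
Proof.
exact: (measurable_convolution_integrand G_compact G_metrizable
  (iffRL (measurable_EFinP _ _) f_measurable)).
Qed.

(** The moment bound is uniform over translates and [|a| <= 1 + |a| ^ p], so the mean of [f (s * x)]
    is bounded uniformly in [s]. *)
Lemma right_average_moment_bounded : bounded_measurable (1 + C) Kf.
Proof.
split; last first.
  move=> s; rewrite /Kf /right_average -lee_fin.
  rewrite -abse_EFin Rintegral_EFin; last exact: f_integrable.
  by apply: le_trans (abs_bound s); apply: le_abse_integral => //; exact/measurable_EFinP.
apply/measurable_EFinP.
(* [f] has no bound to shift by, so measurability goes through its positive and negative parts. *)
rewrite [X in measurable_fun _ X](_ : _ = fun s => (\int[nu]_x (fun y => (f y)%:E)^\+ (s * x)%g -
    \int[nu]_x (fun y => (f y)%:E)^\- (s * x)%g)%E); last first.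
  apply/funext => s; rewrite /= /Kf /right_average Rintegral_EFin; last exact: f_integrable.
  by rewrite [LHS]integralE; congr (_ - _)%E; apply: eq_integral => x _;
    rewrite ?funeposE ?funenegE.
have mfE : measurable_fun setT (fun y => (f y)%:E) by exact/measurable_EFinP.
apply: emeasurable_funB.
  exact: (measurable_integral_mulg G_compact G_metrizable nu (measurable_funepos mfE)).
exact: (measurable_integral_mulg G_compact G_metrizable nu (measurable_funeneg mfE)).
Qed.

(** The uniform first-moment bound gives integrability on the product, hence Fubini; right
    invariance then turns each inner integral into the mean of [f]. *)
Lemma right_average_mean0 : \int[mu]_x Kf x = 0.
Proof.
apply: EFin_inj; rewrite Rintegral_EFin; last first.
  exact: bounded_measurable_integrable right_average_moment_bounded.
transitivity (\int[mu]_s \int[nu]_x (f (s * x)%g)%:E)%E.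
  by apply: eq_integral => s _; rewrite /Kf /right_average Rintegral_EFin//; exact: f_integrable.
rewrite (Fubini (f := fun z : G * G => (f (z.1 * z.2)%g)%:E))/=; last first.
  apply/integrable12ltyP => //=.
  apply: (@le_lt_trans _ _ (\int[mu]_s (1 + C)%:E)%E); last first.
    by rewrite integral_cst//= probability_setT mule1 ltry.
  apply: ge0_le_integral => //.
  - by move=> s _; exact: integral_ge0.
  - have mfa : measurable_fun setT (fun y => `|(f y)%:E|%E).
      by apply: measurableT_comp => //; exact/measurable_EFinP.
    exact: (measurable_integral_mulg G_compact G_metrizable nu mfa).
  - by move=> s _; exact: abs_bound.
rewrite -[RHS](_ : \int[nu]_x 0 = 0)%E; last by rewrite integral0.
apply: eq_integral => x _; rewrite -f_mean0.
have mfE : measurable_fun setT (fun y => (f y)%:E) by exact/measurable_EFinP.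
rewrite [LHS]integralE [RHS]integralE; congr (_ - _)%E.
  rewrite -(ge0_integral_haar_rmulg G_compact G_metrizable mu_haar x (measurable_funepos mfE))//.
  by apply: eq_integral => y _; rewrite !funeposE.
rewrite -(ge0_integral_haar_rmulg G_compact G_metrizable mu_haar x (measurable_funeneg mfE))//.
by apply: eq_integral => y _; rewrite !funenegE.
Qed.

Lemma martingale_decomposition :
  exists (D : G * G -> R) (h : G -> R) (L C' : R),
    [/\ measurable_fun setT D, forall x, `|h x| <= L,
      forall s, nu.-integrable setT (EFin \o (fun x => D (s, x))) /\
                \int[nu]_x D (s, x) = 0,
      forall s, (\int[nu]_x (`|D (s, x)| `^ p)%:E <= C'%:E)%E &
      forall s x, f (s * x)%g = D (s, x) - h (s * x)%g + h s].
Proof.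
have [nus nusE] := convolution_powers_exist G_compact G_metrizable nu.
have [k [N [c [c0 cN]]]] :=
  power_sum_minorization G_compact G_metrizable mu_haar nusE nu_adapted nu_abs.
have [L [h [hb hE]]] := poisson_equation_bounded G_compact G_metrizable mu_haar
  nusE c0 cN right_average_moment_bounded right_average_mean0.
pose v s x := h (s * x)%g - h s.
have vb s : bounded_measurable (L + L) (v s).
  split; first by apply: measurable_funB => //;
    exact: (bounded_measurable_lmulg G_compact G_metrizable _ hb).1.
  by move=> x; apply: le_trans (ler_normB _ _) _; apply: lerD; exact: hb.2.
have vi s := bounded_measurable_integrable nu (vb s).
(* The moment constant combines the bound [C] for [f] with the bound [L + L] for the coboundary term
   [v]. *)
exists (fun z => f (z.1 * z.2)%g + v z.1 z.2), h, L,
  (2 `^ p * (C + (L + L) `^ p)); split.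
- apply: measurable_funD; first exact/measurable_EFinP.
  apply: measurable_funB; last first.
    by apply: (measurableT_comp hb.1); exact: measurable_fst.
  apply/measurable_EFinP.
  exact: (measurable_convolution_integrand G_compact G_metrizable
    (iffRL (measurable_EFinP _ _) hb.1)).
- exact: hb.2.
- move=> s; split.
    by apply: (integrableD measurableT (f_integrable s) (vi s)).
  rewrite /= (RintegralD measurableT (f_integrable s) (vi s)).
  rewrite RintegralB//; last 2 first.
  + exact: (bounded_measurable_integrable nu (bounded_measurable_lmulg G_compact G_metrizable s hb)).
  + exact: (bounded_measurable_integrable nu (bounded_measurable_cst _ (h s))).
  (* The mean of [D (s, x)] is [Kf s] plus the mean of [h (s * x)] minus [h s], which vanishes by
     the Poisson equation. *)
  rewrite Rintegral_probability_cst; have := hE s; rewrite /Kf /right_average => <-.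
  by rewrite addrC subrKA subrr.
- move=> s; apply: (@le_trans _ _ (\int[nu]_x
      ((2 `^ p)%:E * ((`|f (s * x)%g| `^ p)%:E + ((L + L) `^ p)%:E)))%E).
    apply: ge0_le_integral => //.
    + by apply: mpow; exact: (measurable_funD (mfs s) (vb s).1).
    + by apply: measurable_funeM; apply: emeasurable_funD => //; exact: mpow.
    + move=> x _; rewrite -EFinD -EFinM lee_fin.
      apply: le_trans (powR_normD_le _ _ (le_trans ler01 p1)) _.
      rewrite ler_wpM2l ?powR_ge0// lerD2l ge0_ler_powR//; last exact: (vb s).2.
        exact: le_trans p1.
      by rewrite nnegrE; exact: le_trans ((vb s).2 x).
  rewrite ge0_integralZlT ?lee_fin ?powR_ge0//; first 1 last.
  + by apply: emeasurable_funD => //; exact: mpow.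
  + by move=> x; rewrite -EFinD lee_fin addr_ge0 ?powR_ge0.
  rewrite EFinM; apply: lee_wpmul2l; first by rewrite lee_fin powR_ge0.
  rewrite ge0_integralD//; first 1 last.
  + exact: mpow.
  + by move=> x _; rewrite lee_fin powR_ge0.
  rewrite EFinD; apply: leeD => //.
  by rewrite integral_cst//= probability_setT mule1.
- by move=> s x /=; rewrite /v; lra.
Qed.

End martingale_decomposition.

(** * The past of the walk and its independence from the next step *)

Section history.
Context {R : realType} {dO d : measure_display} {Omega : measurableType dO}
  {G : borelGroupType d} {P : probability Omega R}.
Variables (nu : probability G R) (X : nat -> {RV P >-> G}).

Definition cylinder (k : nat) : set (set Omega) :=
  [set A | exists B : nat -> set G, (forall i, measurable (B i)) /\
    A = \bigcap_(i in [set i | (i < k)%N]) (X i @^-1` B i)].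

(* [Omega] equipped with the sigma-algebra generated by the first [k] steps. *)
Definition history (k : nat) := g_sigma_algebraType (cylinder k).

Lemma cylinder_measurable k : cylinder k `<=` @measurable _ Omega.
Proof.
move=> _ [B [mB ->]]; apply: bigcap_measurableType => i _.
by rewrite -[X in measurable X]setTI; exact: measurable_funP.
Qed.

Lemma cylinder_setT k : cylinder k setT.
Proof.
exists (fun=> setT); split=> //; apply/seteqP; split=> // w _ i _.
Qed.

Lemma cylinder_setI_closed k : setI_closed (cylinder k).
Proof.
move=> _ _ [B [mB ->]] [B' [mB' ->]]; exists (fun i => B i `&` B' i); split.
  by move=> i; exact: measurableI.
by apply/seteqP; split=> [w [Bw B'w] i ik|w BBw]; [split; [exact: Bw|exact: B'w]|
  split=> i ik; have [] := BBw i ik].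
Qed.

Lemma cylinderS k : cylinder k `<=` cylinder k.+1.
Proof.
move=> _ [B [mB ->]]; exists (fun i => if (i < k)%N then B i else setT); split.
  by move=> i; case: ifP.
apply/seteqP; split=> w Bw i /= ik; first by case: ifPn => // ik'; exact: Bw.
by have := Bw i (ltnW ik); rewrite /= ik.
Qed.

Lemma history_sub k : @measurable _ (history k) `<=` @measurable _ Omega.
Proof.
apply: smallest_sub; last exact: cylinder_measurable.
exact: sigma_algebra_measurable.
Qed.

Lemma history_le k l : (k <= l)%N ->
  @measurable _ (history k) `<=` @measurable _ (history l).
Proof.
move=> /subnKC <-; elim: (l - k)%N => [|n IH]; first by rewrite addn0.
rewrite addnS; apply: subset_trans IH _.
by apply: sub_smallest2r; [exact: smallest_sigma_algebra|exact: cylinderS].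
Qed.

Lemma history_measurable_fun d' (T : measurableType d') k (u : Omega -> T) :
  measurable_fun setT (u : history k -> T) -> measurable_fun setT u.
Proof.
move=> mu_ _ Y mY; rewrite setTI; apply: (@history_sub k).
by have := mu_ measurableT Y mY; rewrite setTI.
Qed.

Lemma history_measurable_fun_le d' (T : measurableType d') k l (u : Omega -> T) :
  (k <= l)%N -> measurable_fun setT (u : history k -> T) ->
  measurable_fun setT (u : history l -> T).
Proof.
move=> kl mu_ _ Y mY; rewrite setTI; apply: (history_le kl).
by have := mu_ measurableT Y mY; rewrite setTI.
Qed.

Lemma step_history_measurable j k : (j < k)%N ->
  measurable_fun setT (X j : history k -> G).
Proof.
move=> jk _ B mB; rewrite setTI; apply: sub_sigma_algebra.
exists (fun i => if i == j then B else setT); split; first by move=> i; case: ifP.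
apply/seteqP; split=> w /= Bw; last by have := Bw j jk; rewrite /= eqxx.
by move=> i _ /=; case: eqP => // ->.
Qed.

Hypothesis X_iid : iid_with_law nu X.

(** The indices below [k] in the form over which [mutually_independent] quantifies. *)
Fixpoint initial_fset k : {fset nat} :=
  if k is k'.+1 then (k' |` initial_fset k')%fset else fset0.

Lemma mem_initial_fset k i : (i \in initial_fset k) = (i < k)%N.
Proof.
elim: k => [|k IH]; first by rewrite in_fset0.
by rewrite /= in_fset1U IH ltnS [RHS]leq_eqVlt.
Qed.

Local Open Scope ereal_scope.

(** Independence is used for the first [k + 1] steps and for the first [k]; the two products differ
    by the factor of step [k]. *)
Lemma cylinder_independent k A B : cylinder k A -> measurable B ->
  P (A `&` X k @^-1` B) = P A * nu B.
Proof.
move=> [C [mC ->]] mB; have [indep law] := X_iid.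
pose C' i := if (i < k)%N then C i else B.
have mC' i : measurable (C' i) by rewrite /C'; case: ifP.
have setE (l : nat) : [set` initial_fset l] = [set i | (i < l)%N].
  by apply/seteqP; split=> i /=; rewrite mem_initial_fset.
have := indep (initial_fset k.+1) C' mC'; rewrite setE.
rewrite (_ : \bigcap_(i in _) _ =
    \bigcap_(i in [set i | (i < k)%N]) X i @^-1` C i `&` X k @^-1` B); last first.
  apply/seteqP; split=> [w Cw|w [Cw Bw] i /=].
    split=> [i /= ik|]; first by have := Cw i (ltnW ik); rewrite /C' ik.
    by have := Cw k (ltnSn k); rewrite /C' ltnn.
  rewrite ltnS leq_eqVlt => /orP[/eqP ->|ik]; first by rewrite /C' ltnn.
  by rewrite /C' ik; exact: Cw.
move=> ->; rewrite /= big_fsetU1/=; last by rewrite mem_initial_fset ltnn.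
rewrite muleC; congr (_ * _); last by rewrite /C' ltnn; exact: law.
have := indep (initial_fset k) C mC; rewrite setE => ->.
apply: eq_big_seq => i; rewrite mem_initial_fset => ik.
by rewrite /C' ik.
Qed.

(** For fixed [B] both sides are finite measures in [A] that agree on the cylinders, which are
    closed under intersection and generate the history. *)
Lemma history_independent k A B : @measurable _ (history k) A -> measurable B ->
  P (A `&` X k @^-1` B) = P A * nu B.
Proof.
move=> mA mB; have mXB : measurable (X k @^-1` B).
  by rewrite -[X in measurable X]setTI; exact: measurable_funP.
have nuB0 : (0 <= fine (nu B))%R by exact: fine_ge0.
have nuBE : nu B = (fine (nu B))%:E by rewrite fineK// fin_num_measure.
have : mrestr P mXB A = mscale (NngNum nuB0) P A.
  apply: (@g_sigma_algebra_measure_unique _ _ _ (cylinder k) (@cylinder_measurable k)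
    (fun=> setT) (fun=> cylinder_setT k) _ (mrestr P mXB) (mscale (NngNum nuB0) P)
    (@cylinder_setI_closed k)) => //.
  - by rewrite bigcup_const//; exists 0%N.
  - move=> C cC; rewrite /= /mrestr /mscale/= -nuBE muleC.
    exact: cylinder_independent.
  - move=> _; rewrite /= /mrestr setTI.
    by apply: le_lt_trans (probability_le1 _ _) _; rewrite ?ltry.
by rewrite /mrestr /mscale/= -nuBE muleC.
Qed.

(** The substitute for conditional expectation: the pair formed by the past and step [k] has a
    product law, so the step can be integrated out first with the past frozen. *)
Lemma integral_history_step k (Phi : history k * G -> \bar R) :
  measurable_fun setT Phi -> (forall z, 0 <= Phi z) ->
  \int[P]_w Phi (w, X k w) = \int[P]_w \int[nu]_x Phi (w, x).
Proof.
move=> mPhi Phi0.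
have mid : measurable_fun setT (id : Omega -> history k).
  by move=> _ A mA; rewrite setTI; exact: (@history_sub k).
pose idk := HB.pack_for {mfun Omega >-> history k} (id : Omega -> history k)
  (isMeasurableFun.Build _ _ _ _ _ mid).
have mpair : measurable_fun setT (fun w : Omega => (w : history k, X k w)).
  by apply: measurable_fun_pair.
pose pairk := HB.pack_for {mfun Omega >-> (history k * G)%type}
  (fun w : Omega => (w : history k, X k w))
  (isMeasurableFun.Build _ _ _ _ _ mpair).
have lawE C : measurable C ->
    (distribution P idk \x nu) C = distribution P pairk C.
  apply: product_measure_unique => A B mA mB.
  exact: (history_independent mA mB).
transitivity (\int[distribution P pairk]_z Phi z).
  by rewrite ge0_integral_distribution.
rewrite [LHS](eq_measure_integral (distribution P idk \x nu)); last first.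
  by move=> C mC _; apply/esym/lawE.
rewrite fubini_tonelli1// ge0_integral_distribution//.
  exact: measurable_fun_fubini_tonelli_F.
by move=> w; apply: integral_ge0.
Qed.

End history.

(** * Maximal inequality for nonnegative supermartingales *)

Section maximal_inequality.
Context {R : realType} {dO d : measure_display} {Omega : measurableType dO}
  {G : borelGroupType d} {P : probability Omega R}.
Variables (nu : probability G R) (X : nat -> {RV P >-> G}).
Hypothesis X_iid : iid_with_law nu X.
Local Open Scope ereal_scope.

(** The last hypothesis is the supermartingale property made pathwise: [Phi] is the next value as a
    function of past and step, and its [nu]-mean does not exceed the present value. Stopped and
    capped at [lam], the process has nonincreasing means and ends at [lam] on the event in
    question. *)
Lemma supermartingale_maximal (U : nat -> Omega -> R) (n N : nat) (lam : R) :
  (n <= N)%N -> (0 < lam)%R ->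
  (forall k, (n <= k <= N)%N -> measurable_fun setT (U k : history X k -> R)) ->
  (forall k w, (n <= k <= N)%N -> (0 <= U k w)%R) ->
  (forall k, (n <= k < N)%N -> exists Phi : history X k * G -> R,
    [/\ measurable_fun setT Phi, forall z, (0 <= Phi z)%R,
        forall w, U k.+1 w = Phi (w, X k w) &
        forall w, \int[nu]_x (Phi (w, x))%:E <= (U k w)%:E]) ->
  lam%:E * P [set w | exists2 k, (n <= k <= N)%N & (lam <= U k w)%R] <=
  \int[P]_w (U n w)%:E.
Proof.
move=> nN lam0 mU U0 step.
(* The bound [j < k] is strict so that [C k.+1] involves times up to [k] only and belongs to the
   history at [k]. *)
pose C k := [set w | exists2 j, (n <= j < k)%N & (lam <= U j w)%R].
have CE k : C k = \bigcup_(j in [set j | (n <= j < k)%N]) [set w | (lam <= U j w)%R].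
  by apply/seteqP; split=> w [j jk Uj]; exists j.
have mC k : (k <= N)%N -> @measurable _ (history X k) (C k.+1).
  move=> kN; rewrite CE; apply: bigcup_measurable => j /andP[nj jk].
  apply: (history_le (X := X) (k := j)) => //.
  have := mU j; rewrite nj (leq_trans (n := k) jk kN) => /(_ isT measurableT `[lam, +oo[%classic).
  rewrite setTI => /(_ (measurable_itv _)); congr (measurable _).
  by apply/seteqP; split=> w /=; rewrite in_itv/= andbT.
have mC' k : (k <= N.+1)%N -> @measurable _ Omega (C k).
  case: k => [_|k kN]; last exact: history_sub (mC k kN).
  by rewrite CE bigcup0// => j /=; rewrite ltn0 andbF.
(* [glue (C k) (U k)] is [U] stopped on first reaching [lam], capped at [lam]. *)
pose glue (A : set Omega) (u : Omega -> R) w : R :=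
  (lam * \1_A w + \1_(~` A) w * u w)%R.
have glueT A u w : A w -> glue A u w = lam.
  by move=> Aw; rewrite /glue !indicE mem_set// memNset//= ?mulr1 ?mul0r ?addr0//; apply.
have glueF A u w : ~ A w -> glue A u w = u w.
  by move=> Aw; rewrite /glue !indicE memNset// mem_set//= mulr0 mul1r add0r.
have glue0 A u w : (0 <= u w)%R -> (0 <= glue A u w)%R.
  by move=> u0; have [/glueT->|/glueF->//] := pselect (A w); exact: ltW.
have mglue d' (T : measurableType d') (A : set T) (u : T -> R) :
    measurable A -> measurable_fun setT u ->
    measurable_fun setT (fun w => (lam * \1_A w + \1_(~` A) w * u w)%R).
  move=> mA mu; apply: measurable_funD; apply: measurable_funM => //.
  by apply: measurable_indic; exact: measurableC.
have mUO k : (n <= k <= N)%N -> measurable_fun setT (U k).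
  by move=> /mU; exact: history_measurable_fun.
(* On the paths that reach the level exactly at time [k], capping replaces a value at least [lam] by
   [lam]. *)
have glueS k : (n <= k <= N)%N -> \int[P]_w (glue (C k.+1) (U k) w)%:E <=
    \int[P]_w (glue (C k) (U k) w)%:E.
  move=> /[dup] nkN /andP[nk kN]; apply: ge0_le_integral => //.
  - by move=> w _; rewrite lee_fin glue0// U0.
  - by apply/measurable_EFinP; apply: mglue; [exact: mC'|exact: mUO].
  - by apply/measurable_EFinP; apply: mglue; [exact: mC' (leqW kN)|exact: mUO].
  - move=> w _; rewrite lee_fin; have [Ck|Ck] := pselect (C k w).
      rewrite !glueT//; case: Ck => j /andP[nj jk] Uj.
      by exists j; rewrite // nj ltnW.
    rewrite [leRHS]glueF//; have [CSk|CSk] := pselect (C k.+1 w); last by rewrite glueF.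
    rewrite glueT//; case: CSk => j /andP[nj]; rewrite ltnS leq_eqVlt => /orP[/eqP->//|jk] Uj.
    by exfalso; apply: Ck; exists j; rewrite // nj.
have main k : (n + k <= N)%N -> \int[P]_w (glue (C (n + k)%N) (U (n + k)%N) w)%:E <=
    \int[P]_w (U n w)%:E.
  elim: k => [|k IH] nkN.
    rewrite addn0 le_eqVlt; apply/orP; left; apply/eqP; apply: eq_integral => w _.
    by rewrite glueF// => -[j /andP[nj]]; rewrite ltnNge nj.
  rewrite addnS in nkN *; set l := (n + k)%N in nkN IH *.
  have nlN : (n <= l <= N)%N by rewrite leq_addr ltnW.
  apply: le_trans (IH (ltnW nkN)); apply: le_trans (glueS l nlN).
  have [|Phi [mPhi Phi0 PhiE Phile]] := step l; first by rewrite leq_addr.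
  pose Psi (z : history X l * G) : \bar R :=
    (lam * \1_(C l.+1) z.1 + \1_(~` (C l.+1)) z.1 * Phi z)%:E.
  have PsiT w x : C l.+1 w -> Psi (w, x) = lam%:E.
    by move=> Cw; congr EFin; exact: (@glueT (C l.+1) (fun w => Phi (w, x))).
  have PsiF w x : ~ C l.+1 w -> Psi (w, x) = (Phi (w, x))%:E.
    by move=> Cw; congr EFin; exact: (@glueF (C l.+1) (fun w => Phi (w, x))).
  have mPsi : measurable_fun setT Psi.
    apply/measurable_EFinP; apply: measurable_funD; apply: measurable_funM => //.
      apply: (measurableT_comp (f := \1_(C l.+1) : history X l -> R)) => //.
      by apply: measurable_indic; exact: mC (ltnW nkN).
    apply: (measurableT_comp (f := \1_(~` C l.+1) : history X l -> R)) => //.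
    by apply: measurable_indic; apply: measurableC; exact: mC (ltnW nkN).
  have Psi0 z : 0 <= Psi z.
    case: z => w x; have [Cw|Cw] := pselect (C l.+1 w).
      by rewrite PsiT// lee_fin ltW.
    by rewrite PsiF// lee_fin.
  rewrite (_ : \int[P]_w _ = \int[P]_w Psi (w, X l w)); last first.
    apply: eq_integral => w _; have [Cw|Cw] := pselect (C l.+1 w).
      by rewrite glueT// PsiT.
    by rewrite glueF// PsiF// PhiE.
  rewrite (integral_history_step X_iid mPsi Psi0).
  apply: ge0_le_integral => //.
  - by move=> w _; exact: integral_ge0.
  - apply: (history_measurable_fun (X := X) (k := l)).
    exact: (measurable_fun_fubini_tonelli_F Psi).
  - by apply/measurable_EFinP; apply: mglue; [exact: mC' (leqW nkN)|exact: mUO].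
  - move=> w _; have [Cw|Cw] := pselect (C l.+1 w).
      rewrite glueT//; under eq_integral do rewrite PsiT//.
      by rewrite integral_cst//= probability_setT mule1.
    by rewrite glueF//; under eq_integral do rewrite PsiF//.
have {}main := main (N - n)%N; rewrite subnKC// in main.
apply: le_trans (main (leqnn N)).
apply: le_trans (glueS N _); last by rewrite nN leqnn.
have mCN := mC' N.+1 (leqnn _).
rewrite (_ : [set w | _] = C N.+1); last first.
  by apply/seteqP; split=> w [j jk Uj]; exists j => //; rewrite ?ltnS// -ltnS.
rewrite -[X in P X]setIT -(integral_indic P measurableT mCN).
have m1 : measurable_fun setT (fun w => (\1_(C N.+1) w : R)%:E).
  by apply/measurable_EFinP; exact: measurable_indic.
rewrite -ge0_integralZlT//; last by rewrite lee_fin ltW.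
apply: ge0_le_integral => //.
- by move=> w _; rewrite mule_ge0// lee_fin ltW.
- exact: measurable_funeM.
- by apply/measurable_EFinP; apply: mglue => //; apply: mUO; rewrite nN leqnn.
- move=> w _; rewrite -EFinM lee_fin /glue lerDl mulr_ge0// U0//.
  by rewrite nN leqnn.
Qed.

End maximal_inequality.

Lemma measurable_exists_ge d (T : measurableType d) (R : realType) (D : set nat)
    (u : nat -> T -> R) (r : R) :
  (forall k, D k -> measurable_fun setT (u k)) ->
  measurable [set w | exists2 k, D k & r <= u k w].
Proof.
move=> mu; rewrite (_ : [set w | _] = \bigcup_(k in D) [set w | r <= u k w]).
  apply: bigcup_measurable => k /= Dk.
  have := mu k Dk measurableT `[r, +oo[%classic (measurable_itv _).
  rewrite setTI; congr (measurable _).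
  by apply/seteqP; split=> w /=; rewrite in_itv/= andbT.
by apply/seteqP; split=> w [k nkN ruk]; exists k.
Qed.

(** From [expR (- x) >= 1 - x] and [(1 - x) (1 + x + 2 x^2) = 1 + x^2 (1 - 2 x)], which is at least
    [1] exactly because [x <= 1 / 2]. *)
Lemma expR_le_quadratic (R : realType) (x : R) : x <= 2^-1 ->
  expR x <= 1 + x + 2 * x ^+ 2.
Proof.
move=> x2; have x1 : 0 < 1 - x by lra.
have : 1 <= expR (- x) * (1 + x + 2 * x ^+ 2).
  have q0 : 0 <= 1 + x + 2 * x ^+ 2 by nra.
  apply: (@le_trans _ _ ((1 + - x) * (1 + x + 2 * x ^+ 2))); first by nra.
  by apply: ler_wpM2r => //; exact: expR_ge1Dx.
by rewrite expRN mulrC ler_pdivlMr ?expR_gt0// mul1r.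
Qed.

(** * Maximal bounds and convergence for sums of centred bounded increments *)

Section martingale_sums.
Context {R : realType} {dO d : measure_display} {Omega : measurableType dO}
  {G : borelGroupType d} {P : probability Omega R}.
Hypothesis G_compact : compact [set: G].
Hypothesis G_metrizable : metrizable R G.
Variables (nu : probability G R) (X : nat -> {RV P >-> G}).
Hypothesis X_iid : iid_with_law nu X.

Lemma walkS k w : walk X k.+1 w = (walk X k w * X k w)%g.
Proof. by rewrite /walk big_ord_recr. Qed.

Lemma walk_history_measurable k : measurable_fun setT (walk X k : history X k -> G).
Proof.
elim: k => [|k IH].
  rewrite (_ : walk X 0 = cst 1%g); first exact: measurable_cst.
  by apply/funext => w; rewrite /walk big_ord0.
rewrite (_ : walk X k.+1 = fun w => (walk X k w * X k w)%g); last first.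
  by apply/funext => w; exact: walkS.
apply: (measurable_fun_mulg G_compact G_metrizable (T := history X k.+1)).
  exact: (history_measurable_fun_le (X := X) (leqnSn k)).
exact: step_history_measurable.
Qed.

Definition increment_sum (Z : nat -> G * G -> R) (n : nat) (w : Omega) : R :=
  \sum_(k < n) Z k (walk X k w, X k w).

Lemma increment_sumS Z n w :
  increment_sum Z n.+1 w = increment_sum Z n w + Z n (walk X n w, X n w).
Proof. by rewrite /increment_sum big_ord_recr. Qed.

Lemma increment_sum_history_measurable Z n :
  (forall k, measurable_fun setT (Z k)) ->
  measurable_fun setT (increment_sum Z n : history X n -> R).
Proof.
move=> mZ; elim: n => [|n IH].
  rewrite (_ : increment_sum Z 0 = cst 0); first exact: measurable_cst.
  by apply/funext => w; rewrite /increment_sum big_ord0.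
rewrite (_ : increment_sum Z n.+1 = fun w => increment_sum Z n w +
  Z n (walk X n w, X n w)); last by apply/funext => w; exact: increment_sumS.
apply: (measurable_funD (T := history X n.+1)).
  exact: (history_measurable_fun_le (X := X) (leqnSn n)).
apply: (measurableT_comp (mZ n)).
have mS := history_measurable_fun_le (leqnSn n) (@walk_history_measurable n).
exact: (measurable_fun_pair mS (step_history_measurable (X := X) (ltnSn n))).
Qed.

Lemma increment_history_measurable (Z : G * G -> R) k : measurable_fun setT Z ->
  measurable_fun setT (fun z : history X k * G => Z (walk X k z.1, z.2)).
Proof.
move=> mZ; apply: (measurableT_comp mZ); apply: measurable_fun_pair.
  by apply: (measurableT_comp (@walk_history_measurable k)); exact: measurable_fst.
exact: measurable_snd.
Qed.

Variables (Z : nat -> G * G -> R) (b v : nat -> R).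
Hypothesis mZ : forall k, measurable_fun setT (Z k).
Hypothesis Zb : forall k z, `|Z k z| <= b k.
Hypothesis Z0 : forall k s, \int[nu]_x Z k (s, x) = 0.
Hypothesis Zv : forall k s, \int[nu]_x (Z k (s, x)) ^+ 2 <= v k.

Let M := increment_sum Z.

Let Zsb k s : bounded_measurable (b k) (fun x => Z k (s, x)).
Proof.
split; last by move=> x; exact: Zb.
by apply: (measurableT_comp (mZ k)); exact: pair1_measurable.
Qed.

Let Zs2b k s : bounded_measurable (b k ^+ 2) (fun x => Z k (s, x) ^+ 2).
Proof.
split; first by apply: measurable_funX; exact: (Zsb k s).1.
by move=> x; rewrite normrX lerXn2r// ?nnegrE//; apply: le_trans (Zb k (s, x)).
Qed.

Let v0 k : 0 <= v k.
Proof.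
by apply: le_trans (Zv k 1%g); apply: Rintegral_ge0 => x _; exact: sqr_ge0.
Qed.

(** The squared deviation from [M n] grows in mean by at most [v k] per step. Adding the variance
    still to come, the sum of [v i] over [k <= i < N], makes it a supermartingale. *)
Lemma increment_sum_kolmogorov (n N : nat) (e : R) : (n <= N)%N -> 0 < e ->
  ((e ^+ 2)%:E * P [set w | exists2 k, (n <= k <= N)%N &
     (e <= `|M k w - M n w|)%R] <= (\sum_(n <= i < N) v i)%R%:E)%E.
Proof.
move=> nN e0.
pose U k w := (M k w - M n w) ^+ 2 + \sum_(k <= i < N) v i.
have mM k : measurable_fun setT (M k : history X k -> R).
  exact: increment_sum_history_measurable.
have mMn k : (n <= k)%N -> measurable_fun setT (M n : history X k -> R).
  by move=> nk; exact: (history_measurable_fun_le (X := X) nk).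
have mMO k : measurable_fun setT (M k).
  exact: (history_measurable_fun (X := X) (mM k)).
have := @supermartingale_maximal _ _ _ _ _ _ nu X X_iid U n N (e ^+ 2) nN (exprn_gt0 2 e0).
have -> : (\int[P]_w (U n w)%:E = (\sum_(n <= i < N) v i)%R%:E)%E.
  under eq_integral do rewrite /U subrr expr0n add0r.
  by rewrite integral_cst//= probability_setT mule1.
move=> maxi; apply: le_trans (maxi _ _ _).
- apply: lee_wpmul2l; first by rewrite lee_fin sqr_ge0.
  apply: le_measure; rewrite ?inE.
  + apply: (measurable_exists_ge (D := [set k | (n <= k <= N)%N])
      (u := fun k w => `|M k w - M n w|)) => k _.
    by apply: measurableT_comp => //; exact: measurable_funB.
  + apply: (measurable_exists_ge (D := [set k | (n <= k <= N)%N]) (u := U)) => k _; apply: measurable_funD => //.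
    by apply: measurable_funX; exact: measurable_funB.
  + move=> w [k nkN ek]; exists k => //; rewrite /U.
    rewrite -[leLHS]addr0 lerD ?sumr_ge0//.
    by rewrite -[leRHS]real_normK ?num_real// lerXn2r// nnegrE ltW.
- move=> k /andP[nk kN].
  apply: (measurable_funD (T := history X k)); last exact: measurable_cst.
  apply: (measurable_funX (T := history X k)).
  by apply: (measurable_funB (T := history X k)) => //; exact: mMn.
- by move=> k w _; rewrite addr_ge0 ?sqr_ge0// sumr_ge0.
- move=> k /andP[nk kN].
  exists (fun z => (M k z.1 - M n z.1 + Z k (walk X k z.1, z.2)) ^+ 2 +
    \sum_(k.+1 <= i < N) v i); split.
  + apply: measurable_funD; last exact: measurable_cst.
    apply: measurable_funX; apply: measurable_funD; last exact: increment_history_measurable.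
    apply: measurable_funB.
      by apply: (measurableT_comp (mM k)); exact: measurable_fst.
    by apply: (measurableT_comp (mMn k nk)); exact: measurable_fst.
  + by move=> z; rewrite addr_ge0 ?sqr_ge0// sumr_ge0.
  + by move=> w; rewrite /U /M increment_sumS /=; congr (_ ^+ 2 + _); lra.
  + move=> w; set s := walk X k w; set a := M k w - M n w => /=.
    have bq : bounded_measurable (`|a ^+ 2 + \sum_(k.+1 <= i < N) v i| +
        (`|2 * a| * b k + b k ^+ 2))
        (fun x => (a ^+ 2 + \sum_(k.+1 <= i < N) v i) +
          (2 * a * Z k (s, x) + Z k (s, x) ^+ 2)).
      apply: bounded_measurableD; first exact: bounded_measurable_cst.
      by apply: bounded_measurableD (Zs2b k s); exact: bounded_measurableZ.
    rewrite (_ : (\int[nu]_x _)%E = (\int[nu]_x ((a ^+ 2 + \sum_(k.+1 <= i < N) v i) +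
          (2 * a * Z k (s, x) + Z k (s, x) ^+ 2)))%:E).
      have iZ := bounded_measurable_integrable nu (bounded_measurableZ (2 * a) (Zsb k s)).
      have iZ2 := bounded_measurable_integrable nu (Zs2b k s).
      rewrite RintegralD//; last 2 first.
      * exact: (bounded_measurable_integrable nu (bounded_measurable_cst _ _)).
      * exact: (bounded_measurable_integrable nu
          (bounded_measurableD (bounded_measurableZ (2 * a) (Zsb k s)) (Zs2b k s))).
      rewrite Rintegral_probability_cst RintegralD// RintegralZl//; last first.
        exact: (bounded_measurable_integrable nu (Zsb k s)).
      rewrite Z0 mulr0 add0r lee_fin /U -/a (big_ltn kN) -addrA lerD2l addrC lerD2r.
      exact: Zv.
    rewrite Rintegral_EFin; last exact: (bounded_measurable_integrable nu bq).
    by apply: eq_integral => x _; congr EFin; rewrite sqrrD mulr_natl -mulrnAl; lra.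
Qed.

(** Since [l * b k <= 1 / 2], the quadratic bound for [expR] applies to each increment, and mean
    zero gives a factor at most [1 + 2 l^2 V <= expR (2 l^2 V)]. Hence [expR (l * M k - 2 l^2 V k)]
    is a supermartingale started at [1]. *)
Lemma increment_sum_exponential (N : nat) (l V r : R) :
  0 <= l -> 0 <= V -> (forall k, (k < N)%N -> l * b k <= 2^-1) ->
  (forall k, (k < N)%N -> v k <= V) ->
  (P [set w | exists2 k, (k <= N)%N & (r <= M k w)%R] <=
   (expR (2 * l ^+ 2 * V * N%:R - l * r))%R%:E)%E.
Proof.
move=> l0 V0 lb vV.
pose U k w := expR (l * M k w - 2 * l ^+ 2 * V * k%:R).
have mM k : measurable_fun setT (M k : history X k -> R).
  exact: increment_sum_history_measurable.
have mMO k : measurable_fun setT (M k).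
  exact: (history_measurable_fun (X := X) (mM k)).
pose lam := expR (l * r - 2 * l ^+ 2 * V * N%:R).
have := @supermartingale_maximal _ _ _ _ _ _ nu X X_iid U 0 N lam (leq0n _) (expR_gt0 _).
have -> : (\int[P]_w (U 0%N w)%:E = 1)%E.
  rewrite (eq_integral (cst 1%E)).
    by rewrite integral_cst//= probability_setT mule1.
  by move=> w _; rewrite /U /M /increment_sum big_ord0 !mulr0 subrr expR0.
move=> maxi.
have H : (lam%:E * P [set w | exists2 k, (k <= N)%N & (r <= M k w)%R] <= 1)%E.
  apply: le_trans (maxi _ _ _).
  - apply: lee_wpmul2l; first by rewrite lee_fin expR_ge0.
    apply: le_measure; rewrite ?inE.
    + apply: (measurable_exists_ge (D := [set k | (k <= N)%N]) (u := M)) => k _.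
      exact: mMO.
    + apply: (measurable_exists_ge (D := [set k | (0 <= k <= N)%N]) (u := U)) => k _.
      apply: (measurableT_comp (@measurable_expR R)).
      by apply: measurable_funB => //; exact: measurable_funM.
    + move=> w [k kN rk]; exists k => //; rewrite /U ler_expR.
      apply: lerB; first exact: ler_wpM2l.
      by rewrite ler_wpM2l ?ler_nat// !mulr_ge0// sqr_ge0.
  - move=> k _; apply: (measurableT_comp (@measurable_expR R)).
    by apply: measurable_funB => //; exact: measurable_funM.
  - by move=> k w _; exact: expR_ge0.
  - move=> k /andP[_ kN].
    exists (fun z => expR (l * (M k z.1 + Z k (walk X k z.1, z.2)) -
      2 * l ^+ 2 * V * k.+1%:R)); split.
    + apply: (measurableT_comp (@measurable_expR R)); apply: measurable_funB => //.
      apply: measurable_funM => //; apply: measurable_funD.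
        by apply: (measurableT_comp (mM k)); exact: measurable_fst.
      exact: increment_history_measurable.
    + by move=> z; exact: expR_ge0.
    + by move=> w; rewrite /U /M increment_sumS.
    + move=> w; set s := walk X k w => /=.
      pose q x := 1 + (l * Z k (s, x) + 2 * l ^+ 2 * Z k (s, x) ^+ 2).
      have bZ := bounded_measurableZ l (Zsb k s).
      have bZ2 := bounded_measurableZ (2 * l ^+ 2) (Zs2b k s).
      have bq := bounded_measurableD (bounded_measurable_cst _ 1) (bounded_measurableD bZ bZ2).
      have Eq : \int[nu]_x q x <= expR (2 * l ^+ 2 * V).
        rewrite /q RintegralD//; last 2 first.
        * exact: (bounded_measurable_integrable nu (bounded_measurable_cst _ 1)).
        * exact: (bounded_measurable_integrable nu (bounded_measurableD bZ bZ2)).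
        rewrite Rintegral_probability_cst RintegralD//; last 2 first.
        * exact: (bounded_measurable_integrable nu bZ).
        * exact: (bounded_measurable_integrable nu bZ2).
        rewrite !RintegralZl//; last 2 first.
        * exact: (bounded_measurable_integrable nu (Zs2b k s)).
        * exact: (bounded_measurable_integrable nu (Zsb k s)).
        rewrite Z0 mulr0 add0r; apply: le_trans (expR_ge1Dx _).
        rewrite lerD2l ler_wpM2l ?mulr_ge0 ?sqr_ge0//.
        exact: le_trans (Zv k s) (vV k kN).
      pose e0 := expR (l * M k w - 2 * l ^+ 2 * V * k.+1%:R).
      apply: (@le_trans _ _ (\int[nu]_x (e0 * q x)%:E)%E).
        apply: ge0_le_integral => //.
        * apply/measurable_EFinP; apply: (measurableT_comp (@measurable_expR R)).
          apply: measurable_funB => //; apply: measurable_funM => //.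
          by apply: measurable_funD => //; exact: (Zsb k s).1.
        * by apply/measurable_EFinP; apply: measurable_funM => //; exact: bq.1.
        * move=> x _; rewrite lee_fin.
          rewrite (_ : _ - _ = (l * M k w - 2 * l ^+ 2 * V * k.+1%:R) + l * Z k (s, x)); last by lra.
          rewrite expRD ler_wpM2l ?expR_ge0//.
          apply: le_trans (expR_le_quadratic _) _.
            apply: le_trans (lb k kN); apply: ler_wpM2l => //.
            by apply: le_trans (ler_norm _) (Zb _ _).
          by rewrite /q exprMn addrA mulrA.
      rewrite -Rintegral_EFin; last first.
        exact: (bounded_measurable_integrable nu (bounded_measurableZ e0 bq)).
      rewrite RintegralZl//; last exact: (bounded_measurable_integrable nu bq).
      rewrite lee_fin /U; apply: (@le_trans _ _ (e0 * expR (2 * l ^+ 2 * V))).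
        by rewrite ler_wpM2l ?expR_ge0.
      by rewrite -expRD ler_expR -natr1; lra.
have pE : P [set w | exists2 k, (k <= N)%N & (r <= M k w)%R] \is a fin_num.
  apply: fin_num_measure.
  by apply: (measurable_exists_ge (D := [set k | (k <= N)%N]) (u := M)) => k _.
move: H; rewrite -[X in (_ * X <= _)%E]fineK// -[X in (X <= _)%E]fineK// -EFinM !lee_fin.
rewrite mulrC -ler_pdivlMr ?expR_gt0// mul1r /lam -expRN opprB => H.
by rewrite -[leLHS]fineK// lee_fin.
Qed.

Lemma increment_sum_tail (n : nat) (e T : R) : 0 < e ->
  (forall N, (n <= N)%N -> \sum_(n <= i < N) v i <= T) ->
  (P [set w | exists2 k, (n <= k)%N & (e <= `|M k w - M n w|)%R] <=
   (T / e ^+ 2)%R%:E)%E.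
Proof.
move=> e0 vT.
have mMO k : measurable_fun setT (M k).
  apply: (history_measurable_fun (X := X) (k := k)).
  exact: increment_sum_history_measurable.
pose E N := [set w | exists2 k, (n <= k <= n + N)%N & (e <= `|M k w - M n w|)%R].
have mE N : measurable (E N).
  apply: (measurable_exists_ge (D := [set k | (n <= k <= n + N)%N])
    (u := fun k w => `|M k w - M n w|)) => k _.
  by apply: measurableT_comp => //; exact: measurable_funB.
have -> : [set w | exists2 k, (n <= k)%N & (e <= `|M k w - M n w|)%R] = \bigcup_N E N.
  apply/seteqP; split=> w /= [k].
    by move=> nk ek; exists k => //; exists k => //; rewrite nk leq_addl.
  by move=> _ [j /andP[nj _] ej]; exists j.
have cE : P (E N) @[N --> \oo] --> P (\bigcup_N E N).
  apply: nondecreasing_cvg_mu => //; first exact: bigcupT_measurable.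
  move=> N N' NN'; apply/subsetPset => w [k /andP[nk kN] ek].
  by exists k; rewrite // nk (leq_trans kN)// leq_add2l.
rewrite -(cvg_lim (@ereal_hausdorff _) cE); apply: lime_le.
  by apply/cvg_ex; exists (P (\bigcup_N E N)).
apply: nearW => N.
have := increment_sum_kolmogorov (leq_addr N n) e0.
rewrite -[X in (_ * X <= _)%E]fineK; last by rewrite fin_num_measure//; exact: mE.
rewrite -EFinM lee_fin mulrC -ler_pdivlMr ?exprn_gt0// => H.
rewrite -[leLHS]fineK; last by rewrite fin_num_measure//; exact: mE.
rewrite lee_fin; apply: le_trans H _.
by rewrite ler_wpM2r ?invr_ge0 ?sqr_ge0// vT// leq_addr.
Qed.

(** Tails of the variance series bound the probability of a late oscillation, so almost every path
    is Cauchy. *)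
Lemma increment_sum_cvg : cvgn (series v) ->
  {ae P, forall w, cvgn (fun n => M n w)}.
Proof.
move=> cv; pose tail n := limn (series v) - series v n.
have tailP n N : (n <= N)%N -> \sum_(n <= i < N) v i <= tail n.
  move=> nN; rewrite /tail lerBrDr addrC [X in X + _]/series/= -big_cat_nat//=.
  apply: nondecreasing_cvgn_le => //.
  by apply: nondecreasing_series => i _ _.
have tail0 : tail n @[n --> \oo] --> 0.
  by rewrite -(subrr (limn (series v))); apply: cvgB => //; exact: cvg_cst.
(* A path fails to be Cauchy only if, for some scale [m], it lies in [E m n] for all [n]; each such
   intersection is null. *)
pose E (m n : nat) :=
  [set w | exists2 k, (n <= k)%N & (m.+1%:R^-1 <= `|M k w - M n w|)%R].
have mE m n : measurable (E m n).
  apply: (measurable_exists_ge (D := [set k | (n <= k)%N])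
    (u := fun k w => `|M k w - M n w|)) => k _.
  apply: measurableT_comp => //; apply: measurable_funB.
    apply: (history_measurable_fun (X := X) (k := k)).
    exact: increment_sum_history_measurable.
  apply: (history_measurable_fun (X := X) (k := n)).
  exact: increment_sum_history_measurable.
have F0 m : P.-negligible (\bigcap_n E m n).
  have mF : measurable (\bigcap_n E m n) by exact: bigcapT_measurable.
  exists (\bigcap_n E m n); split => //.
  have pF : P (\bigcap_n E m n) \is a fin_num by rewrite fin_num_measure.
  apply/eqP; rewrite eq_le measure_ge0 andbT -[leLHS]fineK// lee_fin.
  have : tail n / m.+1%:R^-1 ^+ 2 @[n --> \oo] --> (0 / m.+1%:R^-1 ^+ 2 : R).
    exact: cvgMl.
  rewrite mul0r => c0; rewrite -(cvg_lim (@Rhausdorff _) c0); apply: limr_ge.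
    by apply/cvg_ex; exists 0.
  apply: nearW => n; rewrite -lee_fin fineK//.
  have me0 : 0 < m.+1%:R^-1 :> R by rewrite invr_gt0.
  apply: le_trans (increment_sum_tail me0 (tailP n)).
  by apply: le_measure; rewrite ?inE//; [exact: mE|exact: bigcap_inf].
apply: negligibleS (negligible_bigcup F0) => w /= ncv.
apply: contrapT => nF; apply: ncv; apply/cauchy_cvgP; apply: cauchy_exP => e e0.
have [//|m me] := @ltr_add_invr R 0 e; rewrite add0r in me.
have [n nE] : exists n, ~ E m n w.
  by apply/existsNP => allE; apply: nF; exists m => // n _; exact: allE.
exists (M n w); exists n => // k /= nk; rewrite /ball/= distrC.
rewrite ltNge; apply/negP => ek; apply: nE; exists k => //.
by apply: le_trans ek; exact: ltW.
Qed.

End martingale_sums.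

(** Abel summation against the remainders [r n = s n - l]. Beyond [K] these are at most [e / 4], and
    the boundary terms and the monotone sum of increments of [a] add up to [e / 2 * a n]; the first
    [K] terms take the other half of [e]. *)
Lemma kronecker (R : realType) (a x : nat -> R) :
  (forall n, 0 < a n) -> {homo a : m n / (m <= n)%N >-> m <= n} ->
  a n @[n --> \oo] --> +oo -> cvgn (fun n => \sum_(k < n) x k / a k) ->
  (\sum_(k < n) x k) / a n @[n --> \oo] --> 0.
Proof.
move=> a0 ha aoo cs; pose s n := \sum_(k < n) x k / a k.
set l := limn s; have sl : s n @[n --> \oo] --> l by exact: cs.
pose r n := s n - l.
apply/cvgrPdist_le => e e0.
have e4 : 0 < e / 4 by rewrite divr_gt0.
have [K _ HK] : \forall n \near \oo, `|r n| <= e / 4.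
  move/cvgrPdist_le : sl => /(_ _ e4); apply: filterS => n.
  by rewrite distrC.
pose B := `|\sum_(k < K) x k|.
have xE k : x k = a k * (r k.+1 - r k).
  have -> : r k.+1 - r k = x k / a k by rewrite /r /s big_ord_recr/=; ring.
  by rewrite mulrC divfK// gt_eqF.
have bound n : (K <= n)%N -> `|\sum_(K <= k < n) x k| <= e / 2 * a n.
  move=> Kn.
  have -> : \sum_(K <= k < n) x k = (a n * r n - a K * r K) -
      \sum_(K <= k < n) (a k.+1 - a k) * r k.+1.
    rewrite -(telescope_sumr (fun k => a k * r k))// -sumrB.
    by apply: eq_bigr => k _; rewrite xE; lra.
  have S1 : `|\sum_(K <= k < n) (a k.+1 - a k) * r k.+1| <= e / 4 * (a n - a K).
    apply: le_trans (ler_norm_sum _ _ _) _.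
    rewrite -(telescope_sumr a)// mulr_sumr; rewrite big_nat [leRHS]big_nat.
    apply: ler_sum => k /andP[Kk kn].
    have ak : 0 <= a k.+1 - a k by rewrite subr_ge0 ha.
    by rewrite normrM (ger0_norm ak) mulrC ler_wpM2r// HK//= leqW.
  have S2 : `|a n * r n| <= e / 4 * a n.
    rewrite normrM mulrC (gtr0_norm (a0 n)).
    by apply: ler_wpM2r; [exact: ltW|exact: HK].
  have S3 : `|a K * r K| <= e / 4 * a K.
    rewrite normrM mulrC (gtr0_norm (a0 K)).
    by apply: ler_wpM2r; [exact: ltW|exact: HK (leqnn K)].
  apply: le_trans (ler_normB _ _) _.
  apply: le_trans (lerD (ler_normB _ _) (lexx _)) _.
  by lra.
have [K' _ HK'] : \forall n \near \oo, B / (e / 2) <= a n.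
  by move/cvgryPge : aoo; exact.
exists (maxn K K') => // n /=; rewrite geq_max => /andP[Kn K'n].
rewrite sub0r normrN normrM normfV (gtr0_norm (a0 n)) ler_pdivrMr//.
rewrite -(big_mkord xpredT x) (@big_cat_nat _ _ _ K)//=.
apply: le_trans (ler_normD _ _) _; rewrite (splitr e) mulrDl lerD ?bound//.
by rewrite big_mkord -/B mulrC -ler_pdivrMr ?HK'// divr_gt0.
Qed.

(** * Truncated and recentred increments *)

Section truncation.
Context {R : realType} {dO d : measure_display} {Omega : measurableType dO}
  {G : borelGroupType d} {P : probability Omega R}.
Hypothesis G_compact : compact [set: G].
Hypothesis G_metrizable : metrizable R G.
Variables (nu : probability G R) (X : nat -> {RV P >-> G}).
Hypothesis X_iid : iid_with_law nu X.
Variables (D : G * G -> R) (p C : R).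
Hypothesis mD : measurable_fun setT D.
Hypothesis p1 : 1 <= p.
Hypothesis iD : forall s, nu.-integrable setT (EFin \o (fun x => D (s, x))).
Hypothesis D0 : forall s, \int[nu]_x D (s, x) = 0.
Hypothesis DC : forall s, (\int[nu]_x (`|D (s, x)| `^ p)%:E <= C%:E)%E.

Definition truncate (t : R) (z : G * G) : R := if `|D z| <= t then D z else 0.

Definition truncated_mean (t : R) (s : G) : R := \int[nu]_x truncate t (s, x).

Definition truncated_increment (t : R) (z : G * G) : R :=
  truncate t z - truncated_mean t z.1.

Lemma truncate_bounded t : 0 <= t -> bounded_measurable t (truncate t).
Proof.
move=> t0; split; last by move=> z; rewrite /truncate; case: ifP; rewrite ?normr0.
apply: measurable_fun_if => //.
- apply: (measurable_fun_ler (f := fun z => `|D z|)) => //.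
  exact: measurableT_comp.
- exact: measurable_funTS.
Qed.

Let truncate_bounded_s t s : 0 <= t ->
  bounded_measurable t (fun x => truncate t (s, x)).
Proof.
move=> t0; split; last by move=> x; exact: (truncate_bounded t0).2.
by apply: (measurableT_comp (truncate_bounded t0).1); exact: pair1_measurable.
Qed.

Lemma truncated_mean_bounded t : 0 <= t -> bounded_measurable t (truncated_mean t).
Proof.
move=> t0; have [mT Tt] := truncate_bounded t0; split; last first.
  by move=> s; apply: norm_Rintegral_le; exact: truncate_bounded_s.
have shift s : (truncated_mean t s)%:E =
    (\int[nu]_x (t + truncate t (s, x))%:E - t%:E)%E.
  have bs := truncate_bounded_s s t0.
  rewrite -Rintegral_EFin; last first.
    exact: (bounded_measurable_integrable nu (bounded_measurableD
      (bounded_measurable_cst _ t) bs)).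
  rewrite RintegralD//; last 2 first.
  - exact: (bounded_measurable_integrable nu (bounded_measurable_cst _ t)).
  - exact: (bounded_measurable_integrable nu bs).
  by rewrite Rintegral_probability_cst -EFinB addrC addKr.
have : measurable_fun setT (fun s => \int[nu]_x (t + truncate t (s, x))%:E - t%:E)%E.
  apply: emeasurable_funB => //.
  apply: (measurable_fun_fubini_tonelli_F (fun z => (t + truncate t z)%:E)).
    by apply/measurable_EFinP; exact: measurable_funD.
  move=> z; have := Tt z; rewrite ler_norml lee_fin => /andP[? _].
  by rewrite -lerBlDl sub0r.
under eq_fun do rewrite -shift.
by move=> /measurable_EFinP.
Qed.

Lemma truncated_increment_bounded t : 0 <= t ->
  bounded_measurable (t + t) (truncated_increment t).
Proof.
move=> t0; have [mT Tt] := truncate_bounded t0.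
have [mm mt] := truncated_mean_bounded t0; split.
  by apply: measurable_funB => //; apply: (measurableT_comp mm); exact: measurable_fst.
by move=> z; apply: le_trans (ler_normB _ _) _; apply: lerD.
Qed.

Lemma truncated_increment_mean0 t s : 0 <= t ->
  \int[nu]_x truncated_increment t (s, x) = 0.
Proof.
move=> t0; rewrite /truncated_increment /= RintegralB//; last 2 first.
- exact: (bounded_measurable_integrable nu (truncate_bounded_s s t0)).
- exact: (bounded_measurable_integrable nu (bounded_measurable_cst _ (truncated_mean t s))).
by rewrite Rintegral_probability_cst subrr.
Qed.

(** Recentring can only lower the second moment. The form [W + V |D| ^ p] serves both parts: [W = 0]
    and [V = t ^ (2 - p)] when [p <= 2], and [W = V = 1] when [p > 2]. *)
Lemma truncated_increment_variance t s (W V : R) : 0 <= t -> 0 <= W -> 0 <= V ->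
  (forall x, truncate t (s, x) ^+ 2 <= W + V * `|D (s, x)| `^ p) ->
  \int[nu]_x (truncated_increment t (s, x)) ^+ 2 <= W + V * C.
Proof.
move=> t0 W0 V0 TV; have bs := truncate_bounded_s s t0.
set m := truncated_mean t s.
have bs2 : bounded_measurable (t ^+ 2) (fun x => truncate t (s, x) ^+ 2).
  split; first by apply: measurable_funX; exact: bs.1.
  by move=> x; rewrite normrX lerXn2r// ?nnegrE//; exact: bs.2.
have -> : \int[nu]_x (truncated_increment t (s, x)) ^+ 2 =
    \int[nu]_x (truncate t (s, x) ^+ 2 + (- 2 * m * truncate t (s, x) + m ^+ 2)).
  by apply: eq_Rintegral => x _; rewrite /truncated_increment -/m; ring.
have b1 := bounded_measurableZ (- 2 * m) bs.
have bm := bounded_measurable_cst G (m ^+ 2).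
rewrite RintegralD//; last 2 first.
- exact: (bounded_measurable_integrable nu bs2).
- exact: (bounded_measurable_integrable nu (bounded_measurableD b1 bm)).
rewrite RintegralD//; last 2 first.
- exact: (bounded_measurable_integrable nu b1).
- exact: (bounded_measurable_integrable nu bm).
rewrite RintegralZl//; last exact: (bounded_measurable_integrable nu bs).
rewrite Rintegral_probability_cst -/(truncated_mean t s) -/m.
apply: (@le_trans _ _ (\int[nu]_x truncate t (s, x) ^+ 2)).
  have := sqr_ge0 m; nra.
rewrite -lee_fin Rintegral_EFin; last exact: (bounded_measurable_integrable nu bs2).
have mDp : measurable_fun setT (fun x => (`|D (s, x)| `^ p)%:E).
  apply/measurable_EFinP; apply: (measurableT_comp (measurable_powR p)).
  by apply: measurableT_comp => //; apply: (measurableT_comp mD); exact: pair1_measurable.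
apply: (@le_trans _ _ (\int[nu]_x (W%:E + V%:E * (`|D (s, x)| `^ p)%:E))%E).
  apply: ge0_le_integral => //.
  - by move=> x _; rewrite lee_fin sqr_ge0.
  - by apply/measurable_EFinP; exact: bs2.1.
  - by apply: emeasurable_funD => //; exact: measurable_funeM.
  - by move=> x _; rewrite -EFinM -EFinD lee_fin.
rewrite ge0_integralD//; [|by move=> x _; rewrite mule_ge0|exact: measurable_funeM].
rewrite ge0_integralZlT// integral_cst//= probability_setT mule1 EFinD leeD2l//.
by rewrite EFinM lee_wpmul2l.
Qed.

(** As [D] has mean zero, the truncated mean is minus the mean of the part cut off, where [|D| > t]
    and so [|D| <= t ^ (1 - p) |D| ^ p]. *)
Lemma truncated_mean_le t s : 0 < t ->
  `|truncated_mean t s| <= t `^ (1 - p) * C.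
Proof.
move=> t0; have bs := truncate_bounded_s s (ltW t0).
have iT := bounded_measurable_integrable nu bs.
have mDp : measurable_fun setT (fun x => (`|D (s, x)| `^ p)%:E).
  apply/measurable_EFinP; apply: (measurableT_comp (measurable_powR p)).
  by apply: measurableT_comp => //; apply: (measurableT_comp mD); exact: pair1_measurable.
have -> : truncated_mean t s = \int[nu]_x (truncate t (s, x) - D (s, x)).
  by rewrite RintegralB// D0 subr0.
have mdiff : measurable_fun setT (fun x => truncate t (s, x) - D (s, x)).
  apply: measurable_funB; first exact: bs.1.
  by apply: (measurableT_comp mD); exact: pair1_measurable.
rewrite -lee_fin -abse_EFin Rintegral_EFin; last exact: (integrableB measurableT iT (iD s)).
apply: le_trans (le_abse_integral _ _ _) _ => //; first exact/measurable_EFinP.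
apply: (@le_trans _ _ (\int[nu]_x ((t `^ (1 - p))%:E * (`|D (s, x)| `^ p)%:E))%E).
  apply: ge0_le_integral => //.
  - by apply: measurableT_comp => //; exact/measurable_EFinP.
  - exact: measurable_funeM.
  - move=> x _; rewrite abse_EFin -EFinM lee_fin /truncate.
    have [_|Dt] := leP `|D (s, x)| t.
      by rewrite subrr normr0 mulr_ge0// powR_ge0.
    rewrite sub0r normrN; set y := `|D (s, x)| in Dt *.
    have y0 : 0 < y by exact: lt_trans Dt.
    rewrite -{1}(powRr1 (ltW y0)) -{1}(subrK p 1) powRD; last by rewrite (gt_eqF y0) implybT.
    rewrite ler_wpM2r ?powR_ge0// -opprB !powRN lef_pV2 ?posrE ?powR_gt0//.
    by rewrite ge0_ler_powR ?nnegrE ?subr_ge0// ltW.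
rewrite ge0_integralZlT//; last by rewrite lee_fin powR_ge0.
by rewrite EFinM lee_wpmul2l// lee_fin powR_ge0.
Qed.

(** Markov's inequality with the position [S_k] frozen, so that the uniform moment bound applies. *)
Lemma increment_exceed k t : 0 < t ->
  (P [set w | (t < `|D (walk X k w, X k w)|)%R] <= (t `^ (- p) * C)%R%:E)%E.
Proof.
move=> t0.
have mDk := increment_history_measurable G_compact G_metrizable (X := X) (k := k) mD.
pose Phi (z : history X k * G) : \bar R :=
  ((t `^ (- p))%:E * (`|D (walk X k z.1, z.2)| `^ p)%:E)%E.
have mPhi : measurable_fun setT Phi.
  apply: measurable_funeM; apply/measurable_EFinP.
  apply: (measurableT_comp (measurable_powR p)).
  by apply: measurableT_comp.
have Phi0 z : (0 <= Phi z)%E by rewrite mule_ge0// lee_fin powR_ge0.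
have mabs : measurable_fun setT (fun w => `|D (walk X k w, X k w)|).
  apply: measurableT_comp => //; apply: (measurableT_comp mD).
  apply: measurable_fun_pair; last exact: measurable_funP.
  exact: (history_measurable_fun (walk_history_measurable G_compact G_metrizable (X := X) (k := k))).
have mE : measurable [set w | (t < `|D (walk X k w, X k w)|)%R].
  have := mabs measurableT `]t, +oo[%classic (measurable_itv _).
  rewrite setTI; congr (measurable _).
  by apply/seteqP; split=> w /=; rewrite in_itv/= andbT.
rewrite -[X in P X]setIT -(integral_indic P measurableT mE).
apply: (@le_trans _ _ (\int[P]_w Phi (w, X k w))%E).
  apply: ge0_le_integral => //.
  - by apply/measurable_EFinP; exact: measurable_indic.
  - apply: measurable_funeM; apply/measurable_EFinP.
    exact: (measurableT_comp (measurable_powR p) mabs).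
  - move=> w _; rewrite indicE; case: (boolP (_ \in _)) => [/set_mem/= tD|_]; last first.
      exact: Phi0.
    rewrite /Phi -EFinM lee_fin powRN mulrC ler_pdivlMr ?powR_gt0// mul1r.
    by rewrite ge0_ler_powR ?nnegrE ?(le_trans ler01 p1)// ltW.
rewrite (integral_history_step X_iid mPhi Phi0).
apply: (@le_trans _ _ (\int[P]_w (t `^ (- p) * C)%:E)%E); last first.
  by rewrite integral_cst//= probability_setT mule1.
apply: ge0_le_integral => //.
- by move=> w _; exact: integral_ge0.
- apply: (history_measurable_fun (X := X) (k := k)).
  exact: (measurable_fun_fubini_tonelli_F Phi).
- move=> w _; rewrite /Phi/= ge0_integralZlT//; last 2 first.
  + apply/measurable_EFinP; apply: (measurableT_comp (measurable_powR p)).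
    by apply: measurableT_comp => //; apply: (measurableT_comp mD); exact: pair1_measurable.
  + by rewrite lee_fin powR_ge0.
  by rewrite EFinM lee_wpmul2l// lee_fin powR_ge0.
Qed.

End truncation.

(** * Strong law for the increments when [p <= 2] *)

Section strong_law.
Context {R : realType} {dO d : measure_display} {Omega : measurableType dO}
  {G : borelGroupType d} {P : probability Omega R}.
Hypothesis G_compact : compact [set: G].
Hypothesis G_metrizable : metrizable R G.
Variables (nu : probability G R) (X : nat -> {RV P >-> G}).
Hypothesis X_iid : iid_with_law nu X.
Variables (D : G * G -> R) (p C : R).
Hypothesis mD : measurable_fun setT D.
Hypothesis p1 : 1 <= p.
Hypothesis iD : forall s, nu.-integrable setT (EFin \o (fun x => D (s, x))).
Hypothesis D0 : forall s, \int[nu]_x D (s, x) = 0.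
Hypothesis DC : forall s, (\int[nu]_x (`|D (s, x)| `^ p)%:E <= C%:E)%E.

Lemma moment_bound_ge0 : 0 <= C.
Proof.
rewrite -lee_fin; apply: le_trans (DC 1%g).
by apply: integral_ge0 => x _; rewrite lee_fin powR_ge0.
Qed.

Lemma borel_cantelli_real (F : nat -> set Omega) (u : nat -> R) :
  (forall k, measurable (F k)) -> (forall k, (P (F k) <= (u k)%:E)%E) ->
  cvgn (series u) -> {ae P, forall w, \forall k \near \oo, ~ F k w}.
Proof.
move=> mF Fu cu.
have : P (lim_sup_set F) = 0%E.
  apply: lim_sup_set_cvg0 => //.
  apply: (@le_lt_trans _ _ (\sum_(n <oo) (u n)%:E)%E).
    by apply: lee_nneseries => // n _; exact: Fu.
  rewrite (_ : (\sum_(n <oo) (u n)%:E = (limn (series u))%:E)%E) ?ltry//.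
  rewrite -EFin_lim//; congr (limn _); apply/funext => n.
  by rewrite /= sumEFin.
move=> F0; exists (lim_sup_set F); split => //.
  apply: bigcap_measurable => [|n _]; first by exists 0%N.
  exact: bigcup_measurable.
move=> w /= nF n _; apply: contrapT => nFw; apply: nF.
exists n => // k /= nk Fk; apply: nFw; by exists k.
Qed.

Lemma eventually_truncated (t : nat -> R) : (forall k, 0 < t k) ->
  cvgn (series (fun k => t k `^ (- p))) ->
  {ae P, forall w, \forall k \near \oo, `|D (walk X k w, X k w)| <= t k}.
Proof.
move=> t0 ct.
have mabs k : measurable_fun setT (fun w => `|D (walk X k w, X k w)|).
  apply: measurableT_comp => //; apply: (measurableT_comp mD).
  apply: measurable_fun_pair; last exact: measurable_funP.
  exact: (history_measurable_fun (walk_history_measurable G_compact G_metrizable (X := X) (k := k))).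
pose F k := [set w | t k < `|D (walk X k w, X k w)|].
have mF k : measurable (F k).
  have := mabs k measurableT `]t k, +oo[%classic (measurable_itv _).
  rewrite setTI; congr (measurable _).
  by apply/seteqP; split=> w /=; rewrite in_itv/= andbT.
have := @borel_cantelli_real F (fun k => t k `^ (- p) * C) mF _ _.
case=> [k||N [mN N0 NF]].
- exact: (increment_exceed G_compact G_metrizable X_iid mD p1 DC).
- rewrite (_ : series _ = (fun n => series (fun k => t k `^ (- p)) n * C)).
    by apply: is_cvgMl => //; exact: is_cvg_cst.
  by apply/funext => n; rewrite /series/= mulr_suml.
- exists N; split => // w /= nw; apply: NF => /= Fw; apply: nw.
  by apply: filterS Fw => k /= /negP; rewrite -leNgt.
Qed.

(** Truncating at [a k] costs the same amount [C a_k ^ (- p)] three times: as variance of the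
    normalized increment, as normalized mean, and as probability of exceeding the level. Its
    summability makes the normalized series converge, and Kronecker's lemma concludes. *)
Lemma increment_strong_law (a : nat -> R) : p <= 2 ->
  (forall k, 0 < a k) -> {homo a : m n / (m <= n)%N >-> m <= n} ->
  a n @[n --> \oo] --> +oo -> cvgn (series (fun k => a k `^ (- p))) ->
  {ae P, forall w,
    increment_sum X (fun=> D) n w / a n @[n --> \oo] --> 0}.
Proof.
move=> p2 a0 ha aoo ca.
have C0 := moment_bound_ge0.
have cCa : cvgn (series (fun k => C * a k `^ (- p))).
  rewrite (_ : series _ = (fun n => C * series (fun k => a k `^ (- p)) n)).
    by apply: is_cvgMr => //; exact: is_cvg_cst.
  by apply/funext => n; rewrite /series/= mulr_sumr.
pose T k := truncated_increment nu D (a k).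
pose m k := truncated_mean nu D (a k).
pose Z k z := (a k)^-1 * T k z.
have bT k := truncated_increment_bounded nu mD (ltW (a0 k)).
have bZ k := bounded_measurableZ (a k)^-1 (bT k).
have bTs k s : bounded_measurable (a k + a k) (fun x => T k (s, x)).
  split; last by move=> x; exact: (bT k).2.
  by apply: (measurableT_comp (bT k).1); exact: pair1_measurable.
have Z0 k s : \int[nu]_x Z k (s, x) = 0.
  rewrite RintegralZl//; last exact: (bounded_measurable_integrable nu (bTs k s)).
  by rewrite (truncated_increment_mean0 nu mD s (ltW (a0 k))) mulr0.
have Zv k s : \int[nu]_x Z k (s, x) ^+ 2 <= C * a k `^ (- p).
  have bTs2 : bounded_measurable ((a k + a k) ^+ 2) (fun x => T k (s, x) ^+ 2).
    split; first by apply: measurable_funX; exact: (bTs k s).1.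
    have ak0 := ltW (a0 k).
    by move=> x; rewrite normrX lerXn2r// ?nnegrE ?addr_ge0//; exact: (bTs k s).2.
  under eq_Rintegral do rewrite exprMn.
  rewrite RintegralZl//; last exact: (bounded_measurable_integrable nu bTs2).
  apply: (@le_trans _ _ ((a k)^-1 ^+ 2 * (0 + a k `^ (2 - p) * C))).
    rewrite ler_wpM2l ?sqr_ge0//.
    apply: (truncated_increment_variance mD DC) => //.
    - exact: ltW.
    - exact: powR_ge0.
    - move=> x; rewrite add0r /truncate; case: ifPn => [Da|_]; last first.
        by rewrite expr0n mulr_ge0// powR_ge0.
      have [->|Dn0] := eqVneq (D (s, x)) 0.
        by rewrite expr0n mulr_ge0// powR_ge0.
      have D1 : 0 < `|D (s, x)| by rewrite normr_gt0.
      rewrite -[leLHS]real_normK ?num_real// -powR_mulrn//.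
      (* [|D| ^ 2 = |D| ^ (2 - p) |D| ^ p], and [2 - p >= 0] lets the first factor be bounded by
         [a_k ^ (2 - p)]. *)
      rewrite -{1}(subrK p 2%:R) powRD; last by rewrite (gt_eqF D1) implybT.
      by rewrite ler_wpM2r ?powR_ge0// ge0_ler_powR ?nnegrE ?subr_ge0// ltW.
  rewrite add0r powRD; last by rewrite (gt_eqF (a0 k)) implybT.
  rewrite (powR_mulrn _ (ltW (a0 k))) -mulrA exprVn mulKf ?expf_neq0 ?gt_eqF//.
  by rewrite mulrC.
have cvgZ := increment_sum_cvg G_compact G_metrizable X_iid
  (fun k => (bZ k).1) (fun k => (bZ k).2) Z0 Zv cCa.
have evt := eventually_truncated a0 ca.
move: cvgZ evt; apply: filterS2 => w cZ evD.
apply: (@kronecker R a (fun k => D (walk X k w, X k w))) => //.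
pose Dk k := D (walk X k w, X k w).
pose y k := m k (walk X k w) / a k.
(* The truncation error, zero as soon as the increment stays within its level. *)
pose e k := Dk k / a k - Z k (walk X k w, X k w) - y k.
rewrite (_ : (fun n => _) = fun n => increment_sum X Z n w + (series y n + series e n)); last first.
  apply/funext => n; rewrite /increment_sum /series/= !big_mkord -!big_split/=.
  by apply: eq_bigr => k _; rewrite /e /Dk; ring.
apply: is_cvgD => //; apply: is_cvgD.
  apply: normed_cvg; apply: (@series_le_cvg _ _ (fun k => C * a k `^ (- p))) => //.
  - by move=> k; exact: normr_ge0.
  - by move=> k; rewrite mulr_ge0// powR_ge0.
  - move=> k; rewrite /= /y normrM normfV (gtr0_norm (a0 k)) ler_pdivrMr//.
    apply: le_trans (truncated_mean_le mD p1 iD D0 DC _ (a0 k)) _.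
    rewrite mulrC -mulrA ler_wpM2l// -[X in _ <= _ * X](powRr1 (ltW (a0 k))) -powRD; last by rewrite (gt_eqF (a0 k)) implybT.
    by rewrite [- p + 1]addrC.
have [K _ HK] : \forall k \near \oo, e k = 0.
  apply: filterS evD => k Dak.
  rewrite /e /y /Z /T /m /truncated_increment /= /truncate Dak /Dk; ring.
apply/cvg_ex; exists (series e K); apply: cvg_near_cst; exists K => // n /= Kn.
rewrite /series/= (@big_cat_nat _ _ _ K)//=.
rewrite [X in _ + X]big_nat [X in _ + X]big1 ?addr0// => k /andP[Kk _].
exact: HK.
Qed.

End strong_law.

(** * Summability of [1 / varphi] *)

Section bertrand_series.
Variable R : realType.

Lemma ln_sub_ge (u v : R) : 0 < u -> 0 < v -> (v - u) / v <= ln v - ln u.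
Proof.
move=> u0 v0; have uv0 : 0 < u / v by exact: divr_gt0.
have := expR_ge1Dx (ln (u / v)); rewrite lnK ?posrE// ln_div ?posrE//.
rewrite mulrBl divff ?gt_eqF//; lra.
Qed.

Lemma powR_telescope_ge (u v e : R) : 0 < u -> 0 < v -> 0 < e ->
  e * ((v - u) * v `^ (- (1 + e))) <= u `^ (- e) - v `^ (- e).
Proof.
move=> u0 v0 e0.
have -> : u `^ (- e) = v `^ (- e) * expR (e * (ln v - ln u)).
  by rewrite /powR !gt_eqF// -expRD; congr expR; ring.
have -> : v `^ (- (1 + e)) = v `^ (- e) / v.
  rewrite -(powR_inv1 (ltW v0)) -powRD ?(gt_eqF v0) ?implybT//.
  by congr (_ `^ _); ring.
have P0 := powR_gt0 (- e) v0.
rewrite -[X in _ <= _ - X]mulr1 -mulrBr.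
rewrite (_ : e * _ = v `^ (- e) * (e * ((v - u) / v))); last by ring.
rewrite ler_pM2l// lerBrDl; apply: le_trans (expR_ge1Dx _).
by rewrite lerD2l ler_pM2l// ln_sub_ge.
Qed.

(** A discrete form of integrating [L ^ (- (1 + e))] in [L]: the terms are dominated by the
    telescoping differences of [L ^ (- e) / e]. With [L] an iterated logarithm it handles [varphi],
    with [L k = k + 1] the ordinary power series. *)
Lemma cvg_series_power_increments (L : nat -> R) (e : R) :
  (forall k, 0 < L k) -> (forall k, L k <= L k.+1) -> 0 < e ->
  cvgn (series (fun k => (L k.+1 - L k) * L k.+1 `^ (- (1 + e)))).
Proof.
move=> L0 LS e0; apply: nondecreasing_is_cvgn.
  by apply: nondecreasing_series => k _ _; rewrite mulr_ge0 ?powR_ge0// subr_ge0.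
exists (e^-1 * L 0%N `^ (- e)) => _ [n _ <-].
rewrite ler_pdivlMl// /series/= mulr_sumr.
apply: (@le_trans _ _ (\sum_(0 <= k < n) (L k `^ (- e) - L k.+1 `^ (- e)))).
  by apply: ler_sum => k _; exact: powR_telescope_ge.
rewrite -[leLHS]opprK -sumrN; under eq_bigr do rewrite opprB.
by rewrite telescope_sumr// opprB lerBlDr lerDl powR_ge0.
Qed.

(** The shift by one compares a term at [k + 1] with an increment from [k] to [k + 1]. *)
Lemma cvg_series_shift_le (u v : nat -> R) (N : nat) :
  (forall k, 0 <= v k) -> (forall k, (N <= k)%N -> 0 <= u k.+1 <= v k) ->
  cvgn (series v) -> cvgn (series u).
Proof.
move=> v0 uv cv.
pose u' k := if (k <= N)%N then 0 else u k.
have cu' : cvgn (series u').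
  have : cvgn (series (fun k => u' k.+1)).
    apply: series_le_cvg cv => // k; rewrite /u'; case: ifPn; rewrite -?ltnNge ?ltnS//.
      by move=> Nk; have /andP[] := uv k Nk.
    by move=> Nk; have /andP[] := uv k Nk.
  move=> /cvg_ex[l cl]; apply/cvg_ex; exists l; rewrite -cvg_shiftS.
  rewrite (_ : (fun n => _) = series (fun k => u' k.+1))//.
  by apply/funext => n; rewrite /series/= big_nat_recl// /u' leq0n add0r.
rewrite (_ : series u = fun n => series u' n + series (fun k => u k - u' k) n); last first.
  apply/funext => n; rewrite /series/= -big_split/=.
  by apply: eq_bigr => k _; ring.
apply: is_cvgD => //; apply/cvg_ex; exists (series (fun k => u k - u' k) N.+1).
apply: cvg_near_cst; exists N.+1 => // n /= Nn.
rewrite /series/= (@big_cat_nat _ _ _ N.+1)//=.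
rewrite [X in _ + X]big_nat [X in _ + X]big1 ?addr0//.
by move=> k /andP[Nk _]; rewrite /u' leqNgt Nk subrr.
Qed.

Lemma iterated_log_large (i : nat) (A : R) :
  exists N, forall n, (N <= n)%N -> A <= iterated_log i n%:R.
Proof.
elim: i A => [|i IH] A.
  exists (Num.truncn `|A|).+1 => n Nn; rewrite /iterated_log/=.
  apply: le_trans (ler_norm _) _; apply: ltW; apply: lt_le_trans (truncnS_gt _) _.
  by rewrite ler_nat.
have [N HN] := IH (expR A); exists N => n /HN An.
rewrite /iterated_log/= -[A]expRK ler_ln ?posrE ?expR_gt0//.
exact: lt_le_trans (expR_gt0 A) An.
Qed.

(** Beyond this threshold every logarithm is taken at a positive argument, so no default value of
    [ln] intervenes. *)
Lemma iterated_logs_ge1 (m : nat) : exists N, forall n i, (N <= n)%N -> (i <= m)%N ->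
  1 <= iterated_log i n%:R :> R.
Proof.
elim: m => [|m [N HN]].
  have [N HN] := iterated_log_large 0 1; exists N => n i Nn.
  by rewrite leqn0 => /eqP ->; exact: HN.
have [N' HN'] := iterated_log_large m.+1 1; exists (maxn N N') => n i.
rewrite geq_max => /andP[Nn N'n]; rewrite leq_eqVlt => /orP[/eqP->|im].
  exact: HN'.
exact: HN.
Qed.

Section large_arguments.
Variables (m N : nat).
Hypothesis lg1 : forall n i, (N <= n)%N -> (i <= m)%N ->
  1 <= iterated_log i n%:R :> R.

Let lg0 n i : (N <= n)%N -> (i <= m)%N -> 0 < iterated_log i n%:R :> R.
Proof. by move=> Nn im; exact: lt_le_trans (lg1 Nn im). Qed.

Lemma iterated_log_homo n n' i : (N <= n)%N -> (n <= n')%N -> (i <= m)%N ->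
  iterated_log i n%:R <= iterated_log i n'%:R :> R.
Proof.
move=> Nn nn'; elim: i => [|i IH] im; first by rewrite /iterated_log/= ler_nat.
rewrite /iterated_log/= ler_ln ?posrE; first exact: IH (ltnW im).
  exact: lg0 (ltnW im).
exact: lg0 (leq_trans Nn nn') (ltnW im).
Qed.

(** The derivative of the [i]-th iterated logarithm is the inverse of the product of the earlier
    ones, the identity counting as the [0]-th. It decreases, so its value at the right endpoint
    bounds the increment from below. *)
Lemma iterated_log_increment n i : (N <= n)%N -> (i <= m)%N ->
  (\prod_(0 <= j < i) iterated_log j n.+1%:R)^-1 <=
  iterated_log i n.+1%:R - iterated_log i n%:R :> R.
Proof.
move=> Nn; have NSn := leqW Nn; elim: i => [|i IH] im.
  rewrite big_geq// invr1 /iterated_log/= -natr1; lra.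
have im' := ltnW im.
apply: le_trans (ln_sub_ge (lg0 Nn im') (lg0 NSn im')).
rewrite big_nat_recr//= invfM ler_pM2r ?invr_gt0; last exact: lg0.
exact: IH.
Qed.

Variable e : R.
Hypothesis e0 : 0 < e.
Hypothesis m1 : (1 <= m)%N.

Lemma varphiE n : varphi m e n =
  (\prod_(0 <= j < m) iterated_log j n%:R) * (iterated_log m n%:R) `^ (1 + e) :> R.
Proof. by rewrite /varphi [in RHS]big_ltn. Qed.

Lemma varphi_homo n n' : (N <= n)%N -> (n <= n')%N ->
  varphi m e n <= varphi m e n' :> R.
Proof.
move=> Nn nn'; rewrite !varphiE; apply: ler_pM.
- rewrite big_nat; apply: prodr_ge0 => j /andP[_ jm]; exact: ltW (lg0 Nn (ltnW jm)).
- exact: powR_ge0.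
- rewrite big_nat [leRHS]big_nat; apply: ler_prod => j /andP[_ jm].
  by rewrite ltW ?(lg0 Nn (ltnW jm))//= iterated_log_homo// ltnW.
- apply: ge0_ler_powR; rewrite ?nnegrE.
  + by rewrite addr_ge0// ltW.
  + exact: ltW (lg0 Nn (leqnn m)).
  + exact: ltW (lg0 (leq_trans Nn nn') (leqnn m)).
  + exact: iterated_log_homo.
Qed.

Lemma varphi_ge n : (N <= n)%N -> n%:R <= varphi m e n :> R.
Proof.
move=> Nn; rewrite /varphi -mulrA -[leLHS]mulr1 ler_wpM2l//.
apply: mulr_ege1.
  rewrite big_nat; apply: (big_ind (fun x => 1 <= x)) => // [x y x1 y1|j /andP[_ jm]].
    exact: mulr_ege1.
  exact: lg1 (ltnW jm).
rewrite -[leLHS](powRr0 (iterated_log m n%:R)); apply: ler_powR; first exact: lg1.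
by rewrite addr_ge0// ltW.
Qed.

Lemma varphi_gt0 n : (N <= n)%N -> 0 < varphi m e n :> R.
Proof.
move=> Nn; apply: lt_le_trans (varphi_ge Nn); have := lg1 Nn (leq0n m).
exact: lt_le_trans.
Qed.

(** With [L] the [m]-th iterated logarithm, [1 / varphi (k + 1)] is at most the increment of [L]
    times [L (k + 1) ^ (- (1 + e))]. The [maxn] freezes arguments below the threshold. *)
Lemma cvg_series_inv_varphi :
  cvgn (series (fun k => (varphi m e (maxn k N) : R)^-1)).
Proof.
pose L k : R := iterated_log m (maxn k N)%:R.
have L0 k : 0 < L k by apply: lg0 => //; exact: leq_maxr.
have LS k : L k <= L k.+1.
  apply: iterated_log_homo => //; first exact: leq_maxr.
  by rewrite geq_max leq_maxr andbT (leq_trans (leqnSn k))// leq_maxl.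
apply: (@cvg_series_shift_le _ _ N _ _ (cvg_series_power_increments L0 LS e0)).
  by move=> k; rewrite mulr_ge0 ?powR_ge0// subr_ge0.
move=> k Nk; rewrite (maxn_idPl (leqW Nk)); have NSk := leqW Nk.
rewrite invr_ge0 ltW ?varphi_gt0//= /L (maxn_idPl Nk) (maxn_idPl NSk).
rewrite varphiE invfM powRN ler_wpM2r ?invr_ge0 ?powR_ge0//.
exact: iterated_log_increment.
Qed.

End large_arguments.
End bertrand_series.

(** * Upper bound of iterated-logarithm type when [p > 2] *)

Section iterated_logarithm.
Variable R : realType.

Lemma ln2_ge : 2^-1 <= ln (2 : R).
Proof.
have := @ln_sub_ge R 1 2 ltr01 (ltr0n _ 2); rewrite ln1; lra.
Qed.

Lemma dyadic_log_le (j : nat) (n : nat) : (0 < j)%N -> (2 ^ j <= n)%N ->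
  ln (j%:R / 2) <= ln (ln n%:R) :> R.
Proof.
move=> j0 jn.
have lj : j%:R / 2 <= ln n%:R :> R.
  apply: (@le_trans _ _ (ln ((2 ^ j)%:R))); last first.
    rewrite ler_ln ?posrE ?ltr0n ?expn_gt0// ?ler_nat//.
    by apply: leq_trans jn; rewrite expn_gt0.
  rewrite natrX lnXn// -[leRHS]mulr_natl ler_wpM2l//; exact: ln2_ge.
have j20 : 0 < j%:R / 2 :> R by rewrite divr_gt0// ltr0n.
by rewrite ler_ln ?posrE// (lt_le_trans j20).
Qed.

(** With [a] and [b] the square roots of [n] and [n + 1], the step [1 / b <= 2 (b - a)] amounts to
    [(b - a) ^ 2 >= 0], as [b ^ 2 = a ^ 2 + 1]. *)
Lemma sum_inv_sqrt_le (n : nat) :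
  \sum_(k < n) k.+1%:R `^ (- 2^-1) <= 2 * Num.sqrt n%:R :> R.
Proof.
elim: n => [|n IH]; first by rewrite big_ord0 sqrtr0 mulr0.
rewrite big_ord_recr/=; apply: le_trans (lerD IH (lexx _)) _.
rewrite powRN powR12_sqrt//; set a := Num.sqrt n%:R; set b := Num.sqrt n.+1%:R.
have b0 : 0 < b by rewrite sqrtr_gt0.
have a2 : a ^+ 2 = n%:R by exact: sqr_sqrtr.
have b2 : b ^+ 2 = a ^+ 2 + 1 by rewrite a2 natr1; exact: sqr_sqrtr.
rewrite -lerBrDl -[leLHS]mul1r ler_pdivrMr//.
have := sqr_ge0 (b - a); nra.
Qed.

(** The smallness condition of the exponential bound on the block up to [2 ^ j.+1]. The gap
    [1 / 2 - beta] leaves a power of [2 ^ j], which beats the logarithmic factor. *)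
Lemma dyadic_truncation_small (B beta : R) : 0 <= B -> 0 <= beta -> beta < 2^-1 ->
  \forall j \near \oo, forall k, (k < 2 ^ j.+1)%N ->
    Num.sqrt (ln (j%:R / 2)) / Num.sqrt (2 ^ j)%:R * (B * (k.+2)%:R `^ beta) <= 2^-1.
Proof.
move=> B0 be0 be1; pose del := 2^-1 - beta.
have del0 : 0 < del by rewrite subr_gt0.
pose K := (Num.truncn ((16 * B / del) ^+ 2)).+1.
exists K => // j /= Kj k kj.
have j0 : 0 < j%:R :> R by rewrite ltr0n (leq_trans _ Kj).
set y : R := (2 ^ j)%:R; have y0 : 0 < y by rewrite ltr0n expn_gt0.
have jB : 16 * B / del <= Num.sqrt j%:R.
  rewrite -[leLHS]ger0_norm ?mulr_ge0 ?invr_ge0 ?(ltW del0)//.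
  rewrite -sqrtr_sqr ler_wsqrtr//; apply: ltW; apply: lt_le_trans (truncnS_gt _) _.
  by rewrite ler_nat.
have sj : Num.sqrt (ln (j%:R / 2)) <= Num.sqrt j%:R :> R.
  rewrite ler_wsqrtr//; have := @le_ln1Dx R (j%:R / 2 - 1); rewrite addrCA subrr addr0.
  move=> H; apply: le_trans (H _) _; lra.
have ly : j%:R / 2 <= ln y.
  rewrite /y natrX lnXn// -[leRHS]mulr_natl ler_wpM2l//; exact: ln2_ge.
(* The [8] is a [4] from [k + 2 <= 4 * 2 ^ j] times a [2] for the target [1 / 2]; the [16] in [K]
   doubles it once more because [ln y] is only bounded below by [j / 2]. *)
have yd : 8 * B * Num.sqrt (ln (j%:R / 2)) <= y `^ del.
  rewrite /powR (gt_eqF y0); apply: le_trans (expR_ge1Dx _).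
  set s := Num.sqrt _ in sj *; set q := Num.sqrt j%:R in jB sj.
  have q2 : q ^+ 2 = j%:R by rewrite sqr_sqrtr// ltW.
  have q0 : 0 <= q by exact: sqrtr_ge0.
  have : 16 * B <= q * del by rewrite -ler_pdivrMr.
  move=> H1; have H2 : 8 * B * s <= 8 * B * q by rewrite ler_wpM2l// mulr_ge0.
  have H3 : 16 * B * q <= q * del * q by rewrite ler_wpM2r.
  have H4 : del * (j%:R / 2) <= del * ln y by rewrite ler_wpM2l// ltW.
  rewrite -q2 in H4; lra.
have ky : k.+2%:R `^ beta <= 4 * y `^ beta.
  apply: (@le_trans _ _ ((4 * y) `^ beta)).
    apply: ge0_ler_powR; rewrite ?nnegrE ?mulr_ge0 ?(ltW y0)//.
    rewrite /y -natrM ler_nat; apply: (@leq_trans (2 ^ j.+1).+1) => //.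
    by rewrite (mulnDl 2 2) -expnS -addn1 leq_add2l expn_gt0.
  rewrite powRM ?(ltW y0)// ler_wpM2r ?powR_ge0// -[leRHS]powRr1//.
  by apply: ler_powR; rewrite ?ler1n//; lra.
have -> : Num.sqrt y = y `^ del * y `^ beta.
  by rewrite -powRD ?(gt_eqF y0) ?implybT// subrK powR12_sqrt// ltW.
rewrite -mulrA mulrCA ler_pdivrMl; last by rewrite mulr_gt0// powR_gt0.
apply: (@le_trans _ _ (Num.sqrt (ln (j%:R / 2)) * (B * (4 * y `^ beta)))).
  by rewrite ler_wpM2l ?sqrtr_ge0// ler_wpM2l.
have := ler_wpM2r (powR_ge0 y beta) yd; lra.
Qed.

End iterated_logarithm.

Section law_of_iterated_logarithm.
Context {R : realType} {dO d : measure_display} {Omega : measurableType dO}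
  {G : borelGroupType d} {P : probability Omega R}.
Hypothesis G_compact : compact [set: G].
Hypothesis G_metrizable : metrizable R G.
Variables (nu : probability G R) (X : nat -> {RV P >-> G}).
Hypothesis X_iid : iid_with_law nu X.

Section bounded_increments.
Variables (Z : nat -> G * G -> R) (B beta V : R).
Hypothesis mZ : forall k, measurable_fun setT (Z k).
Hypotheses (B0 : 0 <= B) (beta0 : 0 <= beta) (beta1 : beta < 2^-1) (V0 : 0 <= V).
Hypothesis Zb : forall k z, `|Z k z| <= B * k.+2%:R `^ beta.
Hypothesis Z0 : forall k s, \int[nu]_x Z k (s, x) = 0.
Hypothesis Zv : forall k s, \int[nu]_x (Z k (s, x)) ^+ 2 <= V.

(** One-sided on purpose: the hypotheses are symmetric in sign, so the lower bound follows by
    applying it to the negated increments. *)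
Lemma increment_sum_upper_lil : {ae P, forall w, \forall n \near \oo,
  increment_sum X Z n w <= (4 * V + 2) * Num.sqrt (n%:R * ln (ln n%:R))}.
Proof.
have [K0 _ HK0] := dyadic_truncation_small B0 beta0 beta1.
pose K := maxn K0 2; pose l j : R := ln (j%:R / 2).
have K0j j : (K0 <= j + K)%N by rewrite (leq_trans (leq_maxl _ 2))// leq_addl.
have Kj j : (2 <= j + K)%N by rewrite (leq_trans (leq_maxr K0 _))// leq_addl.
have l0 j : 0 <= l (j + K)%N.
  by rewrite ln_ge0// ler_pdivlMr// mul1r ler_nat.
(* The exponential bound with parameter [sqrt (l j / 2 ^ j)] on the block up to
   [2 ^ j.+1] gives [expR (4 V (l j) - A (l j))], which is [(j / 2) ^ -2]. *)
pose A := 4 * V + 2.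
pose r j := A * (Num.sqrt (l j) * Num.sqrt (2 ^ j)%:R).
pose F j := [set w | exists2 k, (k <= 2 ^ (j + K).+1)%N &
  r (j + K)%N <= increment_sum X Z k w].
(* This equals [4 / (j + 2) ^ 2] and dominates the block bound because [K >= 2]. The factor
   [j.+2 - j.+1] puts it in the form of the increment series with exponent [1]. *)
pose u j : R := 4 * (j.+2%:R - j.+1%:R) * j.+2%:R `^ (- (1 + 1)).
have mF j : measurable (F j).
  apply: (measurable_exists_ge (D := [set k | (k <= 2 ^ (j + K).+1)%N])
    (u := increment_sum X Z)) => k _.
  apply: (history_measurable_fun (X := X) (k := k)).
  exact: (increment_sum_history_measurable G_compact G_metrizable).
have Fu j : (P (F j) <= (u j)%:E)%E.
  set i := (j + K)%N; set q : R := Num.sqrt (2 ^ i)%:R; set s := Num.sqrt (l i).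
  have q0 : 0 < q by rewrite sqrtr_gt0 ltr0n expn_gt0.
  have s0 : 0 <= s by exact: sqrtr_ge0.
  have sq0 : 0 <= s / q by rewrite divr_ge0// ltW.
  apply: le_trans (increment_sum_exponential (l := s / q) (V := V) (N := (2 ^ i.+1)%N)
    G_compact G_metrizable X_iid mZ Zb Z0 Zv (r i) sq0 V0 _ _) _ => //.
  - by move=> k ki; apply: HK0 => //; exact: K0j.
  - have q2 : q ^+ 2 = (2 ^ i)%:R by rewrite sqr_sqrtr.
    have s2 : s ^+ 2 = l i by rewrite sqr_sqrtr// l0.
    have -> : (2 ^ i.+1)%:R = 2 * q ^+ 2 by rewrite q2 expnS natrM.
    have -> : 2 * (s / q) ^+ 2 * V * (2 * q ^+ 2) - s / q * r i = - (1 + 1) * l i.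
      rewrite /r -/s -/q /A -s2; field; exact: lt0r_neq0.
    have -> : u j = 4 * j.+2%:R `^ (- (1 + 1)).
      by rewrite /u -(natr1 j.+1) (addrC j.+1%:R) addrK mulr1 nat1r.
    rewrite lee_fin.
    have -> : expR (- (1 + 1) * l i) = (i%:R / 2) `^ (- (1 + 1)).
      by rewrite /powR gt_eqF// divr_gt0// ltr0n (leq_trans _ (Kj j)).
    have E2 : (2^-1 : R) `^ (- (1 + 1)) = 4.
      by rewrite -powR_inv1// -powRrM mulN1r opprK -[1 + 1]/(2%:R) powR_mulrn//; ring.
    rewrite powRM// E2.
    rewrite mulrC ler_pM2l// !powRN lef_pV2 ?posrE ?powR_gt0// ?ltr0n ?(leq_trans _ (Kj j))//.
    apply: ge0_ler_powR; rewrite ?nnegrE ?ler0n// ler_nat -addn2 leq_add2l.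
    exact: leq_maxr.
have cu : cvgn (series u).
  have := @cvg_series_power_increments R (fun k => k.+1%:R) 1 (fun k => ltr0Sn _ k) _ ltr01.
  move=> H.
  rewrite (_ : series u = fun n => 4 * series (fun k => (k.+2%:R - k.+1%:R) * k.+2%:R `^ (- (1 + 1))) n).
    by apply: is_cvgMr; apply: H => k; rewrite ler_nat.
  by apply/funext => n; rewrite /series/= mulr_sumr; apply: eq_bigr => k _; rewrite mulrA.
apply: filterS (borel_cantelli_real mF Fu cu) => w [J _ HJ].
exists (2 ^ (J + K))%N => // n /= Jn.
have n0 : (0 < n)%N by apply: leq_trans Jn; rewrite expn_gt0.
(* [n] lies in the dyadic block from [2 ^ i] to [2 ^ i.+1], on which [ln (ln n)] is at least
   [l i]. *)
pose i := trunc_log 2 n.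
have Ji : (J + K <= i)%N by exact: trunc_log_max.
have Ki : (K <= i)%N by rewrite (leq_trans _ Ji)// leq_addl.
have i0 : (0 < i)%N by rewrite (leq_trans _ Ki)// (leq_trans _ (leq_maxr _ _)).
have := HJ (i - K)%N; rewrite /= leq_subRL// [(K + J)%N]addnC => /(_ Ji).
rewrite /F/= subnK// => nF.
have [le_n n_lt] : (2 ^ i <= n)%N /\ (n < 2 ^ i.+1)%N.
  by split; [exact: trunc_logP|exact: trunc_log_ltn].
rewrite leNgt; apply/negP => nlt; apply: nF; exists n; first exact: ltnW.
apply: le_trans (ltW nlt); rewrite /r -/A ler_wpM2l//; first by rewrite addr_ge0// mulr_ge0.
have li : 0 <= l i by rewrite -(subnK Ki).
rewrite -sqrtrM// mulrC ler_wsqrtr// ler_pM// ?ler_nat//.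
exact: dyadic_log_le.
Qed.

End bounded_increments.

Variables (D : G * G -> R) (p C : R).
Hypothesis mD : measurable_fun setT D.
Hypothesis iD : forall s, nu.-integrable setT (EFin \o (fun x => D (s, x))).
Hypothesis D0 : forall s, \int[nu]_x D (s, x) = 0.
Hypothesis DC : forall s, (\int[nu]_x (`|D (s, x)| `^ p)%:E <= C%:E)%E.

(** The bound [B] depends on the path, through the finitely many increments that exceed their
    truncation level. *)
Lemma increment_sum_lil : 2 < p -> {ae P, forall w, exists B,
  \forall n \near \oo, `|increment_sum X (fun=> D) n w| <=
    B * Num.sqrt (n%:R * ln (ln n%:R))}.
Proof.
move=> p2; have p1 : 1 <= p by lra.
have p0 : 0 < p by lra.
have C0 := moment_bound_ge0 DC.
(* [1 / p < beta < 1 / 2] and [1 / 2 <= beta (p - 1)]: truncation at [k ^ beta] is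
   eventually vacuous, keeps the exponential bound, and shifts means by
   [O(k ^ (- 1/2))]. *)
pose beta := 4^-1 + (2 * p)^-1.
have pV : p * p^-1 = 1 by rewrite divff// gt_eqF.
have betaE : beta * p = p / 4 + 2^-1.
  by rewrite /beta invfM mulrDl mulrC; lra.
have beta0 : 0 <= beta by rewrite addr_ge0// invr_ge0 mulr_ge0// ltW.
have beta1 : beta < 2^-1.
  by rewrite -(ltr_pM2r p0) betaE; lra.
have beta2 : 2^-1 <= beta * (p - 1).
  rewrite mulrBr mulr1 betaE; lra.
pose t k : R := k.+2%:R `^ beta.
have t0 k : 0 < t k by rewrite powR_gt0 ?ltr0n.
have ct : cvgn (series (fun k => t k `^ (- p))).
  have e0 : 0 < beta * p - 1 by rewrite betaE; lra.
  have := @cvg_series_power_increments R (fun k => k.+1%:R) _ (fun k => ltr0Sn _ k) _ e0.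
  move=> H; rewrite (_ : (fun k => _) = (fun k => (k.+2%:R - k.+1%:R) * k.+2%:R `^ (- (1 + (beta * p - 1))))).
    by apply: H => k; rewrite ler_nat.
  apply/funext => k; rewrite -(natr1 k.+1) (addrC k.+1%:R) addrK mul1r nat1r /t -powRrM.
  by congr (_ `^ _); lra.
pose Z k := truncated_increment nu D (t k).
have bZ k := truncated_increment_bounded nu mD (ltW (t0 k)).
have bZs k s : bounded_measurable (t k + t k) (fun x => Z k (s, x)).
  split; last by move=> x; exact: (bZ k).2.
  by apply: (measurableT_comp (bZ k).1); exact: pair1_measurable.
have Zb k z : `|Z k z| <= 2 * k.+2%:R `^ beta.
  by apply: le_trans ((bZ k).2 z) _; rewrite mulr_natl mulr2n.
have Z0 k s : \int[nu]_x Z k (s, x) = 0 by exact: (truncated_increment_mean0 nu mD s (ltW (t0 k))).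
pose V := 1 + 1 * C.
have V0 : 0 <= V by rewrite addr_ge0// mulr_ge0.
have Zv k s : \int[nu]_x (Z k (s, x)) ^+ 2 <= V.
  apply: (truncated_increment_variance mD DC) => //; first exact: ltW.
  move=> x; rewrite mul1r /truncate; case: ifPn => _; last first.
    by rewrite expr0n addr_ge0// powR_ge0.
  rewrite -[leLHS]real_normK ?num_real//; set y := `|D (s, x)|.
  have y0 : 0 <= y by exact: normr_ge0.
  have [y1|y1] := leP y 1.
    by apply: ler_wpDr; [exact: powR_ge0|exact: exprn_ile1].
  apply: ler_wpDl => //; rewrite -powR_mulrn//.
  by apply: ler_powR; exact: ltW.
have upper := increment_sum_upper_lil (fun k => (bZ k).1) (ler0n R 2) beta0 beta1
  V0 Zb Z0 Zv.
have lower : {ae P, forall w, \forall n \near \oo,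
    increment_sum X (fun k z => - Z k z) n w <=
    (4 * V + 2) * Num.sqrt (n%:R * ln (ln n%:R))}.
  apply: (@increment_sum_upper_lil _ 2 beta) => //.
  - by move=> k; apply: measurableT_comp => //; exact: (bZ k).1.
  - by move=> k z; rewrite normrN.
  - move=> k s; under eq_Rintegral do rewrite -mulN1r.
    rewrite RintegralZl//; last exact: (bounded_measurable_integrable nu (bZs k s)).
    by rewrite Z0 mulr0.
  - by move=> k s; under eq_Rintegral do rewrite sqrrN; exact: Zv.
have evt := eventually_truncated G_compact G_metrizable X_iid mD p1 DC t0 ct.
have [N2 HN2] := @iterated_log_large R 2 1.
move: upper lower evt; apply: filterS3 => w [K1 _ up] [K2 _ lo] [K _ tr].
pose Dk k := D (walk X k w, X k w).
pose mk k := truncated_mean nu D (t k) (walk X k w).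
pose e k := Dk k - Z k (walk X k w, X k w) - mk k.
have e0 k : (K <= k)%N -> e k = 0.
  move=> /tr Dt; rewrite /e /mk /Z /truncated_increment/= /truncate /Dk Dt; ring.
pose E := `|\sum_(k < K) e k|.
have split_sum n : increment_sum X (fun=> D) n w =
    increment_sum X Z n w + (\sum_(k < n) mk k + \sum_(k < n) e k).
  rewrite /increment_sum -!big_split/=; apply: eq_bigr => k _; rewrite /e /Dk; ring.
have mean_le n : `|\sum_(k < n) mk k| <= 2 * C * Num.sqrt n%:R.
  apply: le_trans (ler_norm_sum _ _ _) _.
  apply: (@le_trans _ _ (\sum_(k < n) C * k.+1%:R `^ (- 2^-1))); last first.
    by rewrite -mulr_sumr [2 * C]mulrC -mulrA ler_wpM2l// sum_inv_sqrt_le.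
  apply: ler_sum => k _.
  apply: le_trans (truncated_mean_le mD p1 iD D0 DC _ (t0 k)) _.
  rewrite mulrC ler_wpM2l// /t -powRrM.
  apply: (@le_trans _ _ (k.+2%:R `^ (- 2^-1))).
    by apply: ler_powR; rewrite ?ler1n//; lra.
  rewrite !powRN lef_pV2 ?posrE ?powR_gt0 ?ltr0n//.
  by apply: ge0_ler_powR; rewrite ?nnegrE ?ler_nat.
(* The centred truncated sum gives [4 * V + 2], the truncated means [2 * C], the finitely many
   truncation errors [E]. Past [N2] the iterated logarithm is at least [1], so the last two are
   absorbed by the normalization. *)
exists (4 * V + 2 + 2 * C + E); exists (maxn (maxn K1 K2) (maxn K (maxn N2 1))) => // n /=.
rewrite !geq_max => /andP[/andP[K1n K2n] /andP[Kn /andP[N2n n1]]].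
have ll1 : 1 <= ln (ln n%:R) :> R by exact: HN2 N2n.
set S := Num.sqrt (n%:R * _).
have nS : Num.sqrt n%:R <= S.
  by rewrite ler_wsqrtr// -[leLHS]mulr1 ler_wpM2l.
have S1 : 1 <= S.
  by rewrite -sqrtr1 ler_wsqrtr// mulr_ege1// ler1n.
have eE : \sum_(k < n) e k = \sum_(k < K) e k.
  rewrite -(big_mkord xpredT e) (@big_cat_nat _ _ _ K)//= big_mkord.
  by rewrite [X in _ + X]big_nat [X in _ + X]big1 ?addr0// => k /andP[Kk _]; exact: e0.
have MZ : `|increment_sum X Z n w| <= (4 * V + 2) * S.
  rewrite ler_norml up// andbT lerNl; apply: le_trans (lo n K2n).
  by rewrite /increment_sum sumrN.
rewrite split_sum eE; apply: le_trans (ler_normD _ _) _.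
rewrite -2!addrA 2!mulrDl ?addrA; apply: le_trans (lerD MZ (ler_normD _ _)) _.
have H1 : 2 * C * Num.sqrt n%:R <= 2 * C * S by rewrite ler_wpM2l// mulr_ge0.
have H2 : E * 1 <= E * S by rewrite ler_wpM2l// normr_ge0.
have := mean_le n; rewrite -/E; lra.
Qed.

End law_of_iterated_logarithm.

(** * From the increments back to the walk *)

Section walk_sums.
Context {R : realType} {dO d : measure_display} {Omega : measurableType dO}
  {G : borelGroupType d} {P : probability Omega R}.
Hypothesis G_compact : compact [set: G].
Hypothesis G_metrizable : metrizable R G.
Variables (nu : probability G R) (X : nat -> {RV P >-> G}).
Hypothesis X_iid : iid_with_law nu X.

Lemma sup_moment_bound (f : G -> R) (p : R) : measurable_fun [set: G] f ->
  (ereal_sup (range (fun c : G =>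
     'E_P[fun w => (`|f (c * X 0%N w)%g| `^ p)%R])) < +oo)%E ->
  exists C : R, forall c : G, (\int[nu]_x (`|f (c * x)%g| `^ p)%:E <= C%:E)%E.
Proof.
move=> mf; set s := ereal_sup _ => soo; exists (fine s) => c.
have mpow : measurable_fun setT (fun x => (`|f (c * x)%g| `^ p)%:E).
  apply/measurable_EFinP; apply: (measurableT_comp (measurable_powR p)).
  by apply: measurableT_comp => //; exact: (measurable_lmulg_comp G_compact G_metrizable).
have EE c' : ('E_P[fun w => (`|f (c' * X 0%N w)%g| `^ p)%R] =
    \int[P]_w (`|f (c' * X 0%N w)%g| `^ p)%:E)%E by rewrite unlock.
have le_s c' : ('E_P[fun w => (`|f (c' * X 0%N w)%g| `^ p)%R] <= s)%E.
  by apply: ereal_sup_ubound; exists c'.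
have s0 : (0 <= s)%E.
  by apply: le_trans (le_s 1%g); rewrite EE integral_ge0// => w _; rewrite lee_fin powR_ge0.
rewrite fineK ?ge0_fin_numE//; apply: le_trans (le_s c); rewrite EE.
rewrite -(eq_measure_integral (m1 := distribution P (X 0%N)) nu); last first.
  by move=> A mA _; exact: X_iid.2.
by rewrite ge0_integral_distribution// => y; rewrite lee_fin powR_ge0.
Qed.

Variables (f : G -> R) (D : G * G -> R) (h : G -> R) (L : R).
Hypothesis hL : forall x, `|h x| <= L.
Hypothesis fE : forall s x, f (s * x)%g = D (s, x) - h (s * x)%g + h s.

(** The coboundary telescopes to [h (S_0) - h (S_N)]. The increment with index [k] accounts for [f]
    at time [k + 1], which matches the range from [1] to [N] of the walk sum. *)
Lemma walk_sum_increment_sum N w :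
  `|walk_sum X f N w - increment_sum X (fun=> D) N w| <= 2 * L.
Proof.
have -> : walk_sum X f N w - increment_sum X (fun=> D) N w =
    h (walk X 0 w) - h (walk X N w).
  rewrite /walk_sum big_add1/= big_mkord; elim: N => [|N IH].
    by rewrite /increment_sum !big_ord0 !subrr.
  rewrite big_ord_recr/= increment_sumS walkS fE -walkS.
  by move: IH; lra.
by apply: le_trans (ler_normB _ _) _; rewrite mulr_natl mulr2n lerD.
Qed.

End walk_sums.

Lemma limn_esup_lty (R : realType) (u : nat -> R) (B : R) :
  (\forall n \near \oo, u n <= B) -> (limn_esup (EFin \o u) < +oo)%E.
Proof.
move=> uB; apply: (@le_lt_trans _ _ B%:E); last exact: ltry.
apply: (@le_trans _ _ (ereal_sup [set (EFin \o u) x | x in [set n | u n <= B]])).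
  by apply: ereal_inf_lbound; exists [set n | u n <= B].
by apply: ge_ereal_sup => _ [n /= un <-]; rewrite lee_fin.
Qed.

Theorem theorem3 (R : realType) (d : measure_display) (G : borelGroupType d)
    (G_compact : compact [set: G]) (G_metrizable : metrizable R G)
    (mu : probability G R) (mu_haar : normalized_haar mu)
    (nu : probability G R)
    (dO : measure_display) (Omega : measurableType dO)
    (P : probability Omega R) (X : nat -> {RV P >-> G})
    (X_iid : iid_with_law nu X)
    (nu_adapted : adapted nu)
    (nu_abs : exists k : nat,
      (1 <= k)%N /\ abs_part_neq0 (convolution_power nu k) mu)
    (f : G -> R) (f_measurable : measurable_fun [set: G] f)
    (f_mean0 : (\int[mu]_x (f x)%:E = 0)%E) :
  (forall p : R, 1 <= p <= 2 ->
    (ereal_sup (range (fun c : G =>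
       'E_P[fun w => (`|f (c * X 0%N w)%g| `^ p)%R])) < +oo)%E ->
    forall (m : nat) (eps : R), (1 <= m)%N -> 0 < eps ->
    {ae P, forall w,
      (walk_sum X f N w / (varphi m eps N) `^ (p^-1)) @[N --> \oo] --> 0}) /\
  (forall p : R, 2 < p ->
    (ereal_sup (range (fun c : G =>
       'E_P[fun w => (`|f (c * X 0%N w)%g| `^ p)%R])) < +oo)%E ->
    {ae P, forall w,
      (limn_esup (fun N : nat =>
         (`|walk_sum X f N w| / Num.sqrt (N%:R * ln (ln N%:R)))%:E)
       < +oo)%E}).
Proof.
split.
- move=> p /andP[p1 p2] soo m eps m1 eps0.
  have p0 : 0 < p by exact: lt_le_trans ltr01 p1.
  have [C f_bound] := sup_moment_bound G_compact G_metrizable X_iid f_measurable soo.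
  have [D [h [L [C' [mD hL D0 DC fE]]]]] := martingale_decomposition G_compact
    G_metrizable mu_haar nu_adapted nu_abs f_measurable f_mean0 p1 f_bound.
  have [N lg1] := iterated_logs_ge1 R m.
  (* Freezing the argument below [N] makes the norming sequence positive and monotone from the
     start; it agrees with the intended one from [N] on. *)
  pose phi n : R := varphi m eps (maxn n N); pose a n := phi n `^ p^-1.
  have phi0 n : 0 < phi n by apply: (varphi_gt0 lg1 eps0); exact: leq_maxr.
  have a0 n : 0 < a n by exact: powR_gt0.
  have pV0 : 0 < p^-1 by rewrite invr_gt0.
  have ha : {homo a : k n / (k <= n)%N >-> k <= n}.
    move=> k n kn; apply: ge0_ler_powR; rewrite ?nnegrE ?(ltW (phi0 _)) ?(ltW pV0)//.
    apply: (varphi_homo lg1 eps0 m1); first exact: leq_maxr.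
    by rewrite geq_max leq_maxr andbT (leq_trans kn)// leq_maxl.
  have aV n : a n `^ (- p) = (phi n)^-1.
    by rewrite /a -powRrM mulrN mulVf ?gt_eqF// powR_inv1// ltW.
  have aoo : a n @[n --> \oo] --> +oo.
    apply/cvgryPge => A; exists (Num.truncn (`|A| `^ p)).+1 => // n /= An.
    apply: le_trans (ler_norm A) _.
    have -> : `|A| = (`|A| `^ p) `^ p^-1 by rewrite -powRrM mulfV ?gt_eqF// powRr1.
    apply: ge0_ler_powR; rewrite ?nnegrE ?powR_ge0 ?(ltW (phi0 _)) ?(ltW pV0)//.
    apply: le_trans (varphi_ge lg1 eps0 (leq_maxr n N)).
    apply: ltW; apply: lt_le_trans (truncnS_gt _) _.
    by rewrite ler_nat (leq_trans An)// leq_maxl.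
  have ca : cvgn (series (fun k => a k `^ (- p))).
    rewrite (_ : (fun k => _) = fun k => (phi k)^-1); last by apply/funext => k.
    exact: (cvg_series_inv_varphi lg1 eps0 m1).
  have := increment_strong_law G_compact G_metrizable X_iid mD p1
    (fun s => (D0 s).1) (fun s => (D0 s).2) DC p2 a0 ha aoo ca.
  apply: filterS => w cM.
  have near_a : \forall n \near \oo, walk_sum X f n w / a n =
      walk_sum X f n w / varphi m eps n `^ p^-1.
    exists N => [//|n Nn]; rewrite /mkset /a /phi.
    by rewrite (maxn_idPl (Nn : (N <= n)%N)).
  suff: walk_sum X f n w / a n @[n --> \oo] --> 0.
    exact: cvg_trans (near_eq_cvg near_a).
  have ia : (a n)^-1 @[n --> \oo] --> 0.
    by apply/gtr0_cvgV0; [exact: nearW|].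
  (* The coboundary is bounded by [2 * L], so dividing by the diverging [a n] removes it. *)
  rewrite (_ : (fun n => _) = fun n => increment_sum X (fun=> D) n w / a n +
    (walk_sum X f n w - increment_sum X (fun=> D) n w) * (a n)^-1); last first.
    by apply/funext => n; rewrite -mulrDl addrC subrK.
  rewrite -[0]addr0; apply: cvgD => //.
  apply/norm_cvg0P.
  apply: (@squeeze_cvgr _ _ _ _ (fun=> 0) (fun n => 2 * L * (a n)^-1)).
  + apply: nearW => n; rewrite normr_ge0 normrM normfV (gtr0_norm (a0 n)).
    rewrite ler_wpM2r ?invr_ge0 ?(ltW (a0 n))//; exact: walk_sum_increment_sum.
  + exact: cvg_cst.
  + by rewrite -[X in _ --> X](mulr0 (2 * L)); apply: cvgMr.
- move=> p p2 soo; have p1 : 1 <= p by lra.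
  have [C f_bound] := sup_moment_bound G_compact G_metrizable X_iid f_measurable soo.
  have [D [h [L [C' [mD hL D0 DC fE]]]]] := martingale_decomposition G_compact
    G_metrizable mu_haar nu_adapted nu_abs f_measurable f_mean0 p1 f_bound.
  have := increment_sum_lil G_compact G_metrizable X_iid mD
    (fun s => (D0 s).1) (fun s => (D0 s).2) DC p2.
  apply: filterS => w [B [N1 _ HB]].
  have [N2 HN2] := @iterated_log_large R 2 1.
  (* [B] comes from the martingale part and [2 * L] from the coboundary, whose normalization is at
     least [1] past [N2]. *)
  apply: (@limn_esup_lty _ _ (B + 2 * L)); exists (maxn N1 (maxn N2 1)) => // n /=.
  rewrite !geq_max => /andP[N1n /andP[N2n n1]].
  have ll1 : 1 <= ln (ln n%:R) :> R by exact: HN2 N2n.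
  set S := Num.sqrt _.
  have S1 : 1 <= S by rewrite -sqrtr1 ler_wsqrtr// mulr_ege1// ler1n.
  have S0 : 0 < S by exact: lt_le_trans S1.
  rewrite ler_pdivrMr// mulrDl.
  have H := walk_sum_increment_sum X hL fE n w.
  have L0 : 0 <= L := le_trans (normr_ge0 _) (hL 1%g).
  have H2 : 2 * L * 1 <= 2 * L * S by rewrite ler_wpM2l// mulr_ge0.
  rewrite -[X in `|X|](subrK (increment_sum X (fun=> D) n w)).
  apply: le_trans (ler_normD _ _) _; have := HB n N1n; rewrite -/S; lra.
Qed.
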